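(* Let $X$ be a continuous process with $X_0=0$. Then $X$ is of class $(\Sigma)$ if and only if $|X|$ is of class $(\Sigma)$.
   Context: A filtered probability space $(\Omega,(\mathcal F_t)_{t\ge 0},\mathcal F,\mathbb P)$ satisfying the usual conditions is fixed, and processes are understood to be adapted to $(\mathcal F_t)_{t\ge0}$. A stochastic process $X$ is of class $(\Sigma)$ if it decomposes as $X=M+V$, where (1) $M$ is a càdlàg local martingale; (2) $V$ is an adapted continuous finite variation process starting at $0$; (3) $\int_0^t 1_{\{X_u\neq 0\}}\,dV_u=0$ for all $t\ge 0$. *)

(* Defs.v *)
From HB Require Import structures.
From mathcomp Require Import all_boot all_order all_algebra.
From mathcomp Require Import all_classical all_reals all_analysis.

Set Implicit Arguments.
Unset Strict Implicit.
Unset Printing Implicit Defensive.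

Import Order.TTheory GRing.Theory Num.Theory.
Import numFieldNormedType.Exports.

Local Open Scope classical_set_scope.
Local Open Scope ring_scope.

(* A process is a function X : R -> T -> R, X t w being its value at time t and
   sample point w; only times t >= 0 matter.  Path properties and identities
   between processes are understood up to an evanescent set: they are required
   for almost every w, simultaneously for all times. *)

Section paths.
Context {R : realType}.
Implicit Types f : R -> R.

Definition continuous_path f : Prop := {within `[0, +oo[, continuous f}.

Definition cadlag_path f : Prop :=
  (forall t, 0 <= t -> f u @[u --> t^'+] --> f t) /\
  (forall t, 0 < t -> cvg (f u @[u --> t^'-])).

Definition finite_variation_path f : Prop :=
  forall t, 0 <= t -> bounded_variation 0 t f.

(* On [0, +oo[ a path f of finite variation is the difference of its
   increasing part pos_tv 0 f and its decreasing part neg_tv 0 f.  Both are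
   frozen at their value at 0 on negative times. *)
Definition increasing_part f (x : R) : R := fine (pos_tv 0 f (Num.max 0 x)).

Definition decreasing_part f (x : R) : R := fine (neg_tv 0 f (Num.max 0 x)).

Definition is_cumulative f : Prop :=
  {homo f : x y / x <= y} /\ right_continuous f.

(* f bundled with its proofs of monotonicity and right-continuity; the junk
   value idfun is never used for the parts of a continuous path of finite
   variation: see decreasing_part_is_cumulative, increasing_part_is_cumulative *)
Definition to_cumulative f : cumulative R R :=
  match pselect (is_cumulative f) with
  | left h => HB.pack_for (cumulative R R) f
                (isCumulative.Build R _ R f (proj1 h) (proj2 h))
  | right _ => idfun
  end.

(* \int_{]0, t]} h df for the signed Lebesgue-Stieltjes measure df of f *)
Definition stieltjes_integral (f h : R -> R) (t : R) : R :=
  \int[lebesgue_stieltjes_measure (to_cumulative (increasing_part f))]_(u in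
    `]0, t]) h u -
  \int[lebesgue_stieltjes_measure (to_cumulative (decreasing_part f))]_(u in
    `]0, t]) h u.

Lemma to_cumulativeE f : is_cumulative f -> to_cumulative f = f :> (R -> R).
Proof. by rewrite /to_cumulative; case: pselect. Qed.

Lemma decreasing_part_is_cumulative f :
  continuous_path f -> finite_variation_path f ->
  is_cumulative (decreasing_part f).
Proof.
move=> cf bvf; split.
  move=> x y xy; have m0 (z : R) : 0 <= Num.max 0 z by rewrite le_max lexx.
  have mxy : Num.max 0 x <= Num.max 0 y by rewrite ge_max m0 le_max xy orbT.
  apply: (fine_neg_tv_nondecreasing (bvf _ (m0 y))) => //.
    by rewrite in_itv/= m0.
  by rewrite in_itv/= m0 lexx.
move=> x; have [x0|x0] := ltP x 0.
  rewrite /decreasing_part (max_l (ltW x0)).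
  apply: cvg_near_cst; near=> u; rewrite max_l//.
  near: u; exact: nbhs_right_le.
rewrite /decreasing_part (max_r x0).
have fx : f @ x^'+ --> f x.
  have x1 : x < x + 1 by rewrite ltrDl.
  have : {within `[x, x + 1], continuous f}.
    apply: continuous_subspaceW cf => u /=; rewrite !in_itv/= andbT.
    by move=> /andP[xu _]; exact: le_trans xu.
  by move=> /(continuous_within_itvP _ x1)[].
have x1 : x < x + 1 by rewrite ltrDl.
have bv1 : bounded_variation 0 (x + 1) f by apply: bvf; rewrite addr_ge0.
apply: cvg_trans (neg_tv_right_continuous x0 x1 bv1 fx).
apply: near_eq_cvg; near=> u => /=; rewrite max_r// (le_trans x0)//.
Unshelve. all: by end_near. Qed.

Lemma increasing_part_is_cumulative f :
  continuous_path f -> finite_variation_path f ->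
  is_cumulative (increasing_part f).
Proof.
move=> cf bvf; apply: (@decreasing_part_is_cumulative (\- f)).
  by move=> x; exact: continuousN (cf x).
by move=> t t0; apply/bounded_variationN; exact: bvf.
Qed.

Lemma increasing_decreasing_partE f t :
  finite_variation_path f -> 0 <= t ->
  f t = increasing_part f t - decreasing_part f t.
Proof.
move=> bvf t0; rewrite /increasing_part /decreasing_part (max_r t0).
by rewrite (bounded_variation_pos_neg_tvE (bvf t t0))// in_itv/= t0 lexx.
Qed.

End paths.

Section processes.
Context {d : measure_display} {T : measurableType d} {R : realType}.
Variables (P : probability T R) (F : R -> set (set T)).
Implicit Types (G : set (set T)) (X M V : R -> T -> R).

Definition filtration : Prop :=
  [/\ forall t, 0 <= t -> sigma_algebra [set: T] (F t),
      forall t, 0 <= t -> F t `<=` measurable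
    & forall s t, 0 <= s -> s <= t -> F s `<=` F t].

(* The second clause entails completeness of the probability space, since
   F 0 is contained in the ambient sigma-algebra. *)
Definition usual_conditions : Prop :=
  (forall t, 0 <= t -> F t = \bigcap_(s in [set s | t < s]) F s) /\
  (forall N, P.-negligible N -> F 0 N).

Definition measurable_wrt G (Y : T -> R) : Prop :=
  forall B, measurable B -> G (Y @^-1` B).

Definition adapted X : Prop := forall t, 0 <= t -> measurable_wrt (F t) (X t).

(* Z is a version of the conditional expectation of Y given G *)
Definition is_cond_expectation G (Y Z : T -> R) : Prop :=
  [/\ measurable_wrt G Z,
      P.-integrable [set: T] (EFin \o Z)
    & forall A, G A -> \int[P]_(w in A) Z w = \int[P]_(w in A) Y w].

Definition martingale M : Prop :=
  [/\ adapted M,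
      forall t, 0 <= t -> P.-integrable [set: T] (EFin \o M t)
    & forall s t, 0 <= s -> s <= t -> is_cond_expectation (F s) (M t) (M s)].

Definition stopping_time (tau : T -> \bar R) : Prop :=
  (forall w, (0 <= tau w)%E) /\
  (forall t, 0 <= t -> F t [set w | (tau w <= t%:E)%E]).

Definition stopped M (tau : T -> \bar R) : R -> T -> R :=
  fun t w => M (fine (mine t%:E (tau w))) w.

(* The factor 1_{tau_n > 0} lets M 0 be an arbitrary F 0-measurable variable *)
Definition local_martingale M : Prop :=
  adapted M /\
  exists tau : nat -> T -> \bar R,
    [/\ forall n, stopping_time (tau n),
        {ae P, forall w, nondecreasing_seq (tau ^~ w) /\
                         tau ^~ w @ \oo --> +oo%E}
      & forall n, martingale (fun t w =>
          \1_[set w' | (0 < tau n w')%E] w * stopped M (tau n) t w)].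

Definition class_Sigma X : Prop :=
  exists M V,
    [/\ {ae P, forall w, forall t, 0 <= t -> X t w = M t w + V t w},
        local_martingale M /\ {ae P, forall w, cadlag_path (M ^~ w)},
        adapted V /\
        {ae P, forall w, [/\ V 0 w = 0, continuous_path (V ^~ w)
                           & finite_variation_path (V ^~ w)]}
      & {ae P, forall w, forall t, 0 <= t ->
          stieltjes_integral (V ^~ w) \1_[set u | X u w != 0] t = 0}].

End processes.

(* Main.v *)
Require Import Defs.
From mathcomp Require Import all_boot all_order all_algebra.
From mathcomp Require Import all_classical all_reals all_analysis.
From mathcomp Require Import measurable_realfun.
From mathcomp Require Import ring lra.
Import Order.TTheory GRing.Theory Num.Theory.
Import numFieldNormedType.Exports.

Set Implicit Arguments.
Unset Strict Implicit.
Unset Printing Implicit Defensive.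

Local Open Scope classical_set_scope.
Local Open Scope ring_scope.

(** The processes [X] and [|X|] have the same excursions away from 0 up to
    signs, so the point is that the signs of the excursions of a process of
    class (Sigma) may be changed: if [X^+ + c0 X^-] is of class (Sigma) with
    [c0 <> 0], so is [X^+ + c X^-] for every [c <> 0]
    ([class_Sigma_rescale_negative]). The theorem is the case of the
    coefficients -1 and 1.

    In the decomposition [M + V] of [X^+ + c0 X^-] the paths of [V] are flat
    where [X <> 0] ([flat_of_stieltjes_integral]), hence [M] moves exactly as
    [X] while [X > 0]. This alone implies that [X^+] is the sum of a local
    martingale [N], morally the integral of the indicator of [X > 0] against
    [M], and of a nondecreasing process which is flat where [X <> 0]
    ([positive_part_decomposition]); the same holds for [X^-] with [M / c0], and
    the two decompositions can be combined linearly.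

    The process [N] is a limit of discrete sums. On a time mesh fine enough for
    the oscillations of [X] to be at most [e], the sum of the increments of [M]
    over the mesh intervals at whose start [X > e] differs from [(X - e)^+] by a
    process that is nondecreasing, up to an error of order [e], and flat where
    [X] exceeds [2 e] or is below [- e], because [y |-> (y - e)^+] is convex
    ([tanaka_sum_almost_nondecreasing]). These sums are martingales if [M] is
    one, and their second moments are bounded by that of [M], because increments
    are orthogonal ([tanaka_sum_L2]). They need not converge as the mesh is
    refined, but midpoints of them do so in mean square, by the parallelogram
    identity ([midpoint_cauchy]), and then locally uniformly, almost surely, by
    Doob's maximal inequality ([doob_maximal]) and the Borel-Cantelli lemma.
    Monotonicity and flatness, being preserved by midpoints and limits, hold for
    [X^+ - N].

    Second moments require bounded martingales. So [M] is stopped when it leaves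
    [[-n, n]], as well as along its own localizing sequence ([localize]), which
    rests on optional stopping ([optional_stopping]); the construction of [N]
    takes care of all [n] simultaneously, by minimising a weighted sum of second
    moments. *)

(** * Discrete Tanaka sums along a path *)

Section tanaka_sum.
Context {R : realType}.
Implicit Types (x m : R -> R) (e h s t : R).

(** A Riemann sum, stopped at time [t], of the integral of the indicator of
    [x > e] against [m], on the mesh [h]. *)
Definition tanaka_sum x m e h (K : nat) t : R :=
  \sum_(i < K) (e < x (i%:R * h))%R%:R *
    (m (Num.min (i.+1%:R * h) t) - m (Num.min (i%:R * h) t)).

Lemma tanaka_sum_horizon x m e h K t : K%:R * h <= t -> 0 <= h ->
  tanaka_sum x m e h K t = tanaka_sum x m e h K (K%:R * h).
Proof.
move=> Kt h0; apply: eq_bigr => i _.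
have iK j : (j <= K)%N -> Num.min (j%:R * h) t = Num.min (j%:R * h) (K%:R * h).
  move=> jK; have jh : j%:R * h <= K%:R * h by rewrite ler_wpM2r// ler_nat.
  by rewrite !min_l// (le_trans jh).
by rewrite !iK// ltnW.
Qed.

Lemma tanaka_sumS_before x m e h K t : t <= K%:R * h -> 0 <= h ->
  tanaka_sum x m e h K.+1 t = tanaka_sum x m e h K t.
Proof.
move=> tK h0; rewrite /tanaka_sum big_ord_recr/= !min_r// ?subrr ?mulr0 ?addr0//.
by rewrite (le_trans tK)// ler_wpM2r// ler_nat.
Qed.

Lemma tanaka_sumS_in x m e h K t : 0 <= h -> K%:R * h <= t <= K.+1%:R * h ->
  tanaka_sum x m e h K.+1 t = tanaka_sum x m e h K (K%:R * h) +
    (e < x (K%:R * h))%R%:R * (m t - m (K%:R * h)).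
Proof.
move=> h0 /andP[Kt tK]; rewrite {1}/tanaka_sum big_ord_recr/= (min_r tK) (min_l Kt).
by congr (_ + _); exact: tanaka_sum_horizon.
Qed.

Variables (x m : R -> R) (e h : R).
Hypotheses (h0 : 0 <= h) (e0 : 0 <= e).
Hypothesis follows : forall s t, 0 <= s -> s <= t ->
  (forall u, s <= u <= t -> 0 < x u) -> m t - m s = x t - x s.

Definition small_oscillation K := forall i : nat, (i < K)%N ->
  forall u, i%:R * h <= u <= i.+1%:R * h -> `|x u - x (i%:R * h)| <= e.

(* what the Tanaka sum leaves of (x - e)^+: a discrete local time *)
Let b K t := Num.max (x t - e) 0 - tanaka_sum x m e h K t.

Let step_active K t : small_oscillation K.+1 ->
  K%:R * h <= t <= K.+1%:R * h -> e < x (K%:R * h) ->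
  m t - m (K%:R * h) = x t - x (K%:R * h).
Proof.
move=> osc /andP[Kt tK] ex; apply: follows => //; first by rewrite mulr_ge0.
move=> u /andP[Ku ut]; have := osc K (ltnSn K) u.
rewrite Ku (le_trans ut tK) => /(_ isT); rewrite ler_norml => /andP[+ _].
by lra.
Qed.

(* the contribution of one mesh interval is a convexity defect *)
Let step_b K t : small_oscillation K.+1 -> K%:R * h <= t <= K.+1%:R * h ->
  b K (K%:R * h) <= b K.+1 t <= b K (K%:R * h) + e.
Proof.
move=> osc tK; have := step_active osc tK; rewrite /b tanaka_sumS_in//.
have := osc K (ltnSn K) t tK; rewrite ler_norml.
set p := x t; set q := x _; set z := tanaka_sum _ _ _ _ _ _.
have [eq|qe] := ltP e q => osc'; last first.
  move=> _; rewrite mul0r addr0.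
  have -> : Num.max (q - e) 0 = 0 by apply: max_r; lra.
  by case: (leP (p - e) 0) => ?; lra.
move=> /(_ isT) ->; rewrite mul1r.
have -> : Num.max (q - e) 0 = q - e by apply: max_l; lra.
by case: (leP (p - e) 0) => ?; lra.
Qed.

Let b_before K t : t <= K%:R * h -> b K.+1 t = b K t.
Proof. by move=> tK; rewrite /b tanaka_sumS_before. Qed.

Let b_almost_nondecreasing K : small_oscillation K ->
  forall s t, 0 <= s -> s <= t -> t <= K%:R * h -> b K s <= b K t + e.
Proof.
have e0' := e0; elim: K => [|K IH] osc s t s0 st tK.
  rewrite mul0r in tK; have -> : s = t by lra.
  by rewrite lerDl.
have oscK : small_oscillation K by move=> i /ltnW iK; exact: osc.
have [tK'|Kt] := leP t (K%:R * h).
  by rewrite !b_before// ?IH//; exact: le_trans tK'.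
have [sK|Ks] := leP s (K%:R * h).
  rewrite b_before//; have := IH oscK _ _ s0 sK (lexx _).
  have := step_b osc (_ : K%:R * h <= t <= _); rewrite (ltW Kt) tK => /(_ isT).
  by lra.
have := step_b osc (_ : K%:R * h <= t <= _); rewrite (ltW Kt) tK => /(_ isT).
have := step_b osc (_ : K%:R * h <= s <= _).
by rewrite (ltW Ks) (le_trans st tK) => /(_ isT); lra.
Qed.

Let b_cst_pos K : small_oscillation K ->
  forall s t, 0 <= s -> s <= t -> t <= K%:R * h ->
  (forall u, s <= u <= t -> 2 * e < x u) -> b K s = b K t.
Proof.
have e0' := e0; elim: K => [|K IH] osc s t s0 st tK xpos.
  by rewrite mul0r in tK; have -> : s = t by lra.
have oscK : small_oscillation K by move=> i /ltnW iK; exact: osc.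
have [tK'|Kt] := leP t (K%:R * h).
  by rewrite !b_before ?(le_trans st)//; exact: IH.
have inK u : s <= u <= t -> K%:R * h <= u -> e < x (K%:R * h) ->
    b K.+1 u = b K (K%:R * h).
  move=> /[dup] sut /andP[su ut] Ku ex.
  have uK : K%:R * h <= u <= K.+1%:R * h by rewrite Ku (le_trans ut).
  have := xpos _ sut; have := step_active osc uK ex.
  rewrite /b tanaka_sumS_in// ex mul1r => -> xu.
  by rewrite !max_l; lra.
have [sK|Ks] := leP s (K%:R * h).
  have KI : s <= K%:R * h <= t by rewrite sK ltW.
  rewrite b_before// (inK t) ?st ?lexx 1?ltW//; last first.
    by have := xpos _ KI; lra.
  by apply: IH => // u /andP[su ut]; apply: xpos; rewrite su (le_trans ut)// ltW.
have eK : e < x (K%:R * h).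
  have := osc K (ltnSn K) s; rewrite (ltW Ks) (le_trans st tK) => /(_ isT).
  by have := xpos s; rewrite lexx st ler_norml => /(_ isT); lra.
by rewrite !inK ?lexx ?st// ltW// (lt_le_trans Ks).
Qed.

Let b_cst_neg K : small_oscillation K ->
  forall s t, 0 <= s -> s <= t -> t <= K%:R * h ->
  (forall u, s <= u <= t -> x u < - e) -> b K s = b K t.
Proof.
have e0' := e0; elim: K => [|K IH] osc s t s0 st tK xneg.
  by rewrite mul0r in tK; have -> : s = t by lra.
have oscK : small_oscillation K by move=> i /ltnW iK; exact: osc.
have [tK'|Kt] := leP t (K%:R * h).
  by rewrite !b_before ?(le_trans st)//; exact: IH.
have inK u : s <= u <= t -> K%:R * h <= u -> x (K%:R * h) <= 0 ->
    b K.+1 u = b K (K%:R * h).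
  move=> /[dup] sut /andP[su ut] Ku ex.
  have uK : K%:R * h <= u <= K.+1%:R * h by rewrite Ku (le_trans ut).
  have xu := xneg _ sut; rewrite /b tanaka_sumS_in//.
  rewrite [e < _]ltNge (le_trans ex e0) mul0r addr0.
  by rewrite !max_r; lra.
have [sK|Ks] := leP s (K%:R * h).
  have KI : s <= K%:R * h <= t by rewrite sK ltW.
  rewrite b_before// (inK t) ?st ?lexx 1?ltW//; last first.
    by have := xneg _ KI; lra.
  by apply: IH => // u /andP[su ut]; apply: xneg; rewrite su (le_trans ut)// ltW.
have eK : x (K%:R * h) <= 0.
  have := osc K (ltnSn K) s; rewrite (ltW Ks) (le_trans st tK) => /(_ isT).
  by have := xneg s; rewrite lexx st ler_norml => /(_ isT); lra.
by rewrite !inK ?lexx ?st// ltW// (lt_le_trans Ks).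
Qed.

Let posE t : Num.max (x t) 0 - e <= Num.max (x t - e) 0 <= Num.max (x t) 0.
Proof. by have := e0; case: (leP (x t - e) 0); case: (leP (x t) 0); lra. Qed.

(** On a mesh interval with [x > e] at its start, [x] stays positive by
    [small_oscillation], so the sum moves exactly as [x]; on the others it does
    not move. As [y |-> (y - e)^+] is convex with slope 0 or 1, what is left of
    [(x - e)^+] increases from mesh point to mesh point, and the two flat cases
    below are those where [x] only visits one affine piece. The error [2 * e]
    covers the mesh interval that contains [s] and the passage from [(x - e)^+]
    to [x^+]. *)
Lemma tanaka_sum_almost_nondecreasing K : small_oscillation K ->
  forall s t, 0 <= s -> s <= t -> t <= K%:R * h ->
  Num.max (x s) 0 - tanaka_sum x m e h K s <=
  Num.max (x t) 0 - tanaka_sum x m e h K t + 2 * e.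
Proof.
move=> osc s t s0 st tK; have := b_almost_nondecreasing osc s0 st tK.
by rewrite /b; have := posE s; have := posE t; lra.
Qed.

Lemma tanaka_sum_flat_pos K : small_oscillation K ->
  forall s t, 0 <= s -> s <= t -> t <= K%:R * h ->
  (forall u, s <= u <= t -> 2 * e < x u) ->
  Num.max (x s) 0 - tanaka_sum x m e h K s =
  Num.max (x t) 0 - tanaka_sum x m e h K t.
Proof.
have e0' := e0; move=> osc s t s0 st tK xpos; have := b_cst_pos osc s0 st tK xpos; rewrite /b.
have := xpos s; have := xpos t; rewrite !lexx st => /(_ isT) xt /(_ isT) xs.
by rewrite !max_l; lra.
Qed.

Lemma tanaka_sum_flat_neg K : small_oscillation K ->
  forall s t, 0 <= s -> s <= t -> t <= K%:R * h ->
  (forall u, s <= u <= t -> x u < - e) ->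
  Num.max (x s) 0 - tanaka_sum x m e h K s =
  Num.max (x t) 0 - tanaka_sum x m e h K t.
Proof.
have e0' := e0; move=> osc s t s0 st tK xneg; have := b_cst_neg osc s0 st tK xneg; rewrite /b.
have := xneg s; have := xneg t; rewrite !lexx st => /(_ isT) xt /(_ isT) xs.
by rewrite !max_r; lra.
Qed.

End tanaka_sum.

(** * Continuous paths on the half-line *)

Section continuous_paths.
Context {R : realType}.
Implicit Types f g x : R -> R.

Lemma continuous_pathP f : continuous_path f <->
  forall t, 0 <= t -> forall e, 0 < e -> exists2 d, 0 < d &
    forall u, 0 <= u -> `|u - t| < d -> `|f u - f t| <= e.
Proof.
split => [/subspace_continuousP cf t t0 e e0|H].
  have /cvgrPdist_le/(_ e e0)[d /= d0 dP] := cf t (ltac:(by rewrite /= in_itv/= t0)).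
  exists d => // u u0 ut; rewrite distrC; apply: dP; first by rewrite /= distrC.
  by rewrite /= in_itv/= u0.
apply/subspace_continuousP => t /=; rewrite in_itv/= andbT => t0.
apply/cvgrPdist_le => e /(H t t0)[d d0 dP]; exists d => // u /=.
by rewrite in_itv/= andbT distrC => ut u0; rewrite distrC dP.
Qed.

(** Freezing a path before time 0 reduces closure properties of continuous
    paths to those of continuous functions on the whole line. *)
Lemma continuous_path_max0 f :
  continuous_path f <-> continuous (fun t : R => f (Num.max 0 t)).
Proof.
have m0 (t : R) : 0 <= Num.max 0 t by rewrite le_max lexx.
split => [/continuous_pathP cf t|cf].
  apply/cvgrPdist_le => e e0; have [d d0 dP] := cf _ (m0 t) e e0.
  exists d => // u /= ut; rewrite distrC; apply: dP => //.
  apply: le_lt_trans ut; have := ler_norm (t - u); have := ler_norm (u - t).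
  rewrite (distrC t u) ler_distl.
  by case: (leP 0 u); case: (leP 0 t); have := normr_ge0 (u - t); lra.
apply/continuous_pathP => t t0 e e0.
have /cvgrPdist_le/(_ e e0)[d /= d0 dP] := cf t.
exists d => // u u0 ut; have := dP u; rewrite /= distrC => /(_ ut).
by rewrite !max_r// distrC.
Qed.

Lemma eq_continuous_path f g : (forall t, 0 <= t -> f t = g t) ->
  continuous_path f -> continuous_path g.
Proof.
move=> fg; apply: subspace_eq_continuous => t.
by rewrite inE/= in_itv/= andbT; exact: fg.
Qed.

Lemma continuous_path_cst (a : R) : continuous_path (fun=> a).
Proof. by apply/continuous_path_max0; exact: cst_continuous. Qed.

Lemma continuous_pathD f g :
  continuous_path f -> continuous_path g -> continuous_path (fun t => f t + g t).
Proof.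
move=> /continuous_path_max0 cf /continuous_path_max0 cg.
by apply/continuous_path_max0 => t; apply: cvgD; [exact: cf|exact: cg].
Qed.

Lemma continuous_pathZ (a : R) f :
  continuous_path f -> continuous_path (fun t => a * f t).
Proof.
move=> /continuous_path_max0 cf; apply/continuous_path_max0 => t.
by apply: cvgM; [exact: cvg_cst|exact: cf].
Qed.

Lemma continuous_pathB f g :
  continuous_path f -> continuous_path g -> continuous_path (fun t => f t - g t).
Proof.
move=> cf cg; apply: continuous_pathD => //.
by have := @continuous_pathZ (-1) _ cg; under eq_fun do rewrite mulN1r.
Qed.

Lemma continuous_path_pos f :
  continuous_path f -> continuous_path (fun t => Num.max (f t) 0).
Proof.
move=> /continuous_path_max0 cf; apply/continuous_path_max0 => t.
apply: (@continuous_max R R _ (fun=> 0)); last exact: cst_continuous.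
exact: cf.
Qed.

Lemma continuous_path_abs f :
  continuous_path f -> continuous_path (fun t => `|f t|).
Proof.
move=> /continuous_path_max0 cf; apply/continuous_path_max0 => t.
by apply: cvg_norm; exact: cf.
Qed.

Lemma continuous_path_stop f (a : R) : 0 <= a ->
  continuous_path f -> continuous_path (fun t => f (Num.min t a)).
Proof.
move=> a0 /continuous_pathP cf; apply/continuous_pathP => t t0 e e0.
have ma0 u : 0 <= u -> 0 <= Num.min u a by move=> u0; rewrite le_min u0.
have [d d0 dP] := cf _ (ma0 _ t0) e e0; exists d => // u u0 ut.
apply: dP; rewrite ?ma0// (le_lt_trans _ ut)//.
have [ua|au] := leP u a; have [ta|at_] := leP t a; rewrite ?subrr ?normr0//.
- rewrite ler_distl; have := ler_norm (u - t); have := ler_norm (t - u).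
  by rewrite (distrC t u); lra.
- rewrite ler_distl; have := ler_norm (u - t); have := ler_norm (t - u).
  by rewrite (distrC t u); lra.
Qed.

Lemma continuous_path_stop_l f (a : R) : 0 <= a ->
  continuous_path f -> continuous_path (fun t => f (Num.min a t)).
Proof.
by move=> a0 /(continuous_path_stop a0); under eq_fun do rewrite minC.
Qed.

Lemma continuous_path_sum (I : Type) (r : seq I) (F : I -> R -> R) :
  (forall i, continuous_path (F i)) ->
  continuous_path (fun t => \sum_(i <- r) F i t).
Proof.
move=> cF; elim: r => [|i r IH].
  by under eq_fun do rewrite big_nil; exact: continuous_path_cst.
by under eq_fun do rewrite big_cons; exact: continuous_pathD.
Qed.

Lemma continuous_path_uniform_limit (g : nat -> R -> R) f :
  (forall k, continuous_path (g k)) ->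
  (forall t, 0 <= t -> forall e, 0 < e ->
     exists k, forall u, 0 <= u <= t -> `|g k u - f u| <= e) ->
  continuous_path f.
Proof.
move=> cg gf; apply/continuous_pathP => t t0 e e0.
have e3 : 0 < e / 3 by rewrite divr_gt0.
have [k kP] := gf (t + 1) (ltac:(lra)) _ e3.
have [d d0 dP] := (continuous_pathP (g k)).1 (cg k) t t0 _ e3.
exists (Num.min d 1); first by rewrite lt_min d0 ltr01.
move=> u u0; rewrite lt_min => /andP[/(dP _ u0) gut ut].
have := kP u; rewrite u0; have := ler_norm (u - t) => utn.
move=> /(_ (ltac:(lra))); have := kP t; rewrite t0 => /(_ (ltac:(lra))).
by move: gut; rewrite !ler_norml => /andP[] ? ? /andP[] ? ? /andP[] ? ?; lra.
Qed.

Lemma pow2_gt (r : R) : exists n : nat, r < 2 ^+ n.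
Proof.
exists (Num.trunc `|r|).+1; have /truncn_itv/andP[_] := normr_ge0 r.
move=> h; rewrite (le_lt_trans (ler_norm r))// (lt_trans h)//.
by rewrite -natrX ltr_nat ltn_expl.
Qed.

Lemma dyadic_between (a b : R) : 0 <= a -> a < b ->
  exists i m : nat, a < i%:R / 2 ^+ m < b.
Proof.
move=> a0 ab; have [m mP] := pow2_gt (b - a)^-1.
have p0 : 0 < 2 ^+ m :> R by rewrite exprn_gt0.
have ba : 0 < b - a by lra.
have {}mP : 1 < 2 ^+ m * (b - a) by rewrite -ltr_pdivrMr// div1r.
have /truncn_itv/andP[h1 h2] : 0 <= a * 2 ^+ m by rewrite mulr_ge0// ltW.
exists (Num.trunc (a * 2 ^+ m)).+1, m.
rewrite ltr_pdivlMr// h2/= ltr_pdivrMr// -natr1.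
by move: h1 mP; set p := 2 ^+ m; lra.
Qed.

(** Countably many times suffice to control a continuous path. Dyadic times
    are convenient because their finite grids are nested. *)
Lemma le_on_dyadics f (a b c : R) : continuous_path f -> 0 <= a -> a < b ->
  (forall i m : nat, a < i%:R / 2 ^+ m < b -> f (i%:R / 2 ^+ m) <= c) ->
  forall u, a <= u <= b -> f u <= c.
Proof.
move=> /continuous_pathP cf a0 ab H u /andP[au ub].
rewrite leNgt; apply/negP => cfu.
have [d d0 dP] := cf u (le_trans a0 au) ((f u - c) / 2) (ltac:(lra)).
have [i [m /andP[li ir]]] :
    exists i m : nat, Num.max a (u - d) < i%:R / 2 ^+ m < Num.min b (u + d).
  apply: dyadic_between; first by rewrite le_max a0.
  by rewrite lt_min !gt_max; apply/andP; split; apply/andP; split; lra.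
move: li ir; rewrite gt_max lt_min => /andP[ai di] /andP[ib id'].
have := H i m; rewrite ai ib => /(_ isT).
have := dP (i%:R / 2 ^+ m) (le_trans a0 (ltW ai)); rewrite ltr_norml.
move=> /(_ (ltac:(apply/andP; split; lra))).
by rewrite ler_norml => /andP[? ?]; lra.
Qed.

(** Uniform continuity on [[0, T]], by compactness. *)
Lemma small_oscillation_pow2 f (T e : R) : continuous_path f -> 0 < e ->
  \forall m \near \oo, forall (i : nat) u,
    i%:R / 2 ^+ m <= u <= i.+1%:R / 2 ^+ m -> u <= T ->
    `|f u - f (i%:R / 2 ^+ m)| <= e.
Proof.
move=> /continuous_pathP cf e0.
have /compact_near_coveringP cov := @segment_compact R 0 T.
have [|m0 _ H] := cov nat \oo (fun m v => forall w, 0 <= v -> 0 <= w ->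
  `|w - v| <= (2 ^+ m)^-1 -> `|f w - f v| <= e) _.
  move=> v /=; rewrite in_itv/= => /andP[v0 vT].
  have e2 : 0 < e / 2 by rewrite divr_gt0.
  have [d d0 dP] := cf v v0 _ e2.
  have [M MP] := pow2_gt (2 / d).
  exists (ball v (d / 2), [set m | (M <= m)%N]).
    by split=> /=; [apply: nbhsx_ballx; rewrite divr_gt0|exists M].
  move=> [v' m] /= [vv' Mm] w v'0 w0 wv'.
  have wd : `|w - v'| < d / 2.
    apply: (le_lt_trans wv'); rewrite invf_plt ?posrE ?exprn_gt0 ?divr_gt0//.
    by rewrite invf_div (lt_le_trans MP)// ler_weXn2l// ler1n.
  have v'd : `|v' - v| < d / 2 by rewrite distrC.
  have wvd : `|w - v| < d by have := ler_distD v' w v; lra.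
  have v'vd : `|v' - v| < d by lra.
  have := dP _ v'0 v'vd; have := dP _ w0 wvd.
  have := ler_distD (f v) (f w) (f v'); rewrite (distrC (f v)); lra.
exists m0 => // m /= m0m i u /andP[iu ui] uT.
have i0 : 0 <= i%:R / 2 ^+ m :> R by rewrite divr_ge0// exprn_ge0.
apply: (H m m0m); rewrite ?(le_trans i0)//.
  by rewrite /= in_itv/= i0 (le_trans iu).
rewrite ger0_norm ?subr_ge0// lerBlDl (le_trans ui)//.
by rewrite -natr1 mulrDl div1r.
Qed.

Lemma positive_on_segment f (s t : R) : continuous_path f -> 0 <= s -> s <= t ->
  (forall u, s <= u <= t -> 0 < f u) ->
  exists2 c, 0 < c & forall u, s <= u <= t -> c <= f u.
Proof.
move=> cf s0 st fpos.
have [|c] := @EVT_min R f s t st.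
  apply: continuous_subspaceW cf => u /=; rewrite !in_itv/= andbT.
  by move=> /andP[su _]; exact: le_trans su.
rewrite in_itv/= => cst cP; exists (f c); first exact: fpos.
by move=> u ust; apply: cP; rewrite in_itv/=.
Qed.

End continuous_paths.

(** * Paths of finite variation that only move on the zeros of another path *)

Section flat.
Context {R : realType}.
Implicit Types v x g : R -> R.

(** [v] does not move on the time intervals where [x] keeps a strict sign; for
    [v] of finite variation this is what the vanishing of the Stieltjes
    integrals of the indicator of [x <> 0] amounts to. *)
Definition flat_off_zeros x v := forall s t, 0 <= s -> s <= t ->
  (forall u, s <= u <= t -> 0 < x u) \/ (forall u, s <= u <= t -> x u < 0) ->
  v s = v t.

Lemma nonzero_sign_neighborhood x (u : R) : continuous_path x -> 0 <= u ->
  x u != 0 -> exists2 d, 0 < d &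
  (forall w, 0 <= w -> `|w - u| < d -> 0 < x w) \/
  (forall w, 0 <= w -> `|w - u| < d -> x w < 0).
Proof.
move=> /continuous_pathP cx u0 xu.
have e0 : 0 < `|x u| / 2 by rewrite divr_gt0// normr_gt0.
have [d d0 dP] := cx u u0 _ e0; exists d => //.
have [xn|xp|/eqP] := ltrgtP (x u) 0; last by rewrite (negbTE xu).
  right => w w0 wd; have := dP w w0 wd.
  by rewrite (ltr0_norm xn) ler_norml => /andP[? ?]; lra.
left => w w0 wd; have := dP w w0 wd.
by rewrite (gtr0_norm xp) ler_norml => /andP[? ?]; lra.
Qed.

Lemma stieltjes_measure_itv (g : cumulative R R) (a b : R) : a <= b ->
  lebesgue_stieltjes_measure g `]a, b]%classic = (g b - g a)%:E.
Proof.
move=> ab; rewrite /lebesgue_stieltjes_measure/= /measure_extension/=.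
rewrite measurable_mu_extE; last exact: is_ocitv.
exact: (wlength_itv_bnd g false false ab).
Qed.

Lemma measurable_nonzeros x (t : R) : continuous_path x ->
  measurable (`]0, t]%classic `&` [set u | x u != 0]).
Proof.
move=> /continuous_path_max0 cx.
have -> : `]0, t]%classic `&` [set u | x u != 0] =
    `]0, t]%classic `&` (fun u : R => x (Num.max 0 u)) @^-1` (~` [set 0]).
  apply/seteqP; split=> u /=; rewrite in_itv/= => -[/andP[u0 ut]].
    by rewrite (max_r (ltW u0)) u0 ut => /eqP.
  by rewrite (max_r (ltW u0)) u0 ut => /eqP.
apply: measurableI => //; apply: open_measurable; apply: open_comp => //.
exact/closed_openC/accessible_closed_set1/hausdorff_accessible.
Qed.

Lemma tv_flat v (s t : R) : 0 <= s -> s <= t -> finite_variation_path v ->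
  (forall u, s <= u <= t -> v u = v s) ->
  decreasing_part v s = decreasing_part v t.
Proof.
move=> s0 st bv vst; rewrite /decreasing_part !max_r ?(le_trans s0)//.
rewrite /neg_tv (total_variationD _ s0 st) (@nondecreasing_total_variation _ s t)//; last first.
  move=> p q; rewrite !in_itv/= => ps qs _.
  by rewrite (vst p ps) (vst q qs).
by rewrite (vst t) ?lexx ?st// subrr adde0.
Qed.

Lemma decreasing_partN v : decreasing_part (\- v) = increasing_part v.
Proof. by []. Qed.

Definition integral_cumulative (g : cumulative R R) (h : R -> R) (t : R) : R :=
  \int[lebesgue_stieltjes_measure g]_(u in `]0, t]) h u.

Lemma stieltjes_integralE v h (t : R) : stieltjes_integral v h t =
  integral_cumulative (to_cumulative (increasing_part v)) h t -
  integral_cumulative (to_cumulative (decreasing_part v)) h t.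
Proof. by []. Qed.

(** The open set where [x <> 0] is a countable union of dyadic cells on which
    [x] keeps its sign, and each of them has measure 0 because [g] has the same
    value at both ends. *)
Lemma flat_stieltjes_null x (g : cumulative R R) (t : R) : continuous_path x ->
  flat_off_zeros x g ->
  integral_cumulative g \1_[set u | x u != 0] t = 0.
Proof.
move=> cx flat; set S := [set u | x u != 0]; 
pose mu : {measure set (measurableTypeR R) -> \bar R} := lebesgue_stieltjes_measure g.
pose D : set R := `]0, t]%classic.
have mDS : measurable (D `&` S) by exact: measurable_nonzeros.
have DS0 : mu (D `&` S) = 0%E.
  pose cell (m i : nat) : set R := `]i%:R / 2 ^+ m, i.+1%:R / 2 ^+ m]%classic.
  pose A (m i : nat) := if pselect (mu (cell m i) = 0%E) then cell m i else set0.
  suff sub : D `&` S `<=` \bigcup_m \bigcup_i A m i.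
    have [B [mB B0 AB]] : negligible mu (\bigcup_m \bigcup_i A m i).
      apply: (@negligible_bigcup _ _ _ mu) => m.
      apply: (@negligible_bigcup _ _ _ mu) => i.
      rewrite /A; case: pselect => h; last exact: negligible_set0.
      by apply/negligibleP => //; exact: measurable_itv.
    apply/eqP; rewrite -measure_le0 -B0 le_measure ?inE//.
    exact: subset_trans AB.
  move=> u []; rewrite /D/= in_itv/= => /andP[u0 ut] xu.
  have [d d0 dP] := nonzero_sign_neighborhood cx (ltW u0) xu.
  have [m mP] := pow2_gt d^-1; exists m => //.
  have p0 : 0 < 2 ^+ m :> R by rewrite exprn_gt0.
  have [i /andP[iu ui]] : exists i : nat, i%:R / 2 ^+ m < u <= i.+1%:R / 2 ^+ m.
    have up : 0 < u * 2 ^+ m by rewrite mulr_gt0.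
    have [k] : exists k : nat, k%:R <= u * 2 ^+ m < k.+1%:R.
      by exists (Num.trunc (u * 2 ^+ m)); exact/truncn_itv/ltW.
    rewrite le_eqVlt => /andP[/orP[/eqP h1|h1] h2]; last first.
      by exists k; rewrite ltr_pdivrMr// h1 ler_pdivlMr// ltW.
    move: up; rewrite -h1 ltr0n => k0.
    exists k.-1; rewrite prednK// ltr_pdivrMr// ler_pdivlMr// -h1 lexx andbT.
    by rewrite ltr_nat prednK.
  exists i => //; rewrite /A; case: pselect => [c0|[]]; first by rewrite /cell/= in_itv/= iu.
  have ile : i%:R / 2 ^+ m <= i.+1%:R / 2 ^+ m :> R.
    by rewrite ler_pM2r ?invr_gt0// ler_nat.
  rewrite [LHS](stieltjes_measure_itv g ile).
  have i0 : 0 <= i%:R / 2 ^+ m :> R by rewrite divr_ge0// ltW.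
  have ii : i.+1%:R / 2 ^+ m - i%:R / 2 ^+ m < d.
    rewrite -mulrBl -natrB// subSnn div1r.
    by rewrite invf_plt ?posrE.
  rewrite (flat (i%:R / 2 ^+ m) (i.+1%:R / 2 ^+ m)) ?subrr//.
  have near_u w : i%:R / 2 ^+ m <= w <= i.+1%:R / 2 ^+ m -> 0 <= w /\ `|w - u| < d.
    by move=> /andP[iw wi]; split; [lra|rewrite ltr_norml; apply/andP; split; lra].
  by case: dP => dP; [left|right] => w /near_u[w0 wu]; exact: dP.
transitivity (\int[mu]_(u in D) \1_(D `&` S) u).
  by apply: eq_Rintegral => u uD; rewrite !indicE in_setI uD.
have DSD : D `&` S `&` D = D `&` S by rewrite setIAC setIid.
rewrite /Rintegral integral_indic//; last exact: measurable_itv.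
by rewrite DSD DS0.
Qed.

Lemma stieltjes_integral_flat x v (t : R) : continuous_path x ->
  continuous_path v -> finite_variation_path v -> flat_off_zeros x v ->
  stieltjes_integral v \1_[set u | x u != 0] t = 0.
Proof.
move=> cx cv bv flat; rewrite stieltjes_integralE.
have flat_part w : finite_variation_path w -> flat_off_zeros x w ->
    flat_off_zeros x (decreasing_part w).
  move=> bw fw p q p0 pq sgn; apply: tv_flat => // u /andP[pu uq].
  apply/esym/fw => //; case: sgn => sgn; [left|right] => y /andP[py yu];
    by apply: sgn; rewrite py (le_trans yu).
rewrite !flat_stieltjes_null ?subrr//.
- by rewrite to_cumulativeE; [exact: flat_part|exact: decreasing_part_is_cumulative].
- rewrite to_cumulativeE; last exact: increasing_part_is_cumulative.
  rewrite -decreasing_partN; apply: flat_part.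
    by move=> s s0; apply: bounded_variationN; exact: bv.
  by move=> p q p0 pq sgn; rewrite /= (flat p q).
Qed.

(** Subtract the integrals up to [s] and up to [t]: in between the integrand
    is 1, so that the difference is the increment of [v]. *)
Lemma flat_of_stieltjes_integral x v : continuous_path x ->
  continuous_path v -> finite_variation_path v ->
  (forall t, 0 <= t -> stieltjes_integral v \1_[set u | x u != 0] t = 0) ->
  flat_off_zeros x v.
Proof.
move=> cx cv bv int0 s t s0 st sgn.
have t0 : 0 <= t := le_trans s0 st.
have xn u : s <= u <= t -> x u != 0.
  by move=> ust; case: sgn => /(_ u ust) h; [rewrite gt_eqF|rewrite lt_eqF].
set S := [set u | x u != 0].
have intB (g : cumulative R R) :
    integral_cumulative g \1_S t - integral_cumulative g \1_S s = g t - g s.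
  pose mu := lebesgue_stieltjes_measure g.
  have muI (a b : R) (ab : a <= b) : mu `]a, b]%classic = (g b - g a)%:E.
    exact: stieltjes_measure_itv.
  rewrite /integral_cumulative -/mu; have mS := @measurable_nonzeros x t cx.
  have -> : \int[mu]_(u in `]0, t]) \1_S u =
      \int[mu]_(u in `]0, t]) \1_(`]0, t]%classic `&` S) u.
    by apply: eq_Rintegral => u uD; rewrite !indicE in_setI uD.
  have -> : \int[mu]_(u in `]0, s]) \1_S u =
      \int[mu]_(u in `]0, s]) \1_(`]0, t]%classic `&` S) u.
    apply: eq_Rintegral => u uD; rewrite !indicE in_setI.
    suff -> : u \in `]0, t]%classic by [].
    by move: uD; rewrite !inE/= !in_itv/= => /andP[-> /le_trans ->].
  set f := \1_(`]0, t]%classic `&` S).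
  have tE : `]0, t]%classic = `]0, s]%classic `|` `]s, t]%classic :> set R.
    by rewrite -itv_bndbnd_setU ?bnd_simp.
  rewrite [in X in X - _]tE Rintegral_setU//; last 2 first.
  - rewrite -tE; apply: measurable_bounded_integrable => //.
    + by rewrite [X in (X < _)%E](muI 0 t t0) ltry.
    + by rewrite /f; apply: measurable_indic.
    + exists 1; split => // y y1 u _ /=; rewrite /f indicE.
      by case: (_ \in _); rewrite ?normr1 ?normr0; lra.
  - by rewrite disj_set2E; apply/eqP; rewrite -subset0 => u [] /=;
       rewrite !in_itv/= => /andP[_ us] /andP[su _]; lra.
  rewrite addrAC subrr add0r.
  rewrite (@eq_Rintegral _ _ _ _ _ (cst 1)); last first.
    move=> u; rewrite inE/= in_itv/= => /andP[su ut]; rewrite /f indicE mem_set//=.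
    split; first by rewrite /= in_itv/= ut (le_lt_trans s0).
    by apply: xn; rewrite ut ltW.
  by rewrite Rintegral_cst// mul1r [X in fine X](muI s t st).
have := int0 t t0; have := int0 s s0; rewrite !stieltjes_integralE -/S => is0 it0.
have := intB (to_cumulative (increasing_part v)).
have := intB (to_cumulative (decreasing_part v)).
rewrite !to_cumulativeE; last 2 first.
- exact: increasing_part_is_cumulative.
- exact: decreasing_part_is_cumulative.
move=> /= d1 d2; rewrite (increasing_decreasing_partE bv s0).
rewrite (increasing_decreasing_partE bv t0).
move: is0 it0 d1 d2.
move: (integral_cumulative _ _ t) (integral_cumulative _ _ s)
  (integral_cumulative _ _ t) (integral_cumulative _ _ s)
  (increasing_part v s) (increasing_part v t)
  (decreasing_part v s) (decreasing_part v t).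
by move=> *; lra.
Qed.

Lemma nondecreasing_finite_variation v :
  (forall s t, 0 <= s -> s <= t -> v s <= v t) -> finite_variation_path v.
Proof.
move=> ndv t t0; apply: nondecreasing_bounded_variation => p q.
by rewrite !in_itv/= => /andP[p0 _] _; exact: ndv.
Qed.

Lemma finite_variationN v :
  finite_variation_path v -> finite_variation_path (fun t => - v t).
Proof. by move=> bv t t0; apply: bounded_variationN; exact: bv. Qed.

Lemma finite_variationD v w : finite_variation_path v ->
  finite_variation_path w -> finite_variation_path (fun t => v t + w t).
Proof.
move=> bv bw t; rewrite le_eqVlt => /orP[/eqP <-|t0].
  exact: bounded_variationxx.
by apply: bounded_variationD => //; [exact/bv/ltW|exact/bw/ltW].
Qed.

End flat.

(** * Random variables measurable with respect to a sub-sigma-algebra *)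

Section measurable_wrt.
Context {d : measure_display} {T : measurableType d} {R : realType}.
Variable P : probability T R.
Implicit Types (G : set (set T)) (Y Z : T -> R).

(** Measurability with respect to [G] is measurability on the measurable space
    with sigma-algebra [G], which gives it all the usual closure properties. *)
Lemma measurable_wrtP G Y : sigma_algebra [set: T] G ->
  measurable_wrt G Y <->
  measurable_fun [set: g_sigma_algebraType G] (Y : g_sigma_algebraType G -> R).
Proof.
move=> sG; split=> [mY _ B mB|mY B mB].
  by rewrite setTI; apply: sub_sigma_algebra; exact: mY.
have := mY measurableT B mB; rewrite setTI.
by rewrite /measurable/= sigma_algebra_id.
Qed.

Lemma sub_measurable_wrt G H Y : G `<=` H -> measurable_wrt G Y -> measurable_wrt H Y.
Proof. by move=> GH mY B mB; exact/GH/mY. Qed.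

Lemma measurable_wrt_measurable G Y : G `<=` measurable -> measurable_wrt G Y ->
  measurable_fun [set: T] Y.
Proof. by move=> Gm mY _ B mB; rewrite setTI; exact/Gm/mY. Qed.

Section operations.
Variables (G : set (set T)) (sG : sigma_algebra [set: T] G).

Lemma measurable_wrt_cst (a : R) : measurable_wrt G (fun=> a).
Proof. by apply/(measurable_wrtP _ sG); exact: measurable_cst. Qed.

Lemma measurable_wrtD Y Z : measurable_wrt G Y -> measurable_wrt G Z ->
  measurable_wrt G (fun w => Y w + Z w).
Proof.
by move=> /(measurable_wrtP _ sG) mY /(measurable_wrtP _ sG) mZ;
  apply/(measurable_wrtP _ sG); exact: measurable_funD.
Qed.

Lemma measurable_wrtM Y Z : measurable_wrt G Y -> measurable_wrt G Z ->
  measurable_wrt G (fun w => Y w * Z w).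
Proof.
by move=> /(measurable_wrtP _ sG) mY /(measurable_wrtP _ sG) mZ;
  apply/(measurable_wrtP _ sG); exact: measurable_funM.
Qed.

Lemma measurable_wrtZ (a : R) Y : measurable_wrt G Y ->
  measurable_wrt G (fun w => a * Y w).
Proof. by apply: measurable_wrtM; exact: measurable_wrt_cst. Qed.

Lemma measurable_wrtB Y Z : measurable_wrt G Y -> measurable_wrt G Z ->
  measurable_wrt G (fun w => Y w - Z w).
Proof.
by move=> /(measurable_wrtP _ sG) mY /(measurable_wrtP _ sG) mZ;
  apply/(measurable_wrtP _ sG); exact: measurable_funB.
Qed.

Lemma measurable_wrt_abs Y : measurable_wrt G Y -> measurable_wrt G (fun w => `|Y w|).
Proof.
by move=> /(measurable_wrtP _ sG) mY; apply/(measurable_wrtP _ sG);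
  exact: measurableT_comp.
Qed.

Lemma measurable_wrt_max0 Y : measurable_wrt G Y ->
  measurable_wrt G (fun w => Num.max (Y w) 0).
Proof.
move=> /(measurable_wrtP _ sG) mY; apply/(measurable_wrtP _ sG).
by apply: measurable_maxr => //; exact: measurable_cst.
Qed.

Lemma measurable_wrt_indic (A : set T) : G A -> measurable_wrt G (\1_A : T -> R).
Proof.
move=> GA; apply/(measurable_wrtP _ sG).
by apply: measurable_indic; exact: sub_sigma_algebra.
Qed.

Lemma measurable_wrt_sum (I : Type) (s : seq I) (Y : I -> T -> R) :
  (forall i, measurable_wrt G (Y i)) ->
  measurable_wrt G (fun w => \sum_(i <- s) Y i w).
Proof.
move=> mY; apply/(measurable_wrtP _ sG); apply: measurable_sum => i.
by apply/(measurable_wrtP _ sG).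
Qed.

Lemma measurable_wrt_gt Y (a : R) : measurable_wrt G Y -> G [set w | a < Y w].
Proof.
move=> mY; have := mY `]a, +oo[%classic (measurable_itv _).
by congr G; apply/seteqP; split=> w /=; rewrite in_itv/= andbT.
Qed.

Hypothesis Gnull : forall N, P.-negligible N -> G N.

(** By completeness, it does not matter what happens off the null set where
    the convergence holds. *)
Lemma measurable_wrt_ae_lim (Y_ : nat -> T -> R) Y :
  (forall n, measurable_wrt G (Y_ n)) ->
  {ae P, forall w, Y_ n w @[n --> \oo] --> Y w} -> measurable_wrt G Y.
Proof.
move=> mY [N [mN N0 sN]].
have GN : G N by apply: Gnull; exists N; split.
have GNC : G (~` N) by rewrite -setTD; case: sG => _ GC _; exact: GC.
have cvgN w : ~ N w -> Y_ n w @[n --> \oo] --> Y w.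
  by move=> Nw; apply: contrapT => h; apply: Nw; exact: sN.
have m1 : measurable_wrt G (fun w => \1_(~` N) w * Y w).
  apply/(measurable_wrtP _ sG).
  apply: (@measurable_fun_cvg _ (g_sigma_algebraType G) R setT (fun n w => \1_(~` N) w * Y_ n w)).
    move=> n; apply/(measurable_wrtP _ sG); apply: measurable_wrtM => //.
    exact: measurable_wrt_indic.
  move=> w _; rewrite indicE; have [wN|wN] := boolP (w \in ~` N).
    by apply: cvgM; [exact: cvg_cst|apply: cvgN; rewrite inE in wN].
  by rewrite mul0r; under eq_fun do rewrite mul0r; exact: cvg_cst.
move=> B mB; have GB : G ((fun w => \1_(~` N) w * Y w) @^-1` B) by exact: m1.
have -> : Y @^-1` B =
    ((fun w => \1_(~` N) w * Y w) @^-1` B `&` ~` N) `|` (Y @^-1` B `&` N).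
  apply/seteqP; split=> w /=.
    move=> Bw; have [Nw|Nw] := pselect (N w); first by right.
    by left; split => //; rewrite indicE mem_set//= mul1r.
  by move=> [[+ Nw]|[//]]; rewrite indicE mem_set//= mul1r.
have GI A C : G A -> G C -> G (A `&` C).
  move=> GA GC; have := @sigma_algebraP _ setT G; rewrite /=.
  by move=> h; have [_ _ _] := (h (fun s _ => @subsetT _ s)).1 sG; apply.
have GU A C : G A -> G C -> G (A `|` C).
  move=> GA GC; rewrite -bigcup2E; case: sG => G0 _; apply => -[|[|n]]//=.
apply: GU; first exact: GI.
by apply: Gnull; exists N; split => // w [].
Qed.

Lemma measurable_wrt_ae_eq Y Z : measurable_wrt G Y -> {ae P, forall w, Y w = Z w} ->
  measurable_wrt G Z.
Proof.
move=> mY YZ; apply: (@measurable_wrt_ae_lim (fun=> Y)) => //.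
by apply: filterS YZ => w ->; exact: cvg_cst.
Qed.

End operations.

End measurable_wrt.

(** * Integrals of real random variables *)

Section integrals.
Context {d : measure_display} {T : measurableType d} {R : realType}.
Variable P : probability T R.
Implicit Types (f g : T -> R) (A : set T).

Definition finite_mean f := P.-integrable [set: T] (EFin \o f).

Definition bounded_measurable f :=
  measurable_fun [set: T] f /\ exists C, forall w, `|f w| <= C.

Lemma finite_mean_bounded f : bounded_measurable f -> finite_mean f.
Proof.
move=> [mf [C fC]]; apply: measurable_bounded_integrable => //.
  by rewrite (le_lt_trans (probability_le1 P measurableT))// ltry.
exists C; split; first exact: num_real.
by move=> y Cy w _ /=; rewrite (le_trans (fC w))// ltW.
Qed.

Lemma finite_mean_measurable f : finite_mean f -> measurable_fun [set: T] f.
Proof. by move=> /(measurable_int P) /measurable_EFinP. Qed.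

Lemma finite_meanD f g : finite_mean f -> finite_mean g -> finite_mean (fun w => f w + g w).
Proof. by move=> sf sg; exact: (integrableD measurableT sf sg). Qed.

Lemma finite_meanB f g : finite_mean f -> finite_mean g -> finite_mean (fun w => f w - g w).
Proof. by move=> sf sg; exact: (integrableB measurableT sf sg). Qed.

Lemma finite_meanZ (a : R) f : finite_mean f -> finite_mean (fun w => a * f w).
Proof. by move=> sf; exact: (integrableZl measurableT a sf). Qed.

Lemma finite_mean_abs f : finite_mean f -> finite_mean (fun w => `|f w|).
Proof. by move=> sf; exact: integrable_norm. Qed.

Lemma finite_meanM f g : bounded_measurable f -> finite_mean g -> finite_mean (fun w => f w * g w).
Proof.
move=> [mf [C fC]] sg; apply: (@integrableMr _ _ _ _ _ _ f (EFin \o g)) => //.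
exists C; split; first exact: num_real.
by move=> y Cy w _ /=; rewrite (le_trans (fC w))// ltW.
Qed.

Lemma bounded_measurable_cst (a : R) : bounded_measurable (fun=> a).
Proof. by split; [exact: measurable_cst|exists `|a|]. Qed.

Lemma bounded_measurableD f g : bounded_measurable f -> bounded_measurable g ->
  bounded_measurable (fun w => f w + g w).
Proof.
move=> [mf [C fC]] [mg [D gD]]; split; first exact: measurable_funD.
by exists (C + D) => w; rewrite (le_trans (ler_normD _ _))// lerD.
Qed.

Lemma bounded_measurableB f g : bounded_measurable f -> bounded_measurable g ->
  bounded_measurable (fun w => f w - g w).
Proof.
move=> [mf [C fC]] [mg [D gD]]; split; first exact: measurable_funB.
by exists (C + D) => w; rewrite (le_trans (ler_normB _ _))// lerD.
Qed.

Lemma bounded_measurableM f g : bounded_measurable f -> bounded_measurable g ->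
  bounded_measurable (fun w => f w * g w).
Proof.
move=> [mf [C fC]] [mg [D gD]]; split; first exact: measurable_funM.
by exists (C * D) => w; rewrite normrM ler_pM.
Qed.

Lemma bounded_measurableZ (a : R) f : bounded_measurable f ->
  bounded_measurable (fun w => a * f w).
Proof. by apply: bounded_measurableM; exact: bounded_measurable_cst. Qed.

Lemma bounded_measurable_sqr f : bounded_measurable f ->
  bounded_measurable (fun w => f w ^+ 2).
Proof.
by move=> bf; under eq_fun do rewrite expr2; exact: bounded_measurableM.
Qed.

Lemma bounded_measurable_indic A : measurable A -> bounded_measurable (\1_A : T -> R).
Proof.
move=> mA; split; first exact: measurable_indic.
by exists 1 => w; rewrite indicE; case: (_ \in _); rewrite ?normr1 ?normr0.
Qed.

Lemma finite_mean_indicM A f : measurable A -> finite_mean f ->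
  finite_mean (fun w => \1_A w * f w).
Proof. by move=> mA; apply: finite_meanM; exact: bounded_measurable_indic. Qed.

Lemma mean_on A f : \int[P]_(w in A) f w = \int[P]_w (\1_A w * f w).
Proof.
rewrite Rintegral_mkcond; apply: eq_Rintegral => w _.
by rewrite patch_indic /= mulrC.
Qed.

Lemma le_mean f g : finite_mean f -> finite_mean g -> (forall w, f w <= g w) ->
  \int[P]_w f w <= \int[P]_w g w.
Proof. by move=> sf sg fg; exact: le_Rintegral. Qed.

Lemma meanD f g : finite_mean f -> finite_mean g ->
  \int[P]_w (f w + g w) = \int[P]_w f w + \int[P]_w g w.
Proof. by move=> sf sg; rewrite RintegralD. Qed.

Lemma meanB f g : finite_mean f -> finite_mean g ->
  \int[P]_w (f w - g w) = \int[P]_w f w - \int[P]_w g w.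
Proof. by move=> sf sg; rewrite RintegralB. Qed.

Lemma meanZ (a : R) f : finite_mean f -> \int[P]_w (a * f w) = a * \int[P]_w f w.
Proof. by move=> sf; rewrite RintegralZl. Qed.

Lemma mean_sum (I : Type) (s : seq I) (f : I -> T -> R) :
  (forall i, finite_mean (f i)) ->
  finite_mean (fun w => \sum_(i <- s) f i w) /\
  \int[P]_w (\sum_(i <- s) f i w) = \sum_(i <- s) \int[P]_w f i w.
Proof.
move=> sf; elim: s => [|i s [IH1 IH2]].
  split; last by rewrite big_nil; under eq_Rintegral do rewrite big_nil;
    rewrite Rintegral_cst// mul0r.
  under eq_fun do rewrite big_nil.
  exact/finite_mean_bounded/bounded_measurable_cst.
split; last by rewrite big_cons -IH2 -meanD//;
  apply: eq_Rintegral => w _; rewrite big_cons.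
by under eq_fun do rewrite big_cons; exact: finite_meanD.
Qed.

Lemma mean_cst (a : R) : \int[P]_w a = a.
Proof. by rewrite Rintegral_cst// [X in fine X]probability_setT mulr1. Qed.

Lemma mean_indic A : measurable A -> P A = (\int[P]_w \1_A w)%:E.
Proof.
move=> mA; rewrite /Rintegral integral_indic// setIT fineK//.
by rewrite ge0_fin_numE// (le_lt_trans (probability_le1 P mA))// ltry.
Qed.

Lemma eq_mean_ae f g : finite_mean f -> finite_mean g ->
  {ae P, forall w, f w = g w} -> \int[P]_w f w = \int[P]_w g w.
Proof.
move=> sf sg fg; congr fine; apply: ae_eq_integral => //.
- exact: measurable_int sf.
- exact: measurable_int sg.
- by apply: filterS fg => w /= ->.
Qed.

Lemma eq_finite_mean_ae f g : measurable_fun [set: T] g -> finite_mean f ->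
  {ae P, forall w, f w = g w} -> finite_mean g.
Proof.
move=> mg sf fg; apply/integrableP; split; first exact/measurable_EFinP.
move/integrableP : (sf) => [mf]; apply: le_lt_trans; rewrite le_eqVlt.
apply/orP; left; apply/eqP; apply: ae_eq_integral => //.
- by apply/measurable_EFinP; apply: measurableT_comp.
- apply/measurable_EFinP; apply: measurableT_comp => //.
  exact: finite_mean_measurable.
- by apply: filterS fg => w /= ->.
Qed.

Lemma mean_dominated_cvg (f_ : nat -> T -> R) f g :
  (forall n, measurable_fun [set: T] (f_ n)) -> measurable_fun [set: T] f ->
  {ae P, forall w, f_ n w @[n --> \oo] --> f w} ->
  finite_mean g -> (forall n w, `|f_ n w| <= g w) ->
  \int[P]_w f_ n w @[n --> \oo] --> \int[P]_w f w.
Proof.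
move=> mf_ mf f_f sg fg.
have [sf _ cv] := @dominated_convergence _ _ _ P _ measurableT
  (fun n => EFin \o f_ n) (EFin \o f) (EFin \o g)
  (fun n => proj2 (measurable_EFinP _ _) (mf_ n)) (proj2 (measurable_EFinP _ _) mf)
  (ltac:(apply: filterS f_f => w fw _; apply: cvg_EFin => //; exact: nearW))
  sg (ltac:(by apply: aeW => w n _ /=; rewrite lee_fin)).
apply: fine_cvg; rewrite /Rintegral fineK//.
exact: integrable_fin_num.
Qed.

End integrals.

(** * Martingales in continuous time *)

Section martingales.
Context {d : measure_display} {T : measurableType d} {R : realType}.
Variables (P : probability T R) (F : R -> set (set T)).
Hypotheses (Ffilt : filtration F) (Fusual : usual_conditions P F).
Implicit Types (M N : R -> T -> R) (A B : set T).

Lemma filtration_sigma t : 0 <= t -> sigma_algebra [set: T] (F t).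
Proof. by case: Ffilt => + _ _; exact. Qed.

Lemma filtration_measurable t A : 0 <= t -> F t A -> measurable A.
Proof. by case: Ffilt => _ + _ t0; exact. Qed.

Lemma filtration_le s t A : 0 <= s -> s <= t -> F s A -> F t A.
Proof. by case: Ffilt => _ _ + s0 st; exact. Qed.

Lemma filtration_null t A : 0 <= t -> P.-negligible A -> F t A.
Proof.
by move=> t0 NA; apply: filtration_le t0 _ => //; case: Fusual => _; exact.
Qed.

Lemma filtrationI t A B : 0 <= t -> F t A -> F t B -> F t (A `&` B).
Proof.
move=> t0 FA FB.
have [_ _ _] := (@sigma_algebraP _ setT (F t) (fun s _ => @subsetT _ s)).1 (filtration_sigma t0).
by apply.
Qed.

Lemma filtrationC t A : 0 <= t -> F t A -> F t (~` A).
Proof. by move=> t0 FA; rewrite -setTD; have [_ + _] := filtration_sigma t0; apply. Qed.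

Lemma filtration_bigcup t (A : nat -> set T) : 0 <= t ->
  (forall n, F t (A n)) -> F t (\bigcup_n A n).
Proof. by move=> t0; have [_ _] := filtration_sigma t0; apply. Qed.

Lemma filtrationU t A B : 0 <= t -> F t A -> F t B -> F t (A `|` B).
Proof.
move=> t0 FA FB; rewrite -(setCK (A `|` B)) setCU.
by apply: filtrationC => //; apply: filtrationI => //; exact: filtrationC.
Qed.

Lemma filtration_bigcap t (A : nat -> set T) : 0 <= t ->
  (forall n, F t (A n)) -> F t (\bigcap_n A n).
Proof.
move=> t0 FA; rewrite -(setCK (\bigcap_n A n)) setC_bigcap.
by apply: filtrationC => //; apply: filtration_bigcup => // n; exact: filtrationC.
Qed.

Lemma measurable_wrt_le s t (Y : T -> R) : 0 <= s -> s <= t ->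
  measurable_wrt (F s) Y -> measurable_wrt (F t) Y.
Proof. by move=> s0 st; apply: sub_measurable_wrt => A; exact: filtration_le. Qed.

Lemma measurable_of_wrt t (Y : T -> R) : 0 <= t -> measurable_wrt (F t) Y ->
  measurable_fun [set: T] Y.
Proof. by move=> t0; apply: measurable_wrt_measurable => A; exact: filtration_measurable. Qed.

Lemma adapted_ae_eq M N : adapted F M ->
  (forall t, 0 <= t -> {ae P, forall w, M t w = N t w}) -> adapted F N.
Proof.
move=> aM MN t t0; apply: (measurable_wrt_ae_eq (filtration_sigma t0) _ (aM t t0) (MN t t0)).
by move=> A; exact: filtration_null.
Qed.

Lemma martingale_increment M s t A : martingale P F M -> 0 <= s -> s <= t ->
  F s A -> \int[P]_w (\1_A w * (M t w - M s w)) = 0.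
Proof.
move=> [aM sM cM] s0 st FA; have [_ _ /(_ A FA)] := cM s t s0 st.
have mA := filtration_measurable s0 FA.
have sMs : finite_mean P (M s) by exact: sM.
have sMt : finite_mean P (M t) by apply: sM; exact: le_trans st.
rewrite (@mean_on _ _ _ P A (M s)) (@mean_on _ _ _ P A (M t)) => e.
under eq_Rintegral do rewrite mulrBr.
by rewrite meanB ?e ?subrr//; exact: finite_mean_indicM.
Qed.

Lemma martingale_of_increment M : adapted F M ->
  (forall t, 0 <= t -> finite_mean P (M t)) ->
  (forall s t A, 0 <= s -> s <= t -> F s A ->
     \int[P]_w (\1_A w * (M t w - M s w)) = 0) -> martingale P F M.
Proof.
move=> aM sM cM; split => // s t s0 st; split; [exact: aM|exact: sM|].
move=> A FA; have mA := filtration_measurable s0 FA; have t0 := le_trans s0 st.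
rewrite (@mean_on _ _ _ P A (M s)) (@mean_on _ _ _ P A (M t)); apply/eqP; rewrite eq_sym -subr_eq0 -meanB; last 2 first.
- by apply: finite_mean_indicM => //; exact: sM.
- by apply: finite_mean_indicM => //; exact: sM.
apply/eqP; rewrite -[RHS](cM s t A)//.
by apply: eq_Rintegral => w _; rewrite mulrBr.
Qed.

Lemma martingale_ae_eq M N : martingale P F M ->
  (forall t, 0 <= t -> {ae P, forall w, M t w = N t w}) -> martingale P F N.
Proof.
move=> mM MN; have [aM sM _] := mM; have aN := adapted_ae_eq aM MN.
have sN t : 0 <= t -> finite_mean P (N t).
  move=> t0; apply: (eq_finite_mean_ae (measurable_of_wrt t0 (aN t t0)) (sM t t0)).
  exact: MN.
apply: martingale_of_increment => // s t A s0 st FA.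
have mA := filtration_measurable s0 FA; have t0 := le_trans s0 st.
rewrite -[RHS](martingale_increment mM s0 st FA).
apply: eq_mean_ae.
- by apply: finite_mean_indicM => //; apply: finite_meanB; exact: sN.
- by apply: finite_mean_indicM => //; apply: finite_meanB; exact: sM.
by apply: filterS2 (MN s s0) (MN t t0) => w -> ->.
Qed.

Lemma martingaleD M N : martingale P F M -> martingale P F N ->
  martingale P F (fun t w => M t w + N t w).
Proof.
move=> mM mN; have [aM sM _] := mM; have [aN sN _] := mN.
apply: martingale_of_increment => [t t0|t t0|s t A s0 st FA].
- by apply: measurable_wrtD; [exact: filtration_sigma|exact: aM|exact: aN].
- by apply: finite_meanD; [exact: sM|exact: sN].
have mA := filtration_measurable s0 FA; have t0 := le_trans s0 st.
rewrite (@eq_Rintegral _ _ _ _ _ (fun w => \1_A w * (M t w - M s w) +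
  \1_A w * (N t w - N s w))); last by move=> w _; ring.
rewrite meanD ?martingale_increment ?addr0//.
- by apply: finite_mean_indicM => //; apply: finite_meanB; exact: sM.
- by apply: finite_mean_indicM => //; apply: finite_meanB; exact: sN.
Qed.

Lemma martingaleZ (a : R) M : martingale P F M ->
  martingale P F (fun t w => a * M t w).
Proof.
move=> mM; have [aM sM _] := mM.
apply: martingale_of_increment => [t t0|t t0|s t A s0 st FA].
- by apply: measurable_wrtZ; [exact: filtration_sigma|exact: aM].
- by apply: finite_meanZ; exact: sM.
have mA := filtration_measurable s0 FA; have t0 := le_trans s0 st.
rewrite (@eq_Rintegral _ _ _ _ _ (fun w => a * (\1_A w * (M t w - M s w)))).
  rewrite meanZ ?martingale_increment ?mulr0//.
  by apply: finite_mean_indicM => //; apply: finite_meanB; exact: sM.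
by move=> w _; ring.
Qed.

Lemma martingale0 : martingale P F (fun _ _ => 0).
Proof.
apply: martingale_of_increment => [t t0|t t0|s t A s0 st FA].
- by apply: measurable_wrt_cst; exact: filtration_sigma.
- exact/finite_mean_bounded/bounded_measurable_cst.
by under eq_Rintegral do rewrite subrr mulr0; exact: mean_cst.
Qed.

Lemma martingale_sum (I : Type) (r : seq I) (M : I -> R -> T -> R) :
  (forall i, martingale P F (M i)) ->
  martingale P F (fun t w => \sum_(i <- r) M i t w).
Proof.
move=> mM; elim: r => [|i r IH].
  by under eq_fun do under eq_fun do rewrite big_nil; exact: martingale0.
by under eq_fun do under eq_fun do rewrite big_cons; exact: martingaleD.
Qed.

(** The gain of buying at time [a], on an event [A] known then, and selling at
    time [b]. Finite sums of such gains play the role of stochastic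
    integrals. *)
Lemma adapted_elementary_integral M A (a b : R) : adapted F M -> 0 <= a -> a <= b ->
  F a A ->
  adapted F (fun t w => \1_A w * (M (Num.min b t) w - M (Num.min a t) w)).
Proof.
move=> aM a0 ab FA t t0; have sF := filtration_sigma t0.
have [ta|at_] := leP t a.
  rewrite min_r ?(le_trans ta)//.
  by under eq_fun do rewrite subrr mulr0; exact: measurable_wrt_cst.
have bt0 : 0 <= Num.min b t by rewrite le_min t0 (le_trans a0).
have btt : Num.min b t <= t by rewrite ge_min lexx orbT.
apply: measurable_wrtM => //.
  by apply: measurable_wrt_indic => //; apply: filtration_le FA => //; exact: ltW.
apply: measurable_wrtB => //.
  by apply: measurable_wrt_le btt _ => //; exact: aM.
by apply: measurable_wrt_le (ltW at_) _ => //; exact: aM.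
Qed.

Lemma martingale_elementary_integral M A (a b : R) : martingale P F M ->
  0 <= a -> a <= b -> F a A ->
  martingale P F (fun t w => \1_A w * (M (Num.min b t) w - M (Num.min a t) w)).
Proof.
move=> mM a0 ab FA; have [aM sM _] := mM; have b0 := le_trans a0 ab.
have mA := filtration_measurable a0 FA.
have min0 (c t : R) : 0 <= c -> 0 <= t -> 0 <= Num.min c t.
  by move=> c0 t0; rewrite le_min c0.
apply: martingale_of_increment => [|t t0|s t B s0 st FB].
- exact: adapted_elementary_integral.
- by apply: finite_mean_indicM => //; apply: finite_meanB; apply: sM; exact: min0.
have t0 := le_trans s0 st.
have /orP[bs|sb] := le_total b s.
  rewrite (min_l bs) (min_l (le_trans bs st)) (min_l (le_trans ab bs)).
  rewrite (min_l (le_trans ab (le_trans bs st))).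
  by under eq_Rintegral do rewrite subrr mulr0; rewrite mean_cst.
rewrite (min_r sb); have /orP[as_|sa] := le_total a s.
  rewrite (min_l as_) (min_l (le_trans as_ st)).
  have sbt : s <= Num.min b t by rewrite le_min sb.
  have FAB : F s (B `&` A) by apply: filtrationI => //; exact: filtration_le FA.
  rewrite -[RHS](martingale_increment mM s0 sbt FAB).
  by apply: eq_Rintegral => w _; rewrite !indicE in_setI -mulnb natrM; ring.
rewrite (min_r sa); have /orP[ta|at_] := le_total t a.
  rewrite (min_r (le_trans ta ab)) (min_r ta).
  by under eq_Rintegral do rewrite !subrr mulr0; exact: mean_cst.
have abt : a <= Num.min b t by rewrite le_min ab.
have FAB : F a (B `&` A) by apply: filtrationI => //; apply: filtration_le FB.
rewrite (min_l at_) -[RHS](martingale_increment mM a0 abt FAB).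
by apply: eq_Rintegral => w _; rewrite !indicE in_setI -mulnb natrM; ring.
Qed.

(** Increments are orthogonal to bounded past random variables, not only to
    past events: discretise the values of [K] with mesh [1 / n]. *)
Lemma martingale_orthogonal M (s t C : R) (K : T -> R) : martingale P F M ->
  0 <= s -> s <= t -> measurable_wrt (F s) K -> (forall w, `|K w| <= C) ->
  \int[P]_w (K w * (M t w - M s w)) = 0.
Proof.
move=> mM s0 st mK KC; have [_ sM _] := mM; have t0 := le_trans s0 st.
pose D w := M t w - M s w.
have sD : finite_mean P D by apply: finite_meanB; exact: sM.
have mKm := measurable_of_wrt s0 mK.
have bK : bounded_measurable K by split; last by exists C.
pose c := \int[P]_w `|D w|.
suff H n : `|\int[P]_w (K w * D w)| <= c / n.+1%:R.
  apply/normr0_eq0/eqP; rewrite eq_le normr_ge0 andbT.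
  have c0 : 0 <= c by apply: Rintegral_ge0.
  rewrite leNgt; apply/negP => x0; set x := `|_| in x0 H.
  have := H (Num.trunc (c / x)); have /truncn_itv/andP[_ cx] : 0 <= c / x.
    by rewrite divr_ge0// ltW.
  by rewrite leNgt => /negP; apply; rewrite ltr_pdivrMr// mulrC -ltr_pdivrMr.
pose m : R := n.+1%:R; have m0 : 0 < m by rewrite ltr0n.
have C0 : 0 <= C by apply: le_trans (KC point).
pose idx w := Num.trunc ((K w + C) * m).
have KCm w : 0 <= (K w + C) * m.
  by rewrite mulr_ge0 ?(ltW m0)//; have := KC w; rewrite ler_norml => /andP[]; lra.
pose L := (Num.trunc (2 * C * m)).+1.
have idxL w : (idx w < L)%N.
  rewrite ltnS; apply: le_truncn; rewrite ler_pM2r//.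
  by have := KC w; rewrite ler_norml => /andP[]; lra.
pose A k := [set w | idx w = k].
have FA k : F s (A k).
  have := mK [set` `[k%:R / m - C, k.+1%:R / m - C[] (measurable_itv _).
  congr (F s); apply/seteqP; split=> w /=; rewrite in_itv/=.
    move=> kK; apply: truncn_def.
    by rewrite -ler_pdivrMr// -ltr_pdivlMr// -lerBlDr -ltrBrDr.
  move=> <-; have /truncn_itv := KCm w; rewrite -/(idx w).
  by rewrite -ler_pdivrMr// -ltr_pdivlMr// lerBlDr ltrBrDr.
pose K' w := (idx w)%:R / m - C.
have K'E w : K' w = \sum_(k < L) (k%:R / m - C) * \1_(A k) w.
  rewrite (bigD1 (Ordinal (idxL w)))//= big1 ?addr0 => [|k kw].
    by rewrite indicE mem_set// mulr1.
  rewrite indicE memNset ?mulr0// => /esym kE.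
  by move: kw => /eqP; apply; apply: val_inj.
have KK' w : `|K w - K' w| <= m^-1.
  have /truncn_itv/andP := KCm w; rewrite -/(idx w) -ler_pdivrMr// -ltr_pdivlMr//.
  rewrite -natr1 mulrDl div1r /K'.
  have : 0 < m^-1 by rewrite invr_gt0.
  move: ((idx w)%:R / m) => q; move: (m^-1) => r r0 [h1 h2].
  by rewrite ler_norml; apply/andP; split; lra.
have term0 k : \int[P]_w ((k%:R / m - C) * (\1_(A k) w * D w)) = 0.
  rewrite meanZ; first by rewrite (martingale_increment mM)// mulr0.
  by apply: finite_mean_indicM => //; apply: filtration_measurable (FA k).
have K'D0 : \int[P]_w (K' w * D w) = 0.
  rewrite (@eq_Rintegral _ _ _ _ _ (fun w =>
    \sum_(k < L) (k%:R / m - C) * (\1_(A k) w * D w))); last first.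
    by move=> w _; rewrite K'E mulr_suml; apply: eq_bigr => k _; rewrite mulrA.
  have [|_ ->] := @mean_sum _ _ _ P _ (index_enum 'I_L)
      (fun k w => (k%:R / m - C) * (\1_(A k) w * D w)).
    move=> k; apply: finite_meanZ; apply: finite_mean_indicM => //.
    exact: filtration_measurable (FA k).
  by rewrite big1.
have bK' : bounded_measurable K'.
  split; last first.
    exists (C + m^-1) => w; have := KC w; have := KK' w.
    move: (m^-1) => r.
    by rewrite !ler_norml => /andP[? ?] /andP[? ?]; apply/andP; split; lra.
  rewrite (funext K'E).
  apply: measurable_sum => k; apply: measurable_funM => //.
  by apply: measurable_indic; apply: filtration_measurable (FA k).
have -> : \int[P]_w (K w * D w) = \int[P]_w ((K w - K' w) * D w).
  under [RHS]eq_Rintegral do rewrite mulrBl.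
  by rewrite meanB ?K'D0 ?subr0//; exact: finite_meanM.
have bKK' := bounded_measurableB bK bK'.
apply: (le_trans (le_normr_Rintegral _ _)) => //; first exact: finite_meanM.
rewrite /c mulrC -meanZ; last exact: finite_mean_abs.
apply: le_mean.
- exact/finite_mean_abs/finite_meanM.
- exact/finite_meanZ/finite_mean_abs.
- by move=> w; rewrite normrM ler_wpM2r.
Qed.

(** Boundedness is required on all paths, so that squares and products stay
    integrable without further ado. *)
Definition bounded_martingale M :=
  martingale P F M /\ exists C, forall t w, 0 <= t -> `|M t w| <= C.

Lemma bounded_martingaleD M N : bounded_martingale M -> bounded_martingale N ->
  bounded_martingale (fun t w => M t w + N t w).
Proof.
move=> [mM [C MC]] [mN [D ND]]; split; first exact: martingaleD.
by exists (C + D) => t w t0; rewrite (le_trans (ler_normD _ _))// lerD ?MC ?ND.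
Qed.

Lemma bounded_martingaleZ (a : R) M : bounded_martingale M ->
  bounded_martingale (fun t w => a * M t w).
Proof.
move=> [mM [C MC]]; split; first exact: martingaleZ.
by exists (`|a| * C) => t w t0; rewrite normrM ler_wpM2l ?MC.
Qed.

Lemma bounded_martingaleB M N : bounded_martingale M -> bounded_martingale N ->
  bounded_martingale (fun t w => M t w - N t w).
Proof.
move=> bM bN; have := bounded_martingaleD bM (bounded_martingaleZ (-1) bN).
by under eq_fun do under eq_fun do rewrite mulN1r.
Qed.

Lemma bounded_martingale_measurable M t : bounded_martingale M -> 0 <= t ->
  bounded_measurable (M t).
Proof.
move=> [[aM _ _] [C MC]] t0; split; last by exists C => w; exact: MC.
exact: measurable_of_wrt (aM t t0).
Qed.

(** The double product vanishes by orthogonality. *)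
Lemma martingale_pythagoras M (s t : R) A : bounded_martingale M ->
  0 <= s -> s <= t -> F s A ->
  \int[P]_w (\1_A w * M t w ^+ 2) =
  \int[P]_w (\1_A w * M s w ^+ 2) + \int[P]_w (\1_A w * (M t w - M s w) ^+ 2).
Proof.
move=> bM s0 st FA; have t0 := le_trans s0 st; have mA := filtration_measurable s0 FA.
have bs := bounded_martingale_measurable bM s0.
have bt := bounded_martingale_measurable bM t0.
have bA := @bounded_measurable_indic _ _ R _ mA.
have [[aM _ _] [C MC]] := bM; have mM := bM.1.
have C0 : 0 <= C by apply: le_trans (MC 0 point _).
have orth : \int[P]_w (\1_A w * M s w * (M t w - M s w)) = 0.
  apply: (martingale_orthogonal mM s0 st (C := C)).
    apply: measurable_wrtM; [exact: filtration_sigma| |exact: aM].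
    by apply: measurable_wrt_indic => //; exact: filtration_sigma.
  move=> w; rewrite normrM indicE; case: (_ \in _); rewrite ?normr1 ?normr0 ?mul0r//.
  by rewrite mul1r MC.
rewrite (@eq_Rintegral _ _ _ _ _ (fun w => \1_A w * M s w ^+ 2 +
   \1_A w * (M t w - M s w) ^+ 2 + 2 * (\1_A w * M s w * (M t w - M s w)))); last first.
  by move=> w _; ring.
have b1 := bounded_measurableM bA (bounded_measurable_sqr bs).
have b2 := bounded_measurableM bA (bounded_measurable_sqr (bounded_measurableB bt bs)).
have b3 := bounded_measurableM (bounded_measurableM bA bs) (bounded_measurableB bt bs).
rewrite !meanD ?meanZ ?orth ?mulr0 ?addr0//; apply: finite_mean_bounded => //.
  exact: bounded_measurableD.
exact: bounded_measurableZ.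
Qed.

Lemma martingale_sqr_le M (s t : R) : bounded_martingale M -> 0 <= s -> s <= t ->
  \int[P]_w (M s w ^+ 2) <= \int[P]_w (M t w ^+ 2).
Proof.
move=> bM s0 st; have FT : F s [set: T].
  by rewrite -setC0; apply: filtrationC => //; have [] := filtration_sigma s0.
have oneE (f : T -> R) : \int[P]_w f w = \int[P]_w (\1_[set: T] w * f w).
  by apply: eq_Rintegral => w _; rewrite indicE in_setT mul1r.
rewrite oneE [leRHS]oneE (martingale_pythagoras bM s0 st FT) lerDl.
by apply: Rintegral_ge0 => w _; rewrite mulr_ge0// ?sqr_ge0// indicE.
Qed.

Section doob.
Variables (M : R -> T -> R) (bM : bounded_martingale M) (S lam : R).
Hypothesis lam0 : 0 < lam.

(* the maximal inequality along finitely many times: an exceedance that occurs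
   for the first time at [u r] already contributes [lam ^+ 2] to the second
   moment at that time, which can only grow until [S] *)
Let doob_grid (u : nat -> R) r : (forall i, 0 <= u i) ->
  (forall i, u i <= u i.+1) -> (forall i, (i <= r)%N -> u i <= S) ->
  exists2 B, F (u r) B &
   (B = \bigcup_(i < r.+1) [set w | lam < `|M (u i) w|]) /\
   lam ^+ 2 * \int[P]_w \1_B w <= \int[P]_w (\1_B w * M S w ^+ 2).
Proof.
move=> u0 uS; have mM := bM.1; have [aM _ _] := mM.
pose H i := [set w | lam < `|M (u i) w|].
have FH i : F (u i) (H i).
  apply: measurable_wrt_gt.
  by apply: measurable_wrt_abs; [exact: filtration_sigma|exact: aM].
have level i A : u i <= S -> F (u i) A -> A `<=` H i ->
    lam ^+ 2 * \int[P]_w \1_A w <= \int[P]_w (\1_A w * M S w ^+ 2).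
  move=> uiS FA AH; have mA := filtration_measurable (u0 i) FA.
  have bA := @bounded_measurable_indic _ _ R _ mA.
  rewrite (martingale_pythagoras bM (u0 i) uiS FA) -meanZ; last exact: finite_mean_bounded.
  rewrite -[leLHS]addr0 lerD//; last first.
    by apply: Rintegral_ge0 => w _; rewrite mulr_ge0 ?sqr_ge0// indicE.
  apply: le_mean.
  - exact/finite_mean_bounded/bounded_measurableZ.
  - apply/finite_mean_bounded/bounded_measurableM => //.
    exact/bounded_measurable_sqr/bounded_martingale_measurable.
  - move=> w; rewrite indicE; have [wA|wA] := boolP (w \in A); last by rewrite mulr0 mul0r.
    rewrite mulr1 mul1r -[leRHS]real_normK ?num_real// ler_sqr ?nnegrE ?(ltW lam0)//.
    by apply/ltW/AH; exact: set_mem.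
elim: r => [|r IH] rS.
  exists (H 0%N) => //; split; last by apply: (level 0%N) => //; exact: rS.
  by rewrite bigcup_mkord big_ord1.
have [B FB [BE le_B]] : exists2 B, F (u r) B &
   (B = \bigcup_(i < r.+1) H i) /\
   lam ^+ 2 * \int[P]_w \1_B w <= \int[P]_w (\1_B w * M S w ^+ 2).
  by apply: IH => i ir; apply: rS; exact: leqW.
have FB' : F (u r.+1) B by apply: filtration_le FB.
have FD : F (u r.+1) (H r.+1 `&` ~` B).
  by apply: filtrationI => //; exact: filtrationC.
have le_D := level r.+1 _ (rS _ (leqnn _)) FD (@subIsetl _ _ _).
exists (B `|` H r.+1); first exact: filtrationU.
split; first by rewrite BE !bigcup_mkord [RHS]big_ord_recr.
have mB := filtration_measurable (u0 r) FB; have mD := filtration_measurable (u0 _) FD.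
have bB := @bounded_measurable_indic _ _ R _ mB.
have bD := @bounded_measurable_indic _ _ R _ mD.
have S0 : 0 <= S by apply: le_trans (u0 r.+1) (rS _ (leqnn _)).
have bS := bounded_measurable_sqr (bounded_martingale_measurable bM S0).
have E w : \1_(B `|` H r.+1) w = \1_B w + \1_(H r.+1 `&` ~` B) w :> R.
  rewrite !indicE in_setU in_setI in_setC.
  by case: (w \in B); case: (w \in H r.+1); rewrite /= ?addr0 ?add0r.
under eq_Rintegral do rewrite E.
under [leRHS]eq_Rintegral do rewrite E mulrDl.
rewrite !meanD; try by apply: finite_mean_bounded => //; exact: bounded_measurableM.
by rewrite mulrDr lerD.
Qed.

(** Along the dyadic times the exceedance sets increase to the exceedance set
    of the whole continuous path. *)
Lemma doob_maximal (k : nat) : S = k%:R -> (0 < k)%N ->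
  (forall w, continuous_path (M ^~ w)) ->
  exists2 B, measurable B &
   (forall w, ~ B w -> forall t, 0 <= t <= S -> `|M t w| <= lam) /\
   (P B <= (\int[P]_w (M S w ^+ 2) / lam ^+ 2)%:E)%E.
Proof.
move=> Sk k0 cM; have l2 : 0 < lam ^+ 2 by rewrite exprn_gt0.
pose H t := [set w | lam < `|M t w|].
have p0 m : 0 < 2 ^+ m :> R by rewrite exprn_gt0.
pose u m i : R := i%:R / 2 ^+ m.
pose B m := \bigcup_(i < (k * 2 ^ m).+1) H (u m i).
have u0 m i : 0 <= u m i by rewrite divr_ge0// ltW.
have kE m : (k * 2 ^ m)%:R / 2 ^+ m = S.
  by rewrite natrM natrX mulfK ?gt_eqF// Sk.
have uS m i : (i <= k * 2 ^ m)%N -> u m i <= S.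
  by move=> ik; rewrite -(kE m) ler_pM2r ?invr_gt0// ler_nat.
have BE m : F S (B m) /\ (P (B m) <= (\int[P]_w (M S w ^+ 2) / lam ^+ 2)%:E)%E.
  have [A FA [AE leA]] := @doob_grid (u m) (k * 2 ^ m) (u0 m)
    (ltac:(move=> i; rewrite ler_pM2r ?invr_gt0// ler_nat//)) (uS m).
  rewrite /B -AE; split; first by apply: filtration_le (uS _ _ (leqnn _)) FA.
  have mA := filtration_measurable (u0 _ _) FA.
  rewrite mean_indic// lee_fin ler_pdivlMr// mulrC (le_trans leA)//.
  have S0 : 0 <= S by rewrite Sk.
  have bS := bounded_measurable_sqr (bounded_martingale_measurable bM S0).
  have bA := @bounded_measurable_indic _ _ R _ mA.
  apply: le_mean.
  - exact/finite_mean_bounded/bounded_measurableM.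
  - exact: finite_mean_bounded.
  - by move=> w; rewrite ler_piMl ?sqr_ge0// indicE; case: (_ \in _).
have S0 : 0 <= S by rewrite Sk.
have mB m : measurable (B m) by apply: filtration_measurable (BE m).1.
exists (\bigcup_m B m); first exact: bigcupT_measurable.
split.
  move=> w nB; apply: (le_on_dyadics (continuous_path_abs (cM w))) => //.
    by rewrite Sk ltr0n.
  move=> i m /andP[_ imS]; rewrite leNgt; apply/negP => lt_M; apply: nB.
  exists m => //; exists i => //=.
  by move: (ltW imS); rewrite -(kE m) ler_pM2r ?invr_gt0// ler_nat ltnS.
have cvB : (P \o B) x @[x --> \oo] --> P (\bigcup_m B m).
  apply: nondecreasing_cvg_mu => //; first exact: bigcupT_measurable.
  apply/nondecreasing_seqP => m; apply/subsetPset => w [i /= im Hi].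
  exists (2 * i)%N => /=; first by rewrite ltnS expnS mulnCA leq_mul2l -ltnS im.
  suff -> : u m.+1 (2 * i)%N = u m i by [].
  by rewrite /u exprS natrM -mulf_div divff ?mul1r.
rewrite -(cvg_lim _ cvB)//; apply: lime_le; first by apply/cvg_ex; eexists; exact: cvB.
by apply: nearW => m; exact: (BE m).2.
Qed.

End doob.

End martingales.

(** * Limits of martingales, optional stopping and localization *)

Section fatou_real.
Context {d : measure_display} {T : measurableType d} {R : realType}.
Variable P : probability T R.

(** Fatou's lemma. The null set where the convergence fails is cut off first, so
    that the lower limit is the limit everywhere. *)
Lemma mean_abs_limit_le (f_ : nat -> T -> R) (f : T -> R) (c : R) :
  (forall n, finite_mean P (f_ n)) -> measurable_fun [set: T] f ->
  {ae P, forall w, f_ n w @[n --> \oo] --> f w} ->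
  (forall n, \int[P]_w `|f_ n w| <= c) ->
  finite_mean P f /\ \int[P]_w `|f w| <= c.
Proof.
move=> sf mf [N [mN N0 sN]] fc.
have cv w : ~ N w -> f_ n w @[n --> \oo] --> f w.
  by move=> Nw; apply: contrapT => h; apply: Nw; exact: sN.
have mCN : measurable (~` N) by exact: measurableC.
pose g n w := (\1_(~` N) w * `|f_ n w|)%:E : \bar R.
have mg n : measurable_fun [set: T] (g n).
  apply/measurable_EFinP; apply: measurable_funM; first exact: measurable_indic.
  by apply: measurableT_comp => //; exact: finite_mean_measurable (sf n).
have g0 n w : [set: T] w -> (0 <= g n w)%E.
  by move=> _; rewrite lee_fin mulr_ge0// indicE.
have einfE : (limn_einf (fun n => \int[P]_w g n w) <= c%:E)%E.
  rewrite limn_einf_lim; apply: lime_le; first exact: is_cvg_einfs.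
  apply: nearW => n; apply: (@le_trans _ _ (\int[P]_w g n w)%E).
    by apply: ereal_inf_lbound; exists n => /=.
  rewrite -(fineK (integrable_fin_num _ _)) ?lee_fin//.
  - apply: (le_trans _ (fc n)); apply: le_mean.
    + by apply: finite_mean_indicM => //; exact: finite_mean_abs.
    + exact: finite_mean_abs.
    + by move=> w; rewrite ler_piMl// indicE; case: (_ \in _).
  - by apply: finite_mean_indicM => //; exact: finite_mean_abs.
have limE w : limn_einf (g ^~ w) = (\1_(~` N) w * `|f w|)%:E.
  have : g n w @[n --> \oo] --> (\1_(~` N) w * `|f w|)%:E.
    apply: cvg_EFin; first exact: nearW.
    rewrite /comp/= indicE; have [wN|wN] := boolP (w \in ~` N).
      apply: cvgM; first exact: cvg_cst.
      by apply: cvg_norm; apply: cv; rewrite inE in wN.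
    by rewrite mul0r; under eq_fun do rewrite mul0r; exact: cvg_cst.
  by move=> /cvg_einfs /cvg_lim; rewrite limn_einf_lim; apply.
have le_c : (\int[P]_w (\1_(~` N) w * `|f w|)%:E <= c%:E)%E.
  apply: le_trans einfE; apply: le_trans (fatou P measurableT mg g0).
  by under [leRHS]eq_integral do rewrite limE.
have mabs : measurable_fun [set: T] (fun w => (`|f w|)%:E).
  by apply/measurable_EFinP; exact: measurableT_comp.
have eq_abs : (\int[P]_w (`|f w|)%:E = \int[P]_w (\1_(~` N) w * `|f w|)%:E)%E.
  apply: ae_eq_integral => //.
    apply/measurable_EFinP; apply: measurable_funM; first exact: measurable_indic.
    exact: measurableT_comp.
  exists N; split => // w /= nE; apply: contrapT => Nw; apply: nE => _.
  by rewrite indicE mem_set// mul1r.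
have sm : finite_mean P f.
  apply/integrableP; split; first exact/measurable_EFinP.
  rewrite (_ : (\int[P]_w _)%E = (\int[P]_w (`|f w|)%:E)%E) ?eq_abs; last first.
    by apply: eq_integral => w _.
  by rewrite (le_lt_trans le_c)// ltry.
split => //; rewrite -lee_fin /Rintegral fineK; first by rewrite eq_abs.
exact: (integrable_fin_num measurableT (finite_mean_abs sm)).
Qed.

End fatou_real.

Section grid_cell.
Context {R : realType}.
Variables (s h : R) (m : nat).

(** The grid cell of step [h] above [s] in which a stopping time with value [x]
    stops; the last of the [m] cells also collects the later values. *)
Definition stops_in_cell (i : nat) (x : R) : bool :=
  (s + i%:R * h < x) && ((x <= s + i.+1%:R * h) || (i.+1 == m)).

Lemma stops_in_no_cell (x : R) i : 0 <= h -> x <= s -> stops_in_cell i x = false.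
Proof.
move=> h0 xs; apply/negbTE; rewrite negb_and -leNgt; apply/orP; left.
by apply: (le_trans xs); rewrite lerDl mulr_ge0.
Qed.

Lemma stops_in_unique_cell (x : R) : 0 <= h -> (0 < m)%N -> s < x ->
  exists i : nat, [/\ (i < m)%N,
    forall f : nat -> R, \sum_(k < m) (stops_in_cell k x)%:R * f k = f i &
    `|s + i.+1%:R * h - Num.min (s + m%:R * h) x| <= h].
Proof.
move=> h0 m0 sx.
have ex : exists i : nat, (x <= s + i.+1%:R * h) || (i.+1 == m).
  by exists m.-1; rewrite prednK// eqxx orbT.
have leh i j : (i <= j)%N -> s + i%:R * h <= s + j%:R * h.
  by move=> ij; rewrite lerD2l ler_wpM2r// ler_nat.
case: (ex_minnP ex) => i Pi mini.
have im : (i < m)%N.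
  by rewrite -(prednK m0) ltnS; apply: mini; rewrite prednK// eqxx orbT.
have ix : s + i%:R * h < x.
  case: i Pi mini im => [_ _ _|i _ mini im]; first by rewrite mul0r addr0.
  rewrite ltNge; apply/negP => xi; have := mini i.
  by rewrite xi ltnn => /(_ isT).
have cell_i : stops_in_cell i x by rewrite /stops_in_cell ix.
exists i; split => //.
  move=> f; rewrite (bigD1 (Ordinal im))//= cell_i mul1r big1 ?addr0// => k ki.
  suff -> : stops_in_cell k x = false by rewrite mul0r.
  apply/negbTE; rewrite negb_and -leNgt negb_or -ltNge.
  have [ki'|ik|ki'] := ltngtP k i.
  - apply/orP; right; apply/andP; split.
      by apply: le_lt_trans ix; exact: leh.
    by rewrite neq_ltn (leq_ltn_trans ki' im).
  - case/orP: Pi => [xi|/eqP iE]; first by rewrite (le_trans xi)// leh.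
    by have : (k <= i)%N; [rewrite -ltnS iE|rewrite leqNgt ik].
  - by move: ki => /eqP; case; apply: val_inj.
have im' := leh _ _ im.
have Si : s + i.+1%:R * h = s + i%:R * h + h by rewrite -natr1 mulrDl mul1r addrA.
rewrite ler_norml; case/orP: Pi => [xi|/eqP iE].
  rewrite min_r ?(le_trans xi)//; apply/andP; split; first by lra.
  by rewrite Si; lra.
rewrite iE in im' Si *; have [?|?] := leP (s + m%:R * h) x.
  by apply/andP; split; lra.
by apply/andP; split; rewrite ?Si; lra.
Qed.

End grid_cell.

Lemma indic_bool {T : Type} {R : pzRingType} (b : T -> bool) w :
  \1_[set w | b w] w = (b w)%:R :> R.
Proof.
by rewrite indicE; congr ((nat_of_bool _)%:R); apply/idP/idP; rewrite inE.
Qed.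

Section stopping.
Context {d : measure_display} {T : measurableType d} {R : realType}.
Variables (P : probability T R) (F : R -> set (set T)).
Hypotheses (Ffilt : filtration F) (Fusual : usual_conditions P F).
Implicit Types (M Y : R -> T -> R) (theta : T -> R).

Let F_sigma := filtration_sigma Ffilt.

Let F_measurable := filtration_measurable Ffilt.

Let F_le := filtration_le Ffilt.

Let F_null := filtration_null Ffilt Fusual.

Lemma adapted_ae_limit (Y_ : nat -> R -> T -> R) Y :
  (forall k, adapted F (Y_ k)) ->
  (forall t, 0 <= t -> {ae P, forall w, Y_ k t w @[k --> \oo] --> Y t w}) ->
  adapted F Y.
Proof.
move=> aY YY t t0; apply: (measurable_wrt_ae_lim (F_sigma t0) _ _ (YY t t0)).
  by move=> A; exact: F_null.
by move=> k; exact: aY.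
Qed.

(** The rate [r] does not depend on the time, and Cauchy bounds pass to the
    limit by Fatou's lemma: the limit is then also one in mean, which preserves
    the integrals of increments over past events. *)
Lemma martingale_limit (Y_ : nat -> R -> T -> R) Y (r : nat -> R) :
  (forall k, martingale P F (Y_ k)) ->
  (forall t, 0 <= t -> {ae P, forall w, Y_ k t w @[k --> \oo] --> Y t w}) ->
  (forall t k l, 0 <= t -> (k <= l)%N -> \int[P]_w `|Y_ k t w - Y_ l t w| <= r k) ->
  r k @[k --> \oo] --> (0 : R) -> martingale P F Y.
Proof.
move=> mY YY Yr r0.
have sY k t : 0 <= t -> finite_mean P (Y_ k t) by case: (mY k) => _ + _; exact.
have aY : adapted F Y by apply: adapted_ae_limit YY => k; case: (mY k).
have close t k : 0 <= t -> finite_mean P (fun w => Y_ k t w - Y t w) /\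
    \int[P]_w `|Y_ k t w - Y t w| <= r k.
  move=> t0; apply: (@mean_abs_limit_le _ _ _ P
      (fun n w => Y_ k t w - Y_ (n + k)%N t w)).
  - by move=> n; apply: finite_meanB; exact: sY.
  - apply: measurable_funB; first exact: finite_mean_measurable (sY k t t0).
    exact: (measurable_of_wrt Ffilt t0 (aY t t0)).
  - apply: filterS (YY t t0) => w Yw; apply: cvgB; first exact: cvg_cst.
    by rewrite (cvg_shiftn k (fun n => Y_ n t w)).
  - by move=> n; apply: Yr => //; exact: leq_addl.
have sYt t : 0 <= t -> finite_mean P (Y t).
  move=> t0; have := finite_meanB (sY 0%N t t0) (close t 0%N t0).1.
  by under eq_fun do rewrite opprB addrC subrK.
apply: (martingale_of_increment Ffilt aY sYt) => s t A s0 st FA.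
have t0 := le_trans s0 st; have mA := F_measurable s0 FA.
set x := \int[P]_w _.
have x_le k : `|x| <= r k + r k.
  have sA (f : T -> R) : finite_mean P f -> finite_mean P (fun w => \1_A w * f w).
    exact: finite_mean_indicM.
  have le1 u : 0 <= u -> `|\int[P]_w (\1_A w * (Y_ k u w - Y u w))| <= r k.
    move=> u0; have [sk lek] := close u k u0.
    apply: (le_trans (le_normr_Rintegral _ _)) => //; first exact: sA.
    apply: le_trans lek; apply: le_mean.
    - exact/finite_mean_abs/sA.
    - exact: finite_mean_abs.
    - by move=> w; rewrite normrM ler_piMl// indicE; case: (_ \in _);
        rewrite ?normr1 ?normr0.
  have := martingale_increment Ffilt (mY k) s0 st FA.
  have -> : x = \int[P]_w (\1_A w * (Y_ k t w - Y_ k s w)) -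
      (\int[P]_w (\1_A w * (Y_ k t w - Y t w)) -
       \int[P]_w (\1_A w * (Y_ k s w - Y s w))).
    rewrite -!meanB.
    - by rewrite /x; apply: eq_Rintegral => w _; ring.
    - by apply: sA; apply: finite_meanB; exact: sY.
    - by apply: finite_meanB; apply: sA; exact: (close _ _ _).1.
    - by apply: sA; exact: (close _ _ _).1.
    - by apply: sA; exact: (close _ _ _).1.
  move=> ->; rewrite sub0r normrN (le_trans (ler_normB _ _))//.
  by rewrite lerD// le1.
apply/normr0_eq0/eqP; rewrite eq_le normr_ge0 andbT.
have r20 : (r k + r k) @[k --> \oo] --> (0 : R).
  by rewrite -[X in _ --> X]addr0; exact: cvgD.
rewrite -(cvg_lim _ r20)//; apply: limr_ge; first by apply/cvg_ex; exists 0.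
by apply: nearW => k; exact: x_le.
Qed.

Definition real_stopping_time theta :=
  (forall w, 0 <= theta w) /\ forall t, 0 <= t -> F t [set w | theta w <= t].

Section optional_stopping.
Variables (Y : R -> T -> R) (theta : T -> R) (C : R).
Hypotheses (mY : martingale P F Y) (cY : forall w, continuous_path (Y ^~ w)).
Hypothesis stop : real_stopping_time theta.
Hypothesis YC : forall t w, 0 <= t -> `|Y (Num.min t (theta w)) w| <= C.

Let step (s t : R) n : R := (t - s) / n.+1%:R.
Let time s t n k : R := s + k.+1%:R * step s t n.
Let cell s t n k w : bool := stops_in_cell s (step s t n) n.+1 k (theta w).

Let step_ge0 s t n : s <= t -> 0 <= step s t n.
Proof. by move=> st; rewrite divr_ge0// subr_ge0. Qed.

Let time_le s t n k : s <= t -> (k <= n)%N -> time s t n k <= t.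
Proof.
move=> st kn; rewrite /time -lerBrDl /step mulrC -mulrA ler_piMr ?subr_ge0//.
by rewrite mulrC ler_pdivrMr ?ltr0n// mul1r ler_nat.
Qed.

Let time_ge s t n k : s <= t -> s <= time s t n k.
Proof. by move=> st; rewrite lerDl mulr_ge0// step_ge0. Qed.

Let F_gt u t : 0 <= u -> u <= t -> F t [set w | u < theta w].
Proof.
move=> u0 ut; have -> : [set w | u < theta w] = ~` [set w | theta w <= u].
  by apply/seteqP; split=> w /=; rewrite ltNge => /negP.
apply: (filtrationC Ffilt (le_trans u0 ut)).
by apply: (F_le u0 ut); exact: (stop.2 _ u0).
Qed.

Let F_cell s t n k : 0 <= s -> s <= t -> F (time s t n k) [set w | cell s t n k w].
Proof.
move=> s0 st; have k0 : 0 <= s + k%:R * step s t n.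
  by rewrite addr_ge0// mulr_ge0// step_ge0.
have le_k : s + k%:R * step s t n <= time s t n k.
  by rewrite lerD2l ler_wpM2r ?step_ge0// ler_nat.
have u0 : 0 <= time s t n k by rewrite (le_trans k0).
have -> : [set w | cell s t n k w] = [set w | s + k%:R * step s t n < theta w] `&`
    ([set w | theta w <= time s t n k] `|` (if k.+1 == n.+1 then setT else set0)).
  apply/seteqP; split=> w; rewrite /setI /setU /cell /stops_in_cell /mkset;
      case: (k.+1 == n.+1).
  - by move=> /andP[-> _]; split => //; right.
  - by rewrite orbF => /andP[-> ->]; split => //; left.
  - by move=> [-> _]; rewrite orbT.
  - by move=> [-> [->|[]]].
apply: filtrationI => //; first exact: F_gt.
apply: filtrationU => //; first exact: stop.2.
have [_ FC _] := F_sigma u0; have [F0 _ _] := F_sigma u0.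
case: ifP => _ //; by rewrite -(setD0 setT); exact: FC.
Qed.

Let stepE s t n : s + n.+1%:R * step s t n = t.
Proof. by rewrite /step mulrCA divff ?gt_eqF ?ltr0n// mulr1 subrKC. Qed.

Let cell_selects s t w n : s <= t -> s < theta w -> exists u,
  [/\ 0 <= u - s, `|u - Num.min t (theta w)| <= step s t n &
  forall f : R -> R, \sum_(k < n.+1) (cell s t n k w)%:R * f (time s t n k) = f u].
Proof.
move=> st sw; have h0 := step_ge0 n st.
have [i [im sumE]] := stops_in_unique_cell h0 (ltn0Sn n) sw.
rewrite stepE => near_i; exists (time s t n i); split => //.
  by rewrite subr_ge0 time_ge.
by move=> f; exact: (sumE (fun k => f (time s t n k))).
Qed.

Let step_cvg s t : step s t n @[n --> \oo] --> (0 : R).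
Proof.
rewrite -(mulr0 (t - s)); apply: cvgM; first exact: cvg_cst.
exact: (@cvg_harmonic R).
Qed.

Let theta0 w : 0 <= theta w. Proof. exact: stop.1. Qed.

Let min0 t w : 0 <= t -> 0 <= Num.min t (theta w).
Proof. by move=> t0; rewrite le_min t0 theta0. Qed.

Let stopped_value s t w e : 0 <= s -> s <= t -> 0 < e ->
  \forall n \near \oo, forall u, 0 <= u - s ->
    `|u - Num.min t (theta w)| <= step s t n ->
    `|Y u w - Y (Num.min t (theta w)) w| <= e.
Proof.
move=> s0 st e0; have t0 := le_trans s0 st.
have [d0 d0P dP] := (continuous_pathP _).1 (@cY w) _ (min0 w t0) e e0.
have /cvgrPdist_lt/(_ _ d0P) := step_cvg s t; apply: filterS => n.
rewrite sub0r normrN ger0_norm ?step_ge0// => sn u us un.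
by apply: dP; [lra|exact: le_lt_trans sn].
Qed.

Lemma stopped_adapted : adapted F (fun t w => Y (Num.min t (theta w)) w).
Proof.
move=> t t0; have [aY _ _] := mY.
apply: (@measurable_wrt_ae_lim _ _ _ P _ (F_sigma t0) _ (fun n w =>
  \1_[set w | theta w <= 0] w * Y 0 w +
  \sum_(k < n.+1) (cell 0 t n k w)%:R * Y (time 0 t n k) w)).
- by move=> A; exact: F_null.
- move=> n; apply: measurable_wrtD; first exact: F_sigma.
    apply: measurable_wrtM; first exact: F_sigma.
      apply: measurable_wrt_indic; first exact: F_sigma.
      by apply: F_le t0 (stop.2 0 _).
    by apply: measurable_wrt_le t0 (aY 0 _).
  apply: measurable_wrt_sum; first exact: F_sigma.
  move=> k; have u0 := time_ge n k t0; have ut := time_le t0 (ltn_ord k : (k <= n)%N).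
  apply: (measurable_wrt_le Ffilt u0 ut); apply: measurable_wrtM.
  + exact: F_sigma.
  + have := measurable_wrt_indic (R := R) (F_sigma u0) (F_cell n k (lexx 0) t0).
    congr (measurable_wrt _ _).
    by apply/funext => w; rewrite indic_bool.
  + exact: aY.
apply: aeW => w; have [w0|w0] := leP (theta w) 0.
  have tw : theta w = 0 by apply/eqP; rewrite eq_le w0 theta0.
  rewrite indicE mem_set// mul1r tw min_r//.
  rewrite (_ : (fun n => _) = fun=> Y 0 w); first exact: cvg_cst.
  apply/funext => n; rewrite big1 ?addr0// => k _.
  by rewrite /cell stops_in_no_cell ?mul0r// ?step_ge0// tw.
rewrite indicE memNset ?mul0r; last by move=> /=; rewrite leNgt w0.
apply/cvgrPdist_le => e e0; apply: filterS (stopped_value w (lexx 0) t0 e0) => n H.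
have [u [u0 un sumE]] := @cell_selects 0 t w n t0 w0.
by rewrite add0r (sumE (Y ^~ w)) distrC; exact: H.
Qed.

Let kept (y : R) : R := (`|y| <= C + 1)%R%:R.

Let kept_sum s t n w (b : R -> R) := \sum_(k < n.+1)
  (cell s t n k w)%:R * (kept (Y (time s t n k) w) * b (time s t n k)).

Let kept_sum_cvg s t w (b : R -> R) l : 0 <= s -> s <= t -> s < theta w ->
  (forall e, 0 < e -> \forall n \near \oo, forall u, 0 <= u - s ->
    `|u - Num.min t (theta w)| <= step s t n -> `|b u - l| <= e) ->
  kept_sum s t n w b @[n --> \oo] --> l.
Proof.
move=> s0 st sw bl; have t0 := le_trans s0 st.
apply/cvgrPdist_le => e e0.
near=> n; have [u [u0 un sumE]] := @cell_selects s t w n st sw.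
rewrite /kept_sum (sumE (fun u => kept (Y u w) * b u)).
have -> : kept (Y u w) = 1.
  rewrite /kept; suff -> : `|Y u w| <= C + 1 by [].
  have : `|Y u w - Y (Num.min t (theta w)) w| <= 1.
    by move: u u0 un {sumE}; near: n; exact: stopped_value.
  have := ler_distD 0 (Y u w) (Y (Num.min t (theta w)) w).
  rewrite !subr0 sub0r normrN; have := YC w t0.
  have := ler_normD (Y u w - Y (Num.min t (theta w)) w) (Y (Num.min t (theta w)) w).
  by rewrite subrK; lra.
rewrite mul1r distrC; move: u u0 un {sumE}; near: n; exact: bl.
Unshelve. all: by end_near. Qed.

Let kept_sum_le s t n w (b : R -> R) c : 0 <= c ->
  (forall u, kept (Y u w) * `|b u| <= c) -> s <= t -> `|kept_sum s t n w b| <= c.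
Proof.
move=> c0 bc st; have [ws|sw] := leP (theta w) s.
  rewrite /kept_sum big1 ?normr0// => k _.
  by rewrite /cell stops_in_no_cell ?mul0r// step_ge0.
have [u [u0 un sumE]] := @cell_selects s t w n st sw.
by rewrite /kept_sum (sumE (fun u => kept (Y u w) * b u)) normrM ger0_norm//.
Qed.

Let kept_sum_out s t n w (b : R -> R) : s <= t -> theta w <= s ->
  kept_sum s t n w b = 0.
Proof.
move=> st ws; rewrite /kept_sum big1// => k _.
by rewrite /cell stops_in_no_cell ?mul0r// step_ge0.
Qed.

Let C0 : 0 <= C. Proof. by apply: le_trans (YC point (lexx 0)). Qed.

(* a kept cell is an event known at the end of the cell, so that there [Y] at
   that end and [Y t] have the same integral *)
Let kept_sum_integral s t n A : 0 <= s -> s <= t -> F s A ->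
  \int[P]_w (\1_A w * kept_sum s t n w (Y ^~ w)) =
  \int[P]_w (\1_A w * kept_sum s t n w (fun=> Y t w)).
Proof.
move=> s0 st FA; have [aY sY _] := mY; have t0 := le_trans s0 st.
pose G k := A `&` [set w | cell s t n k w] `&` [set w | `|Y (time s t n k) w| <= C + 1].
have k0 k : 0 <= time s t n k by rewrite (le_trans s0)// time_ge.
have FG k : F (time s t n k) (G k).
  apply: filtrationI => //; first apply: filtrationI => //.
  - by apply: F_le FA => //; exact: time_ge.
  - exact: F_cell.
  - have -> : [set w | `|Y (time s t n k) w| <= C + 1] =
        ~` [set w | C + 1 < `|Y (time s t n k) w|].
      by apply/seteqP; split=> w /=; rewrite leNgt => /negP.
    apply: filtrationC => //; apply: measurable_wrt_gt.
    by apply: measurable_wrt_abs; [exact: F_sigma|exact: aY].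
have mG k : measurable (G k) by exact: F_measurable (FG k).
have E (b : T -> R -> R) w : \1_A w * kept_sum s t n w (b w) =
    \sum_(k < n.+1) \1_(G k) w * b w (time s t n k).
  rewrite /kept_sum mulr_sumr; apply: eq_bigr => k _.
  rewrite !mulrA; congr (_ * _); rewrite !indicE !in_setI /kept.
  have -> : (w \in [set w | cell s t n k w]) = cell s t n k w.
    by apply/idP/idP; rewrite inE.
  have -> : (w \in [set w | `|Y (time s t n k) w| <= C + 1]) =
      (`|Y (time s t n k) w| <= C + 1) by apply/idP/idP; rewrite inE.
  by rewrite -!mulnb !natrM.
under eq_Rintegral do rewrite (E (fun w u => Y u w)).
under [RHS]eq_Rintegral do rewrite (E (fun w _ => Y t w)).
have [|_ ->] := @mean_sum _ _ _ P _ (index_enum 'I_n.+1)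
    (fun k w => \1_(G k) w * Y (time s t n k) w).
  by move=> k; apply: finite_mean_indicM => //; exact: sY.
have [|_ ->] := @mean_sum _ _ _ P _ (index_enum 'I_n.+1)
    (fun k w => \1_(G k) w * Y t w).
  by move=> k; apply: finite_mean_indicM => //; exact: sY.
apply: eq_bigr => k _; apply/eqP; rewrite eq_sym -subr_eq0 -meanB; last 2 first.
- by apply: finite_mean_indicM => //; exact: sY.
- by apply: finite_mean_indicM => //; exact: sY.
have kt : time s t n k <= t by apply: time_le => //; rewrite -ltnS.
apply/eqP; rewrite -[RHS](martingale_increment Ffilt mY (k0 k) kt (FG k)).
by apply: eq_Rintegral => w _; rewrite mulrBr.
Qed.

(** Here [Y] itself may be unbounded. Discretise the stopping time, and only keep
    the cells at whose end [Y] is at most [C + 1]: on these [Y] has the same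
    integral as [Y t], dominated convergence applies on both sides, and in the
    limit every cell is kept. *)
Theorem optional_stopping :
  bounded_martingale P F (fun t w => Y (Num.min t (theta w)) w).
Proof.
split; last by exists C => t w t0; exact: YC.
have [aY sY _] := mY.
have bS t : 0 <= t -> bounded_measurable (fun w => Y (Num.min t (theta w)) w).
  move=> t0; split; last by exists C => w; exact: YC.
  exact: (measurable_of_wrt Ffilt t0 (stopped_adapted t0)).
apply: (martingale_of_increment Ffilt).
- exact: stopped_adapted.
- by move=> t t0; apply: finite_mean_bounded; exact: bS.
move=> s t A s0 st FA; have t0 := le_trans s0 st.
have [<-|nst] := eqVneq s t.
  by under eq_Rintegral do rewrite subrr mulr0; exact: mean_cst.
have mA := F_measurable s0 FA.
have FH : F s [set w | s < theta w] by exact: F_gt.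
have FAH := filtrationI Ffilt s0 FA FH.
set H := [set w | s < theta w] in FH FAH.
have mAH := F_measurable s0 FAH.
have AHE w : \1_(A `&` H) w = \1_A w * \1_H w :> R.
  by rewrite !indicE in_setI -mulnb natrM.
have sum_measurable n (b : T -> R -> R) : (forall k : 'I_n.+1,
      measurable_fun [set: T] (fun w => b w (time s t n k))) ->
    measurable_fun [set: T] (fun w => \1_A w * kept_sum s t n w (b w)).
  move=> mb; apply: measurable_funM; first exact: measurable_indic.
  apply: measurable_sum => k; have k0 : 0 <= time s t n k.
    by rewrite (le_trans s0)// time_ge.
  apply: measurable_funM.
    have mc := F_measurable k0 (F_cell n k s0 st).
    have := @measurable_indic _ _ R setT _ mc; congr (measurable_fun _ _).
    by apply/funext => w; rewrite indic_bool.
  apply: measurable_funM => //; rewrite /kept.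
  have mY' : measurable_fun [set: T] (fun w => `|Y (time s t n k) w|).
    by apply: measurableT_comp => //; exact: finite_mean_measurable (sY _ k0).
  have mS : measurable [set w | `|Y (time s t n k) w| <= C + 1].
    have -> : [set w | `|Y (time s t n k) w| <= C + 1] =
        (fun w => `|Y (time s t n k) w|) @^-1` `]-oo, C + 1]%classic.
      by apply/seteqP; split=> w /=; rewrite in_itv.
    by rewrite -[X in measurable X]setTI; apply: mY' => //; exact: measurable_itv.
  have := @measurable_indic _ _ R setT _ mS; congr (measurable_fun _ _).
  by apply/funext => w; rewrite indic_bool.
have lim_case (w : T) (b : R -> R) (l : R) : (s < theta w -> kept_sum s t n w b @[n --> \oo] --> l) ->
    \1_A w * kept_sum s t n w b @[n --> \oo] --> \1_(A `&` H) w * l.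
  rewrite AHE => cv; have [ws|sw] := leP (theta w) s.
    rewrite [X in _ * X * _]indicE memNset /=; last by rewrite /H/= ltNge ws.
    rewrite mulr0 mul0r; under eq_fun do rewrite kept_sum_out// mulr0.
    exact: cvg_cst.
  rewrite [X in _ * X * _]indicE mem_set//= mulr1.
  by apply: cvgM; [exact: cvg_cst|exact: cv].
have ind1 w : `|\1_A w : R| <= 1.
  by rewrite indicE; case: (_ \in _); rewrite ?normr1 ?normr0.
have C10 : 0 <= C + 1 by rewrite addr_ge0// C0.
have L1 : \int[P]_w (\1_A w * kept_sum s t n w (Y ^~ w)) @[n --> \oo] -->
    \int[P]_w (\1_(A `&` H) w * Y (Num.min t (theta w)) w).
  apply: (mean_dominated_cvg (g := fun=> C + 1)).
  - move=> n; apply: sum_measurable => k; apply: finite_mean_measurable (sY _ _).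
    by rewrite (le_trans s0)// time_ge.
  - by apply: measurable_funM; [exact: measurable_indic|case: (bS t t0)].
  - apply: aeW => w; apply: lim_case => sw; apply: kept_sum_cvg => // e e0.
    exact: stopped_value.
  - exact/finite_mean_bounded/bounded_measurable_cst.
  - move=> n w; rewrite normrM -[leRHS]mul1r ler_pM// kept_sum_le// => u.
    by rewrite /kept; have [h|h] := boolP (`|Y u w| <= C + 1); rewrite ?mul1r ?mul0r.
have L2 : \int[P]_w (\1_A w * kept_sum s t n w (fun=> Y t w)) @[n --> \oo] -->
    \int[P]_w (\1_(A `&` H) w * Y t w).
  apply: (mean_dominated_cvg (g := fun w => `|Y t w|)).
  - by move=> n; apply: sum_measurable => k; exact: finite_mean_measurable (sY _ t0).
  - apply: measurable_funM; first exact: measurable_indic.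
    exact: finite_mean_measurable (sY _ t0).
  - apply: aeW => w; apply: lim_case => sw; apply: kept_sum_cvg => // e e0.
    by apply: nearW => n u _ _; rewrite subrr normr0 ltW.
  - exact/finite_mean_abs/sY.
  - move=> n w; rewrite normrM -[leRHS]mul1r ler_pM// kept_sum_le// => u.
    by rewrite /kept; have [h|h] := boolP (`|Y u w| <= C + 1); rewrite ?mul1r ?mul0r.
have eqlim : \int[P]_w (\1_(A `&` H) w * Y (Num.min t (theta w)) w) =
    \int[P]_w (\1_(A `&` H) w * Y t w).
  have E n := kept_sum_integral n s0 st FA.
  rewrite (funext E) in L1; exact: (cvg_unique (@Rhausdorff R) L1 L2).
rewrite (@eq_Rintegral _ _ _ _ _ (fun w => \1_(A `&` H) w * Y (Num.min t (theta w)) w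
   - \1_(A `&` H) w * Y s w)); last first.
  move=> w _; rewrite AHE -mulrBr -mulrA; congr (_ * _).
  have [ws|sw] := leP (theta w) s.
    rewrite (min_r (le_trans ws st)) subrr [\1_H w]indicE memNset ?mul0r//.
    by rewrite /H/= ltNge ws.
  by rewrite [\1_H w]indicE mem_set// mul1r.
rewrite meanB ?eqlim; last 2 first.
- by apply: finite_mean_indicM => //; apply: finite_mean_bounded; exact: bS.
- by apply: finite_mean_indicM => //; exact: sY.
rewrite -meanB; last 2 first.
- by apply: finite_mean_indicM => //; exact: sY.
- by apply: finite_mean_indicM => //; exact: sY.
rewrite -[RHS](martingale_increment Ffilt mY s0 st FAH).
by apply: eq_Rintegral => w _; rewrite mulrBr.
Qed.

End optional_stopping.

End stopping.

Section localization.
Context {d : measure_display} {T : measurableType d} {R : realType}.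
Variables (P : probability T R) (F : R -> set (set T)).
Hypotheses (Ffilt : filtration F) (Fusual : usual_conditions P F).
Implicit Types (M : R -> T -> R).

Let F_sigma := filtration_sigma Ffilt.

Let F_le := filtration_le Ffilt.

Let F_null := filtration_null Ffilt Fusual.

Let F_ae t (A : set T) : 0 <= t -> {ae P, forall w, A w} -> F t A.
Proof.
by move=> t0 NA; rewrite -(setCK A); apply: (filtrationC Ffilt) => //; exact: F_null.
Qed.

Lemma filtration_constant t (p : Prop) : 0 <= t -> F t [set _ | p].
Proof.
move=> t0; have [F0 FC _] := F_sigma t0; have [hp|np] := pselect p.
  by rewrite (_ : [set _ | p] = setT); [rewrite -(setD0 setT); exact: FC|
    apply/seteqP; split].
by rewrite (_ : [set _ | p] = set0)//; apply/seteqP; split.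
Qed.

(** By right-continuity of the filtration. *)
Lemma stopping_time_of_lt (rho : T -> R) : (forall w, 0 <= rho w) ->
  (forall t, 0 <= t -> F t [set w | rho w < t]) -> real_stopping_time F rho.
Proof.
move=> rho0 Frho; split => // t t0.
have [rc _] := Fusual; rewrite rc// => s /= ts.
have st0 : 0 < s - t by rewrite subr_gt0.
pose u n : R := t + (s - t) / n.+1%:R.
have un n : t < u n by rewrite ltrDl divr_gt0.
have us n : u n <= s.
  by rewrite /u -lerBrDl ler_pdivrMr ?ltr0n// ler_peMr ?(ltW st0)// ler1n.
have -> : [set w | rho w <= t] = \bigcap_n [set w | rho w < u n].
  apply/seteqP; split=> w /=; first by move=> wt n _; exact: le_lt_trans (un n).
  move=> H; rewrite leNgt; apply/negP => tw.
  have rt : 0 < rho w - t by rewrite subr_gt0.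
  have [n nP] := pow2_gt ((s - t) / (rho w - t)).
  have := H (2 ^ n)%N I; rewrite /= ltNge => /negP; apply.
  rewrite /u -lerBrDl ler_pdivrMr ?ltr0n// mulrC -ler_pdivrMr//.
  by rewrite (le_trans (ltW nP))// -natrX ler_nat.
apply: (filtration_bigcap Ffilt); first by rewrite (le_trans t0)// ltW.
move=> n; have u0 : 0 <= u n by rewrite (le_trans t0)// ltW.
by apply: F_le (us n) (Frho _ u0).
Qed.

Lemma stopping_time_min (rho tau : T -> R) : real_stopping_time F rho ->
  real_stopping_time F tau -> real_stopping_time F (fun w => Num.min (rho w) (tau w)).
Proof.
move=> [rho0 Frho] [tau0 Ftau]; split=> [w|t t0].
  by rewrite le_min rho0 tau0.
have -> : [set w | Num.min (rho w) (tau w) <= t] =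
    [set w | rho w <= t] `|` [set w | tau w <= t].
  apply/seteqP; split=> w /=; rewrite ge_min; first by move=> /orP[]; [left|right].
  by case=> ->; rewrite ?orbT.
by apply: (filtrationU Ffilt) => //; [exact: Frho|exact: Ftau].
Qed.

Section exit_time.
Variables (M : R -> T -> R) (aM : adapted F M).
Hypothesis cM : forall w, continuous_path (M ^~ w).
Hypothesis M0 : forall w, M 0 w = 0.

(** The first time, capped by [n], at which [M] leaves [[-n, n]]. Looking at
    dyadic times only makes it a stopping time for free. *)
Let exits n w : set R := [set q | q = n%:R \/
  (exists i m : nat, q = i%:R / 2 ^+ m /\ n%:R < `|M q w|)].

Definition exit_time (n : nat) w : R := inf (exits n w).

Let exits_ge0 n w q : exits n w q -> 0 <= q.
Proof. by move=> [->|[i [m [-> _]]]]; rewrite ?divr_ge0// exprn_ge0. Qed.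

Let exits_lbound n w : has_lbound (exits n w).
Proof. by exists 0 => q; exact: exits_ge0. Qed.

Let exits_nonempty n w : exits n w !=set0.
Proof. by exists n%:R; left. Qed.

Let exit_time_ge n w (x : R) : (forall q, exits n w q -> x <= q) -> x <= exit_time n w.
Proof. by move=> H; apply: lb_le_inf. Qed.

Lemma exit_time_ge0 n w : 0 <= exit_time n w.
Proof. by apply: exit_time_ge => q; exact: exits_ge0. Qed.

Lemma exit_time_le n w : exit_time n w <= n%:R.
Proof. by apply: ge_inf => //; left. Qed.

Lemma exit_time_stopping n : real_stopping_time F (exit_time n).
Proof.
apply: stopping_time_of_lt => [|t t0]; first exact: exit_time_ge0.
pose A i m := if (i%:R / 2 ^+ m : R) < t
  then [set w | n%:R < `|M (i%:R / 2 ^+ m) w|] else set0.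
have -> : [set w | exit_time n w < t] =
    [set _ | n%:R < t] `|` \bigcup_i \bigcup_m A i m.
  apply/seteqP; split=> w /=.
    move=> /(inf_lt (exits_nonempty n w))[q [->|[i [m [qE Mq]]]] qt]; first by left.
    by right; exists i => //; exists m => //; rewrite /A -qE qt.
  move=> [nt|[i _ [m _]]]; first exact: le_lt_trans (exit_time_le n w) nt.
  rewrite /A; case: ifPn => // qt /= Mq; apply: le_lt_trans qt.
  by apply: ge_inf => //; right; exists i, m.
apply: (filtrationU Ffilt) => //; first exact: filtration_constant.
apply: (filtration_bigcup Ffilt) => // i; apply: (filtration_bigcup Ffilt) => // m.
rewrite /A; case: ifPn => qt; last by have [] := F_sigma t0.
have q0 : 0 <= i%:R / 2 ^+ m :> R by rewrite divr_ge0// exprn_ge0.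
apply: (F_le q0 (ltW qt)); apply: measurable_wrt_gt.
by apply: measurable_wrt_abs; [exact: F_sigma|exact: aM].
Qed.

Lemma exit_time_bound n w t : 0 <= t -> t <= exit_time n w -> `|M t w| <= n%:R.
Proof.
move=> t0; rewrite le_eqVlt => /orP[/eqP tE|].
  move: t0; rewrite le_eqVlt => /orP[/eqP <-|t0]; first by rewrite M0 normr0.
  apply: (le_on_dyadics (continuous_path_abs (@cM w)) (lexx 0) t0); last first.
    by rewrite lexx ltW.
  move=> i m /andP[_ it]; rewrite leNgt; apply/negP => nM.
  move: it; rewrite ltNge => /negP; apply; rewrite tE.
  by apply: ge_inf => //; right; exists i, m.
move=> te; apply: (le_on_dyadics (continuous_path_abs (@cM w)) (lexx 0)
    (le_lt_trans t0 te)); last by rewrite t0 ltW.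
move=> i m /andP[_ it]; rewrite leNgt; apply/negP => nM.
move: it; rewrite ltNge => /negP; apply.
by apply: ge_inf => //; right; exists i, m.
Qed.

Lemma exit_time_nondecreasing n w : exit_time n w <= exit_time n.+1 w.
Proof.
apply: exit_time_ge => q [->|[i [m [qE Mq]]]].
  by rewrite (le_trans (exit_time_le _ _))// ler_nat.
apply: ge_inf => //; right; exists i, m; split => //.
by apply: le_lt_trans Mq; rewrite ler_nat.
Qed.

Lemma exit_time_unbounded (c : R) w : exists n, forall k, (n <= k)%N -> c <= exit_time k w.
Proof.
have [c0|c0] := leP c 0.
  by exists 0%N => k _; rewrite (le_trans c0)// exit_time_ge0.
have cc : {within `[0, c], continuous (fun t => `|M t w|)}.
  apply: continuous_subspaceW (continuous_path_abs (@cM w)) => u /=.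
  by rewrite !in_itv/= andbT => /andP[].
have [u uc uP] := EVT_max (ltW c0) cc.
have [n1 n1P] := pow2_gt `|M u w|; have [n2 n2P] := pow2_gt c.
exists (2 ^ n1 + 2 ^ n2)%N => k nk; apply: exit_time_ge => q.
have k1 : 2 ^+ n1 <= k%:R :> R.
  by rewrite -natrX ler_nat (leq_trans _ nk)// leq_addr.
have k2 : 2 ^+ n2 <= k%:R :> R.
  by rewrite -natrX ler_nat (leq_trans _ nk)// leq_addl.
move=> [->|[i [m [qE Mq]]]]; first by rewrite (le_trans (ltW n2P)).
rewrite leNgt; apply/negP => qc; move: Mq; rewrite ltNge => /negP; apply.
have q0 : 0 <= q by rewrite qE divr_ge0// exprn_ge0.
apply: le_trans (uP q _) _; first by rewrite in_itv/= q0 ltW.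
by rewrite (le_trans (ltW n1P)).
Qed.

End exit_time.

Lemma stoppedE M (tau : T -> \bar R) t w : 0 <= t -> (t%:E <= tau w)%E ->
  stopped M tau t w = M t w.
Proof. by move=> t0 tt; rewrite /stopped (min_idPl tt). Qed.

Lemma continuous_stopped M (tau : T -> \bar R) w : (0 <= tau w)%E ->
  continuous_path (M ^~ w) -> continuous_path (fun t => stopped M tau t w).
Proof.
rewrite /stopped; case: (tau w) => [r| |//] /= r0 cM.
  apply: (@eq_continuous_path _ (fun t => M (Num.min t r) w)) => [t t0|].
    by rewrite -EFin_min.
  by apply: (@continuous_path_stop _ (M ^~ w) r); rewrite -?lee_fin.
by apply: eq_continuous_path cM => t t0; rewrite (min_idPl _)// leey.
Qed.

(** Stop [M] both along its own localizing sequence and when it leaves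
    [[-n, n]]. Discarding the null set where a path property fails makes all
    of it hold surely. *)
Lemma localize M (Good : set T) : local_martingale P F M ->
  {ae P, forall w, Good w} ->
  (forall w, Good w -> M 0 w = 0 /\ continuous_path (M ^~ w)) ->
  exists (G : set T) (theta : nat -> T -> R),
  [/\ {ae P, forall w, G w}, G `<=` Good,
      forall n, real_stopping_time F (theta n),
      forall w, [/\ nondecreasing_seq (theta ^~ w), forall n, theta n w <= n%:R &
        forall c : R, exists n, forall k, (n <= k)%N -> c <= theta k w] &
      forall n, bounded_martingale P F
        (fun t w => \1_G w * M (Num.min t (theta n w)) w)].
Proof.
move=> [aM [tau [stop ae_tau mart]]] aeGood GoodP.
pose G := [set w | Good w /\ (nondecreasing_seq (tau ^~ w) /\
  tau ^~ w @ \oo --> +oo%E)].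
have aeG : {ae P, forall w, G w} by apply: filterS2 aeGood ae_tau.
pose M' t w : R := \1_G w * M t w.
have M'G t w : G w -> M' t w = M t w by move=> Gw; rewrite /M' indicE mem_set// mul1r.
have M'NG t w : ~ G w -> M' t w = 0.
  by move=> Gw; rewrite /M' indicE memNset// mul0r.
have M'0 w : M' 0 w = 0.
  have [Gw|Gw] := pselect (G w); last exact: M'NG.
  by rewrite M'G//; case: (GoodP w Gw.1).
have cM' w : continuous_path (M' ^~ w).
  have [Gw|Gw] := pselect (G w).
    by apply: eq_continuous_path (GoodP w Gw.1).2 => t _; rewrite M'G.
  by apply: eq_continuous_path (@continuous_path_cst R 0) => t _; rewrite M'NG.
have aM' : adapted F M'.
  apply: (adapted_ae_eq Ffilt Fusual aM) => t t0.
  by apply: filterS aeG => w Gw; rewrite M'G.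
have tau0 n w : (0 <= tau n w)%E by case: (stop n).
pose tau' n w : R := if pselect (G w) then fine (mine (tau n w) n%:R%:E) else n%:R.
have tau'E n w : G w -> (tau' n w)%:E = mine (tau n w) n%:R%:E.
  move=> Gw; rewrite /tau'; case: pselect => // Gw'; rewrite fineK//.
  rewrite ge0_fin_numE; first by rewrite gt_min ltry orbT.
  by rewrite le_min tau0 lee_fin ler0n.
have tau'N n w : ~ G w -> tau' n w = n%:R by rewrite /tau'; case: pselect.
have stop' n : real_stopping_time F (tau' n).
  split=> [w|t t0].
    have [Gw|Gw] := pselect (G w); last by rewrite tau'N.
    by rewrite -lee_fin tau'E// le_min tau0 lee_fin ler0n.
  have -> : [set w | tau' n w <= t] =
      (G `&` ([set w | (tau n w <= t%:E)%E] `|` [set _ | n%:R <= t])) `|`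
      (~` G `&` [set _ | n%:R <= t]).
    apply/seteqP; split=> w /=.
      have [Gw|Gw] := pselect (G w); last by rewrite tau'N//; right.
      by rewrite -lee_fin tau'E// ge_min lee_fin => /orP[]; left; split; [|left| |right].
    move=> [[Gw]|[Gw nt]]; last by rewrite tau'N.
    by move=> h; rewrite -lee_fin tau'E// ge_min lee_fin; case: h => ->; rewrite ?orbT.
  have FG := F_ae t0 aeG; have Fn := filtration_constant (n%:R <= t) t0.
  apply: (filtrationU Ffilt) => //; apply: (filtrationI Ffilt) => //.
    by apply: (filtrationU Ffilt) => //; case: (stop n) => _; exact.
  exact: (filtrationC Ffilt).
pose theta n w := Num.min (exit_time M' n w) (tau' n w).
exists G, theta; split => //.
- by move=> w [].
- by move=> n; apply: stopping_time_min => //; exact: exit_time_stopping.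
- move=> w; split.
  + apply/nondecreasing_seqP => n; rewrite /theta le_min !ge_min.
    rewrite exit_time_nondecreasing/=; apply/orP; right.
    have [Gw|Gw] := pselect (G w); last by rewrite !tau'N// ler_nat.
    rewrite -lee_fin !tau'E// le_min !ge_min lee_fin ler_nat leqnSn orbT andbT.
    by case: Gw => _ [nd _]; rewrite nd.
  + by move=> n; rewrite ge_min exit_time_le.
  + move=> c; have [n1 n1P] := exit_time_unbounded cM' c w.
    have [n2 n2P] := pow2_gt c.
    have cn k : (2 ^ n2 <= k)%N -> c <= k%:R.
      by move=> nk; rewrite (le_trans (ltW n2P))// -natrX ler_nat.
    have [Gw|Gw] := pselect (G w); last first.
      exists (n1 + 2 ^ n2)%N => k nk; rewrite le_min tau'N// n1P ?cn//.
        by rewrite (leq_trans _ nk)// leq_addl.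
      by rewrite (leq_trans _ nk)// leq_addr.
    have [_ [_ /cvgeyPge/(_ c)[n3 _ n3P]]] := Gw.
    exists (n1 + 2 ^ n2 + n3)%N => k nk.
    have k1 : (n1 <= k)%N by rewrite (leq_trans _ nk)// -addnA leq_addr.
    have k2 : (2 ^ n2 <= k)%N by rewrite (leq_trans _ nk)// addnAC leq_addl.
    have k3 : (n3 <= k)%N by rewrite (leq_trans _ nk)// leq_addl.
    by rewrite le_min n1P//= -lee_fin tau'E// le_min n3P// lee_fin cn.
move=> n.
pose Y t w := \1_G w * (\1_[set w' | (0 < tau n w')%E] w * stopped M (tau n) t w).
have mY : martingale P F Y.
  apply: (martingale_ae_eq Ffilt Fusual (mart n)) => t t0.
  by apply: filterS aeG => w Gw; rewrite /Y (@indicE T R G) mem_set// mul1r.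
have cY w : continuous_path (Y ^~ w).
  rewrite /Y; have [Gw|Gw] := boolP (w \in G); last first.
    apply: eq_continuous_path (@continuous_path_cst R 0) => t _.
    by rewrite (@indicE T R G) (negbTE Gw) mul0r.
  apply: continuous_pathZ; apply: continuous_pathZ; apply: continuous_stopped => //.
  by rewrite inE in Gw; case: (GoodP w Gw.1).
have YE t w : 0 <= t -> Y (Num.min t (theta n w)) w = M' (Num.min t (theta n w)) w.
  move=> t0; have [Gw|Gw] := pselect (G w); last first.
    by rewrite M'NG// /Y (@indicE T R G) memNset// mul0r.
  have m0 : 0 <= Num.min t (theta n w).
    by rewrite le_min t0 le_min exit_time_ge0; case: (stop' n) => + _; apply.
  have mtau : ((Num.min t (theta n w))%:E <= tau n w)%E.
    apply: (@le_trans _ _ (tau' n w)%:E).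
      by rewrite lee_fin !ge_min lexx !orbT.
    by rewrite tau'E// ge_min lexx.
  rewrite /Y stoppedE// /M'; congr (_ * _).
  have [tw|tw] := boolP (0 < tau n w)%E; first by rewrite indicE mem_set// mul1r.
  have tw0 : tau n w = 0%E by apply/eqP; rewrite eq_le tau0 andbT leNgt.
  have -> : Num.min t (theta n w) = 0.
    by apply/eqP; rewrite eq_le m0 andbT -lee_fin; move: mtau; rewrite tw0.
  by case: (GoodP w Gw.1) => -> _; rewrite mulr0.
have bY t w : 0 <= t -> `|Y (Num.min t (theta n w)) w| <= n%:R.
  move=> t0; rewrite YE//; apply: (exit_time_bound cM' M'0).
    by rewrite le_min t0 le_min exit_time_ge0; case: (stop' n) => + _; apply.
  by rewrite !ge_min lexx orbT.
have stopn : real_stopping_time F (theta n).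
  by apply: stopping_time_min => //; exact: exit_time_stopping.
have [mS _] := optional_stopping Ffilt Fusual mY cY stopn bY.
split; last by exists n%:R => t w t0; rewrite -[X in `|X|]/(M' _ _) -YE// bY.
apply: (martingale_ae_eq Ffilt Fusual mS) => t t0.
by apply: aeW => w; rewrite YE.
Qed.

End localization.

(** * Convergence lemmas *)

Section convergence.
Context {R : realType}.

Lemma inv_pow2_cvg0 : (2 ^+ k)^-1 @[k --> \oo] --> (0 : R).
Proof.
apply/cvgrPdist_le => e e0; have [n nP] := pow2_gt e^-1.
exists n => // k /= nk; rewrite sub0r normrN ger0_norm ?invr_ge0 ?exprn_ge0//.
rewrite invf_ple ?posrE ?exprn_gt0//.
by rewrite (le_trans (ltW nP))// ler_weXn2l// ler1n.
Qed.

Lemma geometric_increments (a : nat -> R) K :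
  (forall k, (K <= k)%N -> `|a k - a k.+1| <= (2 ^+ k)^-1) ->
  cvg (a n @[n --> \oo]) /\
  forall k, (K <= k)%N -> `|a k - lim (a n @[n --> \oo])| <= 2 / 2 ^+ k.
Proof.
move=> H; have p0 k : 0 < 2 ^+ k :> R by rewrite exprn_gt0.
have tail m k : (K <= k)%N -> `|a k - a (k + m)%N| <= 2 / 2 ^+ k - 2 / 2 ^+ (k + m).
  move=> Kk; elim: m => [|m IH]; first by rewrite addn0 !subrr normr0.
  rewrite addnS; have := H (k + m)%N (leq_trans Kk (leq_addr _ _)).
  have := ler_distD (a (k + m)%N) (a k) (a (k + m).+1).
  have -> : 2 / 2 ^+ (k + m).+1 = (2 ^+ (k + m))^-1 :> R.
    by rewrite exprS invfM mulrA divff ?mul1r.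
  by move: IH; move: (2 ^+ (k + m))^-1 => r; lra.
have tail' k l : (K <= k)%N -> (k <= l)%N -> `|a k - a l| <= 2 / 2 ^+ k.
  move=> Kk kl; rewrite -(subnKC kl) (le_trans (tail _ _ Kk))// gerBl.
  by rewrite divr_ge0// ltW.
have ca : cvg (a n @[n --> \oo]).
  apply/cauchy_cvgP/cauchy_exP => e e0.
  have [n nP] := pow2_gt (2 / e); exists (a (K + n)%N).
  exists (K + n)%N => // l /= nl; apply: (le_lt_trans (tail' _ _ (leq_addr _ _) nl)).
  rewrite ltr_pdivrMr// mulrC -ltr_pdivrMr// (lt_le_trans nP)//.
  by rewrite ler_weXn2l ?ler1n// leq_addl.
split => // k Kk.
have cv : `|a k - a l| @[l --> \oo] --> `|a k - lim (a n @[n --> \oo])|.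
  by apply: cvg_norm; apply: cvgB => //; exact: cvg_cst.
rewrite -(cvg_lim _ cv)//; apply: limr_le; first by apply/cvg_ex; eexists; exact: cv.
by exists k => // l /= kl; exact: tail'.
Qed.

(** The elementary form of the weak compactness of bounded sets of a Hilbert
    space: points of almost minimal norm in the convex hulls of the tails form
    a Cauchy sequence, by the parallelogram identity. Countably many seminorms
    [q j] are handled at once by minimising weighted partial sums of them. *)
Lemma midpoint_cauchy (E : Type) (mid : E -> E -> E) (S : nat -> E -> Prop)
    (q : nat -> E -> R) (dist : nat -> E -> E -> R) (B : nat -> R) :
  (forall k l e, (k <= l)%N -> S l e -> S k e) ->
  (forall k e f, S k e -> S k f -> S k (mid e f)) ->
  (forall k, exists2 e, S k e & forall j, q j e <= B j) ->
  (forall j e, S 0%N e -> 0 <= q j e) ->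
  (forall j e f, S 0%N e -> S 0%N f -> 0 <= dist j e f) ->
  (forall j e f, S 0%N e -> S 0%N f ->
     dist j e f = 2 * q j e + 2 * q j f - 4 * q j (mid e f)) ->
  exists g : nat -> E, (forall k, S k (g k)) /\
    forall j k l, (j <= k)%N -> (k <= l)%N -> dist j (g k) (g l) <= (8 ^+ k)^-1.
Proof.
move=> Sle Smid SB q0 dist0 para.
have S0 k e : S k e -> S 0%N e by exact: Sle.
pose wt j : R := (1 + `|B j|) * 2 ^+ j.
have wt0 j : 0 < wt j by rewrite mulr_gt0 ?exprn_gt0// ltr_wpDr.
pose Q k e := \sum_(j < k.+1) q j e / wt j.
have Q0 k e : S 0%N e -> 0 <= Q k e.
  by move=> Se; apply: sumr_ge0 => j _; rewrite divr_ge0 ?q0// ltW.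
have Qle k l e : (k <= l)%N -> S 0%N e -> Q k e <= Q l e.
  move=> kl Se; rewrite /Q -!(big_mkord xpredT (fun j => q j e / wt j)).
  rewrite [leRHS](@big_cat_nat _ _ _ k.+1)//= lerDl; apply: sumr_ge0 => j _.
  by apply: divr_ge0; [exact: q0|exact: ltW].
have QB k : exists2 e, S k e & forall l, Q l e <= 2.
  have [e Se eB] := SB k; exists e => // l.
  have : Q l e <= \sum_(j < l.+1) (2 ^+ j)^-1.
    apply: ler_sum => j _; rewrite /wt invfM mulrA ler_piMl ?invr_ge0 ?exprn_ge0//.
    rewrite ler_pdivrMr ?mul1r ?ltr_wpDr// (le_trans (eB j))//.
    by rewrite (le_trans (ler_norm _))// lerDr.
  move=> /le_trans; apply.
  suff -> : \sum_(j < l.+1) (2 ^+ j)^-1 = 2 - (2 ^+ l)^-1 :> R.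
    by rewrite gerBl invr_ge0 exprn_ge0.
  elim: l => [|l IH]; first by rewrite big_ord1 expr0 invr1; lra.
  rewrite big_ord_recr/= IH exprS invfM.
  by move: (2 ^+ l)^-1 => r; lra.
pose V k := [set Q k e | e in S k].
have V0 k : has_inf (V k).
  have [e Se _] := QB k; split; first by exists (Q k e); exists e.
  by exists 0 => _ [f Sf <-]; apply: Q0; exact: S0 Sf.
pose m k := inf (V k).
have mle k e : S k e -> m k <= Q k e.
  by move=> Se; apply: ge_inf; [case: (V0 k)|exists e].
have m_nd k l : (k <= l)%N -> m k <= m l.
  move=> kl; apply: lb_le_inf; first by case: (V0 l).
  move=> _ [e Se <-]; apply: le_trans (mle k e (Sle _ _ _ kl Se)) _.
  by apply: Qle => //; exact: S0 Se.
have msup : has_sup (range m).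
  split; first by exists (m 0%N); exists 0%N.
  exists 2 => _ [k _ <-]; have [e Se Q2] := QB k.
  exact: le_trans (mle _ _ Se) (Q2 k).
have /choice[f fP] : forall k, exists e, S k e /\ Q k e < m k + (2 ^+ k)^-1.
  move=> k; have e0 : 0 < (2 ^+ k)^-1 :> R by rewrite invr_gt0 exprn_gt0.
  by have [_ [e Se <-] Qe] := inf_adherent e0 (V0 k); exists e.
have close (eps : R) : 0 < eps -> exists K, forall k l, (K <= k)%N -> (k <= l)%N ->
    forall j, (j <= k)%N -> dist j (f k) (f l) <= wt j * eps.
  move=> eps0; have e8 : 0 < eps / 8 by rewrite divr_gt0.
  have [_ [K1 _ <-] K1P] := sup_adherent e8 msup.
  have [K2 K2P] := pow2_gt (8 / eps).
  exists (K1 + K2)%N => k l Kk kl j jk.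
  have [Sk Qk] := fP k; have [Sl Ql] := fP l; have Slk := Sle _ _ _ kl Sl.
  have small i : (k <= i)%N -> (2 ^+ i)^-1 <= eps / 8.
    move=> ki; rewrite -[leRHS]invf_div lef_pV2 ?posrE ?exprn_gt0 ?divr_gt0//.
    rewrite (le_trans (ltW K2P))// ler_weXn2l ?ler1n//.
    by rewrite (leq_trans _ ki)// (leq_trans _ Kk)// leq_addl.
  have mk : m l <= m k + eps / 8.
    have : m l <= sup (range m) by apply: sup_upper_bound => //; exists l.
    have : m K1 <= m k by apply: m_nd; rewrite (leq_trans _ Kk)// leq_addr.
    by lra.
  have sum_dist : \sum_(i < k.+1) dist i (f k) (f l) / wt i <= eps.
    have -> : \sum_(i < k.+1) dist i (f k) (f l) / wt i =
        2 * Q k (f k) + 2 * Q k (f l) - 4 * Q k (mid (f k) (f l)).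
      rewrite /Q !mulr_sumr -big_split/= -sumrB; apply: eq_bigr => i _.
      by rewrite (para i _ _ (S0 _ _ Sk) (S0 _ _ Sl)); ring.
    have := mle k _ (Smid _ _ _ Sk Slk).
    have := Qle k l _ kl (S0 _ _ Sl).
    by have := small k (leqnn k); have := small l kl; lra.
  have jk' : (j < k.+1)%N by [].
  have : dist j (f k) (f l) / wt j <= \sum_(i < k.+1) dist i (f k) (f l) / wt i.
    rewrite (bigD1 (Ordinal jk'))//= lerDl; apply: sumr_ge0 => i _.
    by rewrite divr_ge0 ?(ltW (wt0 _))//; exact: dist0 (S0 _ _ Sk) (S0 _ _ Sl).
  move=> /le_trans/(_ sum_dist); rewrite ler_pdivrMr// mulrC => /le_trans; exact.
pose c k : R := \sum_(j < k.+1) wt j.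
have c0 k : 0 < c k.
  by rewrite /c big_ord_recr/= ltr_wpDl// sumr_ge0// => j _; exact: ltW.
have /choice[K KP] : forall k, exists K, forall a b, (K <= a)%N -> (a <= b)%N ->
    forall j, (j <= k)%N -> (j <= a)%N -> dist j (f a) (f b) <= (8 ^+ k)^-1.
  move=> k; have e0 : 0 < (8 ^+ k)^-1 / c k by rewrite divr_gt0// invr_gt0 exprn_gt0.
  have [K KP] := close _ e0; exists K => a b Ka ab j jk ja.
  apply: le_trans (KP a b Ka ab j ja) _.
  rewrite mulrA ler_pdivrMr// mulrC ler_wpM2l ?invr_ge0 ?exprn_ge0//.
  have jk' : (j < k.+1)%N by [].
  rewrite /c (bigD1 (Ordinal jk'))//= lerDl; apply: sumr_ge0 => i _; exact: ltW.
pose kappa k := (k + \sum_(i < k.+1) K i)%N.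
have kappa_k k : (k <= kappa k)%N by exact: leq_addr.
have kappa_K k : (K k <= kappa k)%N.
  by rewrite /kappa big_ord_recr/= addnA leq_addl.
have kappa_le k l : (k <= l)%N -> (kappa k <= kappa l)%N.
  move=> kl; apply: leq_add => //.
  rewrite -!(big_mkord xpredT K) [leqRHS](@big_cat_nat _ _ _ k.+1)//=.
  exact: leq_addr.
exists (f \o kappa); split=> [k|j k l jk kl] /=.
  exact: Sle (kappa_k k) (fP _).1.
apply: (KP k) => //; first exact: kappa_le.
exact: leq_trans jk (kappa_k k).
Qed.

Lemma borel_cantelli_geometric {d : measure_display} {T : measurableType d}
    (P : probability T R) (A : nat -> set T) :
  (forall n, measurable (A n)) -> (forall n, (P (A n) <= ((2 ^+ n)^-1)%:E)%E) ->
  {ae P, forall w, exists n, forall k, (n <= k)%N -> ~ A k w}.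
Proof.
move=> mA PA; exists (lim_sup_set A); split.
- apply: bigcapT_measurable => n; apply: bigcup_measurable => k _; exact: mA.
- apply: lim_sup_set_cvg0 => //.
  apply: (@le_lt_trans _ _ (\sum_(0 <= n <oo) (0 + (2 / (2 ^ n.+1)%:R)%:E))%E).
    apply: lee_nneseries => // n _; rewrite add0e (le_trans (PA n))// lee_fin.
    by rewrite natrX exprS invfM mulrA divff ?mul1r.
  apply: le_lt_trans (@epsilon_trick R (fun=> 0%E) 2 xpredT _ _) _ => //.
  by rewrite eseries0// add0e ltry.
move=> w /= nE n _; apply: contrapT => nB; apply: nE; exists n => k nk Ak.
by apply: nB; exists k.
Qed.

End convergence.

(** * Tanaka sums of a process against a martingale *)

Section tanaka_martingale.
Context {d : measure_display} {T : measurableType d} {R : realType}.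
Variables (P : probability T R) (F : R -> set (set T)).
Hypotheses (Ffilt : filtration F) (Fusual : usual_conditions P F).
Variables (X : R -> T -> R) (aX : adapted F X).
Implicit Types (M N : R -> T -> R).

Let F_sigma := filtration_sigma Ffilt.

Let F_measurable := filtration_measurable Ffilt.

Section fixed_mesh.
Variables (e h : R) (h0 : 0 <= h).

Let above i := [set w | e < X (i%:R * h) w].

Let time0 (i : nat) : 0 <= i%:R * h. Proof. exact: mulr_ge0. Qed.

Let timeS (i : nat) : i%:R * h <= i.+1%:R * h.
Proof. by rewrite ler_wpM2r// ler_nat. Qed.

Let F_above i : F (i%:R * h) (above i).
Proof. by apply: measurable_wrt_gt; apply: aX; exact: time0. Qed.

Let tanaka_sumE M K t w : tanaka_sum (X ^~ w) (M ^~ w) e h K t =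
  \sum_(i < K) \1_(above i) w *
    (M (Num.min (i.+1%:R * h) t) w - M (Num.min (i%:R * h) t) w).
Proof. by apply: eq_bigr => i _; rewrite indic_bool. Qed.

Lemma adapted_tanaka_sum M K : adapted F M ->
  adapted F (fun t w => tanaka_sum (X ^~ w) (M ^~ w) e h K t).
Proof.
move=> aM t t0; rewrite (funext (tanaka_sumE M K t)).
apply: measurable_wrt_sum; first exact: F_sigma.
by move=> i; apply: (adapted_elementary_integral Ffilt aM (time0 i) (timeS i) (F_above i)).
Qed.

Lemma bounded_martingale_tanaka_sum N K : bounded_martingale P F N ->
  bounded_martingale P F (fun t w => tanaka_sum (X ^~ w) (N ^~ w) e h K t).
Proof.
move=> [mN [C NC]]; split.
  under eq_fun do rewrite (funext (tanaka_sumE N K _)).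
  apply: (martingale_sum Ffilt) => i.
  exact: (martingale_elementary_integral Ffilt mN (time0 i) (timeS i) (F_above i)).
exists (\sum_(i < K) (C + C)) => t w t0; rewrite tanaka_sumE.
apply: (le_trans (ler_norm_sum _ _ _)); apply: ler_sum => i _.
have C0 : 0 <= C by apply: le_trans (NC 0 w _).
have m0 (j : nat) : 0 <= Num.min (j%:R * h) t by rewrite le_min time0.
rewrite normrM indicE; case: (_ \in _); rewrite ?normr1 ?normr0 ?mul0r ?addr_ge0//.
by rewrite mul1r (le_trans (ler_normB _ _))// lerD// NC.
Qed.

(** Orthogonality of the increments: betting only on some of them decreases the
    second moment. *)
Lemma tanaka_sum_L2 N K t : bounded_martingale P F N -> 0 <= t ->
  \int[P]_w (tanaka_sum (X ^~ w) (N ^~ w) e h K t ^+ 2) <= \int[P]_w (N t w ^+ 2).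
Proof.
move=> bN t0; have m0 (j : nat) : 0 <= Num.min (j%:R * h) t by rewrite le_min time0.
apply: (@le_trans _ _ (\int[P]_w (N (Num.min (K%:R * h) t) w ^+ 2))); last first.
  by apply: (martingale_sqr_le Ffilt bN) => //; rewrite ge_min lexx orbT.
have bZ k u : 0 <= u ->
    bounded_measurable (fun w => tanaka_sum (X ^~ w) (N ^~ w) e h k u).
  move=> u0; exact: (bounded_martingale_measurable Ffilt
    (bounded_martingale_tanaka_sum k bN) u0).
elim: K => [|K IH].
  rewrite (@eq_Rintegral _ _ _ _ _ (fun=> 0)) ?mean_cst.
    by apply: Rintegral_ge0 => w _; exact: sqr_ge0.
  by move=> w _; rewrite /tanaka_sum big_ord0 expr0n.
set a := K%:R * h; set b := K.+1%:R * h.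
have ab : a <= b by exact: timeS.
have [ta|at_] := leP t a.
  rewrite (min_r (le_trans ta ab)); move: IH; rewrite -/a min_r//.
  by under [X in _ -> X <= _]eq_Rintegral do rewrite tanaka_sumS_before//.
set b' := Num.min b t; have ab' : a <= b' by rewrite le_min ab ltW.
have {}IH : \int[P]_w (tanaka_sum (X ^~ w) (N ^~ w) e h K a ^+ 2) <=
    \int[P]_w (N a w ^+ 2).
  move: IH; rewrite -/a min_l ?(ltW at_)//.
  by under eq_Rintegral do rewrite (tanaka_sum_horizon _ _ _ (ltW at_))//.
pose Z w := tanaka_sum (X ^~ w) (N ^~ w) e h K a.
pose D w := N b' w - N a w.
have a0 : 0 <= a by exact: time0.
have b'0 : 0 <= b' by exact: m0.
have ZE w : tanaka_sum (X ^~ w) (N ^~ w) e h K.+1 t = Z w + \1_(above K) w * D w.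
  rewrite tanaka_sumE big_ord_recr/= -tanaka_sumE -/a -/b -/b' (min_l (ltW at_)).
  by rewrite /Z (tanaka_sum_horizon _ _ _ (ltW at_)).
have bZa : bounded_measurable Z by exact: bZ.
have bD : bounded_measurable D.
  exact: (bounded_measurableB (bounded_martingale_measurable Ffilt bN b'0)
    (bounded_martingale_measurable Ffilt bN a0)).
have mB : measurable (above K) by exact: F_measurable (F_above K).
have bB := @bounded_measurable_indic _ _ R _ mB.
have orth : \int[P]_w (Z w * \1_(above K) w * D w) = 0.
  have [_ [C ZC]] := bounded_measurableM bZa bB.
  apply: (martingale_orthogonal Ffilt bN.1 a0 ab' _ ZC).
  apply: measurable_wrtM; first exact: F_sigma.
    by apply: (adapted_tanaka_sum K) => //; case: bN => -[].
  by apply: measurable_wrt_indic; [exact: F_sigma|exact: F_above].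
rewrite (@eq_Rintegral _ _ _ _ _ (fun w => Z w ^+ 2 + \1_(above K) w * D w ^+ 2 +
   2 * (Z w * \1_(above K) w * D w))); last first.
  move=> w _; rewrite ZE; have : \1_(above K) w ^+ 2 = \1_(above K) w :> R.
    by rewrite indicE; case: (_ \in _); rewrite ?expr1n ?expr0n.
  by move: (\1_(above K) w) => i ii; ring: ii.
have b1 := bounded_measurable_sqr bZa.
have b2 := bounded_measurableM bB (bounded_measurable_sqr bD).
have b3 := bounded_measurableM (bounded_measurableM bZa bB) bD.
rewrite meanD; last 2 first.
- by apply: finite_mean_bounded; exact: bounded_measurableD.
- by apply: finite_mean_bounded; exact: bounded_measurableZ.
rewrite meanZ ?orth ?mulr0 ?addr0; last exact: finite_mean_bounded.
rewrite meanD; try exact: finite_mean_bounded.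
have FT : F a [set: T].
  by rewrite -setC0; apply: (filtrationC Ffilt) => //; have [] := F_sigma a0.
have oneE (f : T -> R) : \int[P]_w f w = \int[P]_w (\1_[set: T] w * f w).
  by apply: eq_Rintegral => w _; rewrite indicE in_setT mul1r.
rewrite [leRHS]oneE (martingale_pythagoras Ffilt bN a0 ab' FT) -!oneE.
apply: lerD => //; apply: le_mean.
- exact: finite_mean_bounded.
- exact/finite_mean_bounded/bounded_measurable_sqr.
- by move=> w; rewrite ler_piMl ?sqr_ge0// indicE; case: (_ \in _).
Qed.

End fixed_mesh.

(** * Choice of the mesh *)

Hypothesis cX : forall w, continuous_path (X ^~ w).

(** On this event the mesh [2 ^- m] is too coarse for the level [2 ^- n], up
    to the horizon [n]. *)
Definition coarse (n m : nat) : set T := \bigcup_i \bigcup_j \bigcup_l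
  (if ((i%:R / 2 ^+ m : R) <= (j%:R / 2 ^+ l : R) <= i.+1%:R / 2 ^+ m) &&
      ((j%:R / 2 ^+ l : R) <= n%:R)
   then [set w | ((2 ^+ n)^-1 : R) < `|X (j%:R / 2 ^+ l) w - X (i%:R / 2 ^+ m) w|]
   else set0).

Let dyadic0 (i m : nat) : 0 <= i%:R / 2 ^+ m :> R.
Proof. by rewrite divr_ge0// exprn_ge0. Qed.

Lemma measurable_coarse n m : measurable (coarse n m).
Proof.
apply: bigcupT_measurable => i; apply: bigcupT_measurable => j.
apply: bigcupT_measurable => l; case: ifP => // _.
have mX (k p : nat) : measurable_fun [set: T] (X (k%:R / 2 ^+ p)).
  exact: (measurable_of_wrt Ffilt (dyadic0 k p) (aX (dyadic0 k p))).
rewrite (_ : [set w | _] = (fun w => `|X (j%:R / 2 ^+ l) w - X (i%:R / 2 ^+ m) w|)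
    @^-1` `](2 ^+ n)^-1, +oo[%classic); last first.
  by apply/seteqP; split=> w /=; rewrite in_itv/= andbT.
rewrite -[X in measurable X]setTI.
have mf : measurable_fun [set: T]
    (fun w => `|X (j%:R / 2 ^+ l) w - X (i%:R / 2 ^+ m) w|).
  by apply: measurableT_comp => //; apply: measurable_funB; exact: mX.
by apply: mf => //; exact: measurable_itv.
Qed.

Lemma small_oscillation_not_coarse n m w : ~ coarse n m w ->
  small_oscillation (X ^~ w) (2 ^+ n)^-1 (2 ^+ m)^-1 (n * 2 ^ m).
Proof.
move=> nc i im u iu.
have ii : i%:R / 2 ^+ m < i.+1%:R / 2 ^+ m :> R.
  by rewrite ltr_pM2r ?invr_gt0 ?exprn_gt0// ltr_nat.
have iN : i.+1%:R / 2 ^+ m <= n%:R :> R.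
  by rewrite ler_pdivrMr ?exprn_gt0// -natrX -natrM ler_nat.
have cXi : continuous_path (fun u => `|X u w - X (i%:R / 2 ^+ m) w|).
  apply: continuous_path_abs; apply: continuous_pathB; first exact: cX.
  exact: continuous_path_cst.
apply: (le_on_dyadics cXi (dyadic0 i m) ii _ iu) => j l /andP[ij ji].
rewrite leNgt; apply/negP => lt_X; apply: nc.
exists i => //; exists j => //; exists l => //.
by rewrite (ltW ij) (ltW ji) (le_trans (ltW ji)).
Qed.

(** Each path is uniformly continuous up to the horizon, so that [coarse n m]
    fails eventually in [m]; dominated convergence makes its probability small. *)
Lemma exists_mesh n : exists m, (P (coarse n m) <= ((2 ^+ n)^-1)%:E)%E.
Proof.
have e0 : 0 < (2 ^+ n)^-1 :> R by rewrite invr_gt0 exprn_gt0.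
have cv : \int[P]_w \1_(coarse n m) w @[m --> \oo] --> \int[P]_w (0 : R).
  apply: (mean_dominated_cvg (g := fun=> 1)).
  - by move=> m; apply: measurable_indic; exact: measurable_coarse.
  - exact: measurable_cst.
  - apply: aeW => w; have [m0 _ H] := small_oscillation_pow2 n%:R (@cX w) e0.
    apply: cvg_near_cst; exists m0 => // m /= mm.
    rewrite indicE memNset// => -[i _ [j _ [l _]]].
    case: ifP => // /andP[iji jn] /= lt_X.
    by have := H m mm i _ iji jn; rewrite leNgt lt_X.
  - exact/finite_mean_bounded/bounded_measurable_cst.
  - by move=> m w; rewrite indicE; case: (_ \in _); rewrite ?normr1 ?normr0.
move: cv; rewrite mean_cst => /cvgrPdist_le/(_ _ e0)[m _ /(_ m (leqnn m))].
rewrite /= sub0r normrN => le_e; exists m.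
rewrite mean_indic ?lee_fin; last exact: measurable_coarse.
exact: le_trans (ler_norm _) le_e.
Qed.

End tanaka_martingale.

(** * The martingale part of the positive part *)

(** Iterated midpoints of the terms of [Z] from rank [k] on: enough of the
    convex hull of the tail, and every property preserved by midpoints is
    inherited by induction. *)
Inductive tail_hull {R : realType} {T : Type} (Z : nat -> R -> T -> R) (k : nat) :
    (R -> T -> R) -> Prop :=
| tail_hull_term n : (k <= n)%N -> tail_hull Z k (Z n)
| tail_hull_mid Y Y' : tail_hull Z k Y -> tail_hull Z k Y' ->
    tail_hull Z k (fun t w => (Y t w + Y' t w) / 2).

Lemma tail_hull_le {R : realType} {T : Type} (Z : nat -> R -> T -> R) k l Y :
  (k <= l)%N -> tail_hull Z l Y -> tail_hull Z k Y.
Proof.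
move=> kl; elim=> [n ln|Y1 Y2 _ H1 _ H2]; last exact: tail_hull_mid.
by apply: tail_hull_term; exact: leq_trans ln.
Qed.

(** What midpoints of Tanaka sums of level at least [k] retain: the difference
    [a] between [x^+] and the sum increases, only on the zeros of [x], with an
    error that vanishes as [k] grows. *)
Definition almost_compensator {R : realType} (k : nat) (x a : R -> R) : Prop :=
  forall s t, 0 <= s -> s <= t -> t <= k%:R ->
  [/\ a s <= a t + 2 / 2 ^+ k,
      (forall u, s <= u <= t -> 2 / 2 ^+ k < x u) -> a s = a t &
      (forall u, s <= u <= t -> x u < - (2 ^+ k)^-1) -> a s = a t].

Section positive_part.
Context {d : measure_display} {T : measurableType d} {R : realType}.
Variables (P : probability T R) (F : R -> set (set T)).
Hypotheses (Ffilt : filtration F) (Fusual : usual_conditions P F).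
Variables (X M : R -> T -> R) (theta : nat -> T -> R).
Hypotheses (aX : adapted F X) (cX : forall w, continuous_path (X ^~ w)).
Hypotheses (aM : adapted F M) (cM : forall w, continuous_path (M ^~ w)).
(* this follows from [X = M + V] as well as from [|X| = M + V], if [V] is flat
   off the zeros of [X] *)
Hypothesis follows : forall w s t, 0 <= s -> s <= t ->
  (forall u, s <= u <= t -> 0 < X u w) -> M t w - M s w = X t w - X s w.
Hypothesis theta_ge0 : forall n w, 0 <= theta n w.
Hypothesis theta_le : forall n w, theta n w <= n%:R.
Hypothesis theta_unbounded : forall w (c : R),
  exists n, forall k, (n <= k)%N -> c <= theta k w.
Hypothesis bM : forall n,
  bounded_martingale P F (fun t w => M (Num.min t (theta n w)) w).

Variable mesh : nat -> nat.
Hypothesis meshP : forall n, (P (coarse X n (mesh n)) <= ((2 ^+ n)^-1)%:E)%E.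

Let Z n t w := tanaka_sum (X ^~ w) (M ^~ w) (2 ^+ n)^-1 (2 ^+ mesh n)^-1
  (n * 2 ^ mesh n) t.

Let step0 m : 0 <= (2 ^+ m)^-1 :> R.
Proof. by rewrite invr_ge0 exprn_ge0. Qed.

Let Z_stopped n j t w : Z n (Num.min t (theta j w)) w =
  tanaka_sum (X ^~ w) (fun u => M (Num.min u (theta j w)) w)
    (2 ^+ n)^-1 (2 ^+ mesh n)^-1 (n * 2 ^ mesh n) t.
Proof. by apply: eq_bigr => i _; rewrite !minA. Qed.

Let hull_adapted k Y : tail_hull Z k Y -> adapted F Y.
Proof.
elim=> [n _|Y1 Y2 _ H1 _ H2]; first exact: (adapted_tanaka_sum Ffilt aX _ (step0 _)).
move=> t t0; have [sF _ _] := Ffilt.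
under eq_fun do rewrite mulrC.
apply: (measurable_wrtZ (sF t t0)); apply: (measurable_wrtD (sF t t0)).
  exact: H1.
exact: H2.
Qed.

Let hull_martingale j k Y : tail_hull Z k Y ->
  bounded_martingale P F (fun t w => Y (Num.min t (theta j w)) w).
Proof.
elim=> [n _|Y1 Y2 _ H1 _ H2].
  under eq_fun do under eq_fun do rewrite Z_stopped.
  exact: (bounded_martingale_tanaka_sum Ffilt aX _ (step0 _)).
under eq_fun do under eq_fun do rewrite mulrC.
exact: (bounded_martingaleZ Ffilt _ (bounded_martingaleD Ffilt H1 H2)).
Qed.

Let hull_path k Y : tail_hull Z k Y -> forall w, continuous_path (Y ^~ w) /\ Y 0 w = 0.
Proof.
elim=> [n _|Y1 Y2 _ H1 _ H2] w; last first.
  have [c1 e1] := H1 w; have [c2 e2] := H2 w; split; last by rewrite e1 e2; lra.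
  by under eq_fun do rewrite mulrC; exact/continuous_pathZ/continuous_pathD.
split; last first.
  by apply: big1 => i _; rewrite !min_r ?subrr ?mulr0// mulr_ge0// step0.
apply: continuous_path_sum => i; apply: continuous_pathZ.
by apply: continuous_pathB; apply: (@continuous_path_stop_l _ (M ^~ w)) => //;
  rewrite mulr_ge0// step0.
Qed.

Let hull_compensator k Y : tail_hull Z k Y -> forall w,
  (forall n, (k <= n)%N -> ~ coarse X n (mesh n) w) ->
  almost_compensator k (X ^~ w) (fun t => Num.max (X t w) 0 - Y t w).
Proof.
elim=> [n kn|Y1 Y2 _ H1 _ H2] w nc s t s0 st tk; last first.
  have [m1 p1 n1] := H1 w nc s t s0 st tk; have [m2 p2 n2] := H2 w nc s t s0 st tk.
  split=> [|xp|xn]; first by lra.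
    by have := p1 xp; have := p2 xp; lra.
  by have := n1 xn; have := n2 xn; lra.
have osc := small_oscillation_not_coarse cX (nc n kn).
have tK : t <= (n * 2 ^ mesh n)%:R * (2 ^+ mesh n)^-1.
  rewrite natrM natrX mulfK ?gt_eqF ?exprn_gt0//.
  by rewrite (le_trans tk)// ler_nat.
have nk : (2 ^+ n)^-1 <= (2 ^+ k)^-1 :> R.
  by rewrite lef_pV2 ?posrE ?exprn_gt0// ler_weXn2l// ler1n.
have fw := @follows w.
have e0 := step0 n; have h0 := step0 (mesh n).
split=> [|xp|xn].
- apply: (le_trans (tanaka_sum_almost_nondecreasing h0 e0 fw osc s0 st tK)).
  by rewrite lerD2l ler_wpM2l.
- apply: (tanaka_sum_flat_pos h0 e0 fw osc s0 st tK) => u /xp; apply: le_lt_trans.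
  by rewrite ler_wpM2l.
- apply: (tanaka_sum_flat_neg _ h0 e0 osc s0 st tK) => u /xn /lt_le_trans; apply.
  by rewrite lerN2.
Qed.

Let at_theta j (Y : R -> T -> R) w := Y (Num.min j%:R (theta j w)) w.

Let q j Y := \int[P]_w (at_theta j Y w ^+ 2).

Let dist j Y Y' := \int[P]_w ((at_theta j Y w - at_theta j Y' w) ^+ 2).

Let hull_bounded j k Y : tail_hull Z k Y -> bounded_measurable (at_theta j Y).
Proof.
by move=> /(hull_martingale j) bY; exact: (bounded_martingale_measurable Ffilt bY).
Qed.

(* the second moments of the Tanaka sums are bounded by those of [M], whatever
   the mesh, which is all that minimisation over midpoints requires *)
Let Z_cauchy : exists g : nat -> R -> T -> R, (forall k, tail_hull Z k (g k)) /\
  forall j k l, (j <= k)%N -> (k <= l)%N -> dist j (g k) (g l) <= (8 ^+ k)^-1.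
Proof.
apply: (@midpoint_cauchy _ _ (fun Y Y' t w => (Y t w + Y' t w) / 2)
  (fun k Y => tail_hull Z k Y) q dist (fun j => \int[P]_w (at_theta j M w ^+ 2))).
- by move=> k l Y; exact: tail_hull_le.
- by move=> k Y Y'; exact: tail_hull_mid.
- move=> k; exists (Z k); first exact: tail_hull_term.
  move=> j; rewrite /q /at_theta.
  under eq_Rintegral do rewrite Z_stopped.
  exact: (tanaka_sum_L2 Ffilt aX _ (step0 _) _ (bM j)).
- by move=> j Y _; apply: Rintegral_ge0 => w _; exact: sqr_ge0.
- by move=> j Y Y' _ _; apply: Rintegral_ge0 => w _; exact: sqr_ge0.
move=> j Y Y' /(hull_bounded j) bY /(hull_bounded j) bY'.
have bmid : bounded_measurable (at_theta j (fun t w => (Y t w + Y' t w) / 2)).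
  rewrite /at_theta; under eq_fun do rewrite mulrC.
  exact/bounded_measurableZ/bounded_measurableD.
have s1 := finite_mean_bounded P (bounded_measurable_sqr bY).
have s2 := finite_mean_bounded P (bounded_measurable_sqr bY').
have s3 := finite_mean_bounded P (bounded_measurable_sqr bmid).
rewrite /q /dist -!meanZ// -meanD; [|exact: finite_meanZ|exact: finite_meanZ].
rewrite -meanB; [|by apply: finite_meanD; exact: finite_meanZ|exact: finite_meanZ].
by apply: eq_Rintegral => w _; rewrite /at_theta; field.
Qed.

(** Tanaka's formula for [X^+], although a martingale only drives the positive
    excursions of [X]: a locally uniform limit [N] of midpoints of Tanaka sums is
    a martingale along [theta], and [X^+ - N] inherits from the discrete local
    times that it increases, and only does so on the zeros of [X]. *)
Theorem positive_part_decomposition : exists N,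
  [/\ adapted F N,
      forall n, martingale P F (fun t w => N (Num.min t (theta n w)) w) &
      {ae P, forall w, [/\ continuous_path (N ^~ w), N 0 w = 0,
        forall s t, 0 <= s -> s <= t ->
          Num.max (X s w) 0 - N s w <= Num.max (X t w) 0 - N t w &
        flat_off_zeros (X ^~ w) (fun t => Num.max (X t w) 0 - N t w)]}].
Proof.
have [g [hg gdist]] := Z_cauchy.
pose incr k t w := g k.+1 (Num.min t (theta k.+1 w)) w -
  g k.+2 (Num.min t (theta k.+1 w)) w.
have p0 k : 0 < 2 ^+ k :> R by rewrite exprn_gt0.
(* Doob's inequality turns 8 ^- k for the second moment of an increment of the
   sequence into 2 ^- k for the probability that it exceeds 2 ^- k *)
have gap k : exists B, [/\ measurable B,
    forall w, ~ B w -> forall t, 0 <= t <= k.+1%:R -> `|incr k t w| <= (2 ^+ k.+1)^-1 &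
    (P B <= ((2 ^+ k)^-1)%:E)%E].
  have bi : bounded_martingale P F (incr k).
    by apply: (bounded_martingaleB Ffilt); exact: hull_martingale (hg _).
  have ci w : continuous_path (incr k ^~ w).
    have cs i := @continuous_path_stop _ (g i ^~ w) _ (theta_ge0 k.+1 w)
      (hull_path (hg i) w).1.
    exact: continuous_pathB (cs k.+1) (cs k.+2).
  have l0 : 0 < (2 ^+ k.+1)^-1 :> R by rewrite invr_gt0.
  have [B mB [PB1 PB2]] := doob_maximal Ffilt bi l0 (erefl k.+1%:R) (ltn0Sn k) ci.
  exists B; split => //; apply: (le_trans PB2); rewrite lee_fin.
  have := gdist k.+1 k.+1 k.+2 (leqnn _) (leqnSn _); rewrite -/(at_theta _ _).
  rewrite /dist /at_theta -/(incr k _ _) => le8.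
  rewrite ler_pdivrMr ?exprn_gt0// (le_trans le8)//.
  have -> : 8 = 2 ^+ 3 :> R by rewrite -natrX.
  rewrite -exprM exprVn -exprM -invfM -exprD lef_pV2 ?posrE //.
  by rewrite ler_weXn2l ?ler1n// (mulSn 2) [(2 * _)%N]mulnC leq_add2r leqnSn.
have /choice[A AP] := gap.
have goodA : {ae P, forall w, exists n, forall k, (n <= k)%N -> ~ A k w}.
  by apply: borel_cantelli_geometric => k; case: (AP k).
have goodX : {ae P, forall w, exists n, forall k, (n <= k)%N -> ~ coarse X k (mesh k) w}.
  by apply: borel_cantelli_geometric => // k; exact: (measurable_coarse Ffilt aX).
pose good w := exists n, forall k, (n <= k)%N -> ~ A k w /\ ~ coarse X k (mesh k) w.
have aegood : {ae P, forall w, good w}.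
  apply: filterS2 goodA goodX => w [n1 n1P] [n2 n2P]; exists (maxn n1 n2) => k.
  by rewrite geq_max => /andP[/n1P ? /n2P ?].
pose N t w : R := lim (g k t w @[k --> \oo]).
have cvN w t : good w -> 0 <= t -> exists K, forall u, 0 <= u <= t ->
    (g k u w @[k --> \oo] --> N u w) /\
    forall k, (K <= k)%N -> `|g k u w - N u w| <= 2 / 2 ^+ k.
  move=> [n nP] t0; have [m mP] := theta_unbounded w t.
  exists (maxn n.+1 m) => u /andP[u0 ut]; apply: geometric_increments => -[|k].
    by rewrite geq_max.
  rewrite geq_max ltnS => /andP[nk mk]; have tk := mP _ mk.
  have [_ AP2 _] := AP k; have [nA _] := nP k nk.
  have := AP2 w nA u; rewrite /incr (min_l (le_trans ut tk)) u0/=; apply.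
  by rewrite (le_trans ut)// (le_trans tk).
have aN : adapted F N.
  apply: (adapted_ae_limit Ffilt Fusual (fun k => hull_adapted (hg k))) => t t0.
  apply: filterS aegood => w gw; have [K KP] := cvN w t gw t0.
  by have [] := KP t; rewrite ?t0 ?lexx.
exists N; split => //.
  move=> j; have min0 t w : 0 <= t -> 0 <= Num.min t (theta j w).
    by move=> t0; rewrite le_min t0 theta_ge0.
  apply: (martingale_limit Ffilt Fusual (r := fun k => (2 ^+ k)^-1)
     (Y_ := fun k t w => g (k + j)%N (Num.min t (theta j w)) w)).
  - by move=> k; case: (hull_martingale j (hg (k + j)%N)).
  - move=> t t0; apply: filterS aegood => w gw.
    have [K KP] := cvN w _ gw (min0 t w t0).
    have [] := KP (Num.min t (theta j w)); first by rewrite min0 ?lexx.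
    by rewrite (cvg_shiftn j (fun k => g k (Num.min t (theta j w)) w)).
  - move=> t k l t0 kl.
    have kl' : (k + j <= l + j)%N by rewrite leq_add2r.
    have bD := bounded_martingaleB Ffilt (hull_martingale j (hg (k + j)%N))
      (hull_martingale j (hg (l + j)%N)).
    set D : R -> T -> R := fun t w => _ in bD.
    have D2 : \int[P]_w (D t w ^+ 2) <= (8 ^+ (k + j))^-1.
      have := gdist j _ _ (leq_addl k j) kl'; apply: le_trans.
      have [tj|jt] := leP t j%:R; first exact: (martingale_sqr_le Ffilt bD).
      rewrite le_eqVlt; apply/orP; left; apply/eqP; apply: eq_Rintegral => w _.
      rewrite /D /at_theta.
      by rewrite !(min_r (theta_le j w)) !(min_r (le_trans (theta_le j w) (ltW jt))).
    have bDt := bounded_martingale_measurable Ffilt bD t0.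
    have c0 : 0 < 2 ^+ (k + j) :> R by [].
    (* |D| <= (c D^2 + 1 / c) / 2 with c = 2 ^ (k + j) turns the bound
       8 ^- (k + j) on the second moment into one on the first moment *)
    apply: (@le_trans _ _ (\int[P]_w (2 ^+ (k + j) / 2 * D t w ^+ 2 +
        (2 ^+ (k + j))^-1 / 2))).
      apply: le_mean.
      + exact/finite_mean_abs/finite_mean_bounded.
      + apply: finite_mean_bounded; apply: bounded_measurableD.
          exact/bounded_measurableZ/bounded_measurable_sqr.
        exact: bounded_measurable_cst.
      + move=> w; rewrite -/(D t w); set c := 2 ^+ (k + j) in c0 *.
        rewrite -subr_ge0 (_ : _ - _ = c / 2 * (`|D t w| - c^-1) ^+ 2).
          by rewrite mulr_ge0 ?sqr_ge0// divr_ge0// ltW.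
        by rewrite -(real_normK (num_real (D t w))); field; rewrite gt_eqF.
    rewrite meanD; last 2 first.
    + exact/finite_mean_bounded/bounded_measurableZ/bounded_measurable_sqr.
    + exact/finite_mean_bounded/bounded_measurable_cst.
    rewrite mean_cst meanZ; last exact/finite_mean_bounded/bounded_measurable_sqr.
    have le4 : 2 ^+ (k + j) * (8 ^+ (k + j))^-1 <= (2 ^+ (k + j))^-1 :> R.
      have -> : 8 = 2 ^+ 3 :> R by rewrite -natrX.
      rewrite -exprM ler_pdivrMr ?exprn_gt0// mulrC ler_pdivlMr// -exprD.
      by rewrite ler_weXn2l ?ler1n// (mulSn 2) leq_add2l leq_pmull.
    have lek : (2 ^+ (k + j))^-1 <= (2 ^+ k)^-1 :> R.
      by rewrite lef_pV2 ?posrE// ler_weXn2l ?ler1n// leq_addr.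
    apply: le_trans lek; move: D2; rewrite -(ler_pM2l c0) => /le_trans/(_ le4).
    by move: (\int[P]_w _) (2 ^+ (k + j)) (2 ^- (k + j)) => a b c; lra.
  - exact: inv_pow2_cvg0.
apply: filterS aegood => w gw.
have cg k : continuous_path (g k ^~ w) by case: (hull_path (hg k) w).
have small_pow2 (e : R) : 0 < e -> exists K, forall k, (K <= k)%N -> 2 / 2 ^+ k < e.
  move=> e0; have [K KP] := pow2_gt (2 / e); exists K => k Kk.
  rewrite ltr_pdivrMr// mulrC -ltr_pdivrMr// (lt_le_trans KP)//.
  by rewrite ler_weXn2l// ler1n.
have cN : continuous_path (N ^~ w).
  apply: (continuous_path_uniform_limit cg) => t t0 e e0.
  have [K KP] := cvN w t gw t0; have [L LP] := small_pow2 e e0.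
  exists (maxn K L) => u ut; have [_ /(_ (maxn K L) (leq_maxl _ _))] := KP u ut.
  by move=> /le_trans; apply; apply/ltW/LP; exact: leq_maxr.
(* [X^+ - N] is approached by almost compensators of vanishing error *)
have approx t (e : R) : 0 <= t -> 0 < e -> exists k, [/\ t <= k%:R, 2 / 2 ^+ k < e,
    almost_compensator k (X ^~ w) (fun t => Num.max (X t w) 0 - g k t w) &
    forall u, 0 <= u <= t -> `|g k u w - N u w| <= e].
  move=> t0 e0; have [K KP] := cvN w t gw t0; have [L LP] := small_pow2 e e0.
  have [m mP] := pow2_gt t; have [n nP] := gw.
  exists (maxn (maxn K L) (maxn n (2 ^ m))); set k := maxn _ _.
  have : (k <= k)%N by [].
  rewrite {1}/k !geq_max => /andP[/andP[Kk Lk] /andP[nk mk]].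
  split.
  - by rewrite (le_trans (ltW mP))// -natrX ler_nat.
  - exact: LP.
  - apply: (hull_compensator (hg k)) => i ki.
    by case: (nP i (leq_trans nk ki)).
  - by move=> u ut; have [_ /(_ k Kk)/le_trans] := KP u ut; apply; exact/ltW/LP.
split => //.
- apply: cvg_lim => //; apply: cvg_near_cst; apply: nearW => k.
  by case: (hull_path (hg k) w).
- move=> s t s0 st; apply/ler_addgt0Pr => e e0.
  have e3 : 0 < e / 3 by rewrite divr_gt0.
  have [k [tk ek Hk gk]] := approx t _ (le_trans s0 st) e3.
  have [le_st _ _] := Hk s t s0 st tk.
  have := gk s; rewrite s0 st => /(_ isT); have := gk t.
  rewrite (le_trans s0 st) lexx => /(_ isT).
  by rewrite !ler_norml => /andP[? ?] /andP[? ?]; lra.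
move=> s t s0 st sgn; have t0 := le_trans s0 st.
(* by compactness, X keeps a distance c from 0 on [s, t] *)
have [c c0 cP] : exists2 c, 0 < c & (forall u, s <= u <= t -> c <= X u w) \/
    (forall u, s <= u <= t -> c <= - X u w).
  case: sgn => sgn.
    by have [c c0 cP] := positive_on_segment (@cX w) s0 st sgn; exists c => //; left.
  have cNX : continuous_path (fun u => - X u w).
    by have := @continuous_pathZ _ (-1) _ (@cX w); under eq_fun do rewrite mulN1r.
  have [|c c0 cP] := positive_on_segment cNX s0 st; last by exists c => //; right.
  by move=> u /sgn; rewrite oppr_gt0.
have close e : 0 < e ->
    `|(Num.max (X s w) 0 - N s w) - (Num.max (X t w) 0 - N t w)| <= e.
  move=> e0; have ec : 0 < Num.min c (e / 2) by rewrite lt_min c0 divr_gt0.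
  have [k [tk]] := approx t _ t0 ec; rewrite lt_min => /andP[kc ke] Hk gk.
  have [_ flatp flatn] := Hk s t s0 st tk.
  have eq_st : Num.max (X s w) 0 - g k s w = Num.max (X t w) 0 - g k t w.
    case: cP => cP; [apply: flatp => u /cP|apply: flatn => u /cP]; first lra.
    by have := step0 k; move: kc; move: (2 ^- k) => r; lra.
  have := gk s; rewrite s0 st => /(_ isT); have := gk t.
  rewrite t0 lexx => /(_ isT); rewrite !le_min => /andP[_ gt] /andP[_ gs].
  by move: gt gs; rewrite !ler_norml => /andP[? ?] /andP[? ?]; apply/andP; split; lra.
apply/eqP; rewrite -subr_eq0 -normr_le0; apply/ler_addgt0Pr => e e0.
by rewrite add0r close.
Qed.

End positive_part.

(** * Changing the sign of the negative excursions *)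

Section change_negative_part.
Context {d : measure_display} {T : measurableType d} {R : realType}.
Variables (P : probability T R) (F : R -> set (set T)).
Hypotheses (Ffilt : filtration F) (Fusual : usual_conditions P F).

(** [x^+ + c x^-]: the identity for [c = -1], the absolute value for [c = 1]. *)
Definition rescale_negative (c x : R) : R := Num.max x 0 + c * Num.max (- x) 0.

Lemma rescale_negativeN1 x : rescale_negative (-1) x = x.
Proof.
by rewrite /rescale_negative; case: (leP x 0); case: (leP (- x) 0); lra.
Qed.

Lemma rescale_negative1 x : rescale_negative 1 x = `|x|.
Proof.
rewrite /rescale_negative; have [x0|x0] := leP x 0.
  by rewrite max_l ?oppr_ge0// ler0_norm//; lra.
by rewrite max_r ?oppr_le0 1?ltW// gtr0_norm//; lra.
Qed.

Lemma rescale_negative_pos c x : 0 < x -> rescale_negative c x = x.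
Proof.
move=> x0; rewrite /rescale_negative max_l 1?ltW// max_r ?oppr_le0 1?ltW//.
by rewrite mulr0 addr0.
Qed.

Lemma rescale_negative_neg c x : x < 0 -> rescale_negative c x = c * - x.
Proof.
move=> x0; rewrite /rescale_negative max_r 1?ltW// max_l ?oppr_ge0 1?ltW//.
by rewrite add0r.
Qed.

Lemma rescale_negative_eq0 c x : c != 0 -> (rescale_negative c x != 0) = (x != 0).
Proof.
move=> c0; have [x0|x0|->] := ltrgtP x 0.
- by rewrite rescale_negative_neg// mulf_eq0 (negbTE c0) oppr_eq0 lt_eqF.
- by rewrite rescale_negative_pos// gt_eqF.
- by rewrite /rescale_negative oppr0 maxxx mulr0 addr0 eqxx.
Qed.

Lemma cadlag_continuous_path (f : R -> R) : continuous_path f -> cadlag_path f.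
Proof.
move=> /continuous_path_max0 cf; split=> t t0.
  have ft : f (Num.max 0 u) @[u --> t^'+] --> f t.
    by rewrite -{2}(max_r t0); apply: cvg_at_right_filter; exact: cf.
  apply: cvg_trans ft; apply: near_eq_cvg; near=> u.
  by rewrite max_r// (le_trans t0).
have ft : f (Num.max 0 u) @[u --> t^'-] --> f (Num.max 0 t).
  by apply: cvg_at_left_filter; exact: cf.
apply/cvg_ex; exists (f (Num.max 0 t)); apply: cvg_trans ft.
apply: near_eq_cvg; near=> u; rewrite max_r//; near: u.
by apply: nbhs_left_ge.
Unshelve. all: by end_near. Qed.

Lemma flat_off_zerosN (x v : R -> R) :
  flat_off_zeros (fun t => - x t) v -> flat_off_zeros x v.
Proof.
move=> H s t s0 st [xp|xn]; apply: H => //; [right|left] => u ust.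
  by rewrite oppr_lt0; exact: xp.
by rewrite oppr_gt0; exact: xn.
Qed.

Lemma flat_off_zerosZD (c : R) (x v v' : R -> R) :
  flat_off_zeros x v -> flat_off_zeros x v' ->
  flat_off_zeros x (fun t => v t + c * v' t).
Proof. by move=> H H' s t s0 st sgn; rewrite (H s t) ?(H' s t). Qed.

Lemma finite_variationZ_nondecreasing (c : R) (v : R -> R) :
  (forall s t, 0 <= s -> s <= t -> v s <= v t) ->
  finite_variation_path (fun t => c * v t).
Proof.
move=> ndv; have [c0|c0] := leP 0 c.
  by apply: nondecreasing_finite_variation => s t s0 st; rewrite ler_wpM2l ?ndv.
have -> : (fun t => c * v t) = (fun t => - (- c * v t)).
  by apply/funext => t; rewrite mulNr opprK.
apply: finite_variationN; apply: nondecreasing_finite_variation => s t s0 st.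
by rewrite ler_wpM2l ?ndv// oppr_ge0 ltW.
Qed.

Lemma local_martingale_of_stopped (N : R -> T -> R) (theta : nat -> T -> R) :
  adapted F N -> {ae P, forall w, N 0 w = 0} ->
  (forall n, real_stopping_time F (theta n)) ->
  (forall w, nondecreasing_seq (theta ^~ w) /\
     forall c : R, exists n, forall k, (n <= k)%N -> c <= theta k w) ->
  (forall n, martingale P F (fun t w => N (Num.min t (theta n w)) w)) ->
  local_martingale P F N.
Proof.
move=> aN N0 stop limit mN; split => //.
exists (fun n w => (theta n w)%:E); split.
- move=> n; have [th0 Fth] := stop n; split=> [w|t t0]; first by rewrite lee_fin.
  rewrite (_ : [set w | _] = [set w | theta n w <= t]); first exact: Fth.
  by apply/seteqP; split=> w /=; rewrite lee_fin.
- apply: aeW => w; have [nd unb] := limit w; split.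
    by move=> m n mn; rewrite lee_fin; exact: nd.
  by apply/cvgeyPge => c; have [n nP] := unb c; exists n => // k /nP; rewrite lee_fin.
move=> n; apply: (martingale_ae_eq Ffilt Fusual (mN n)) => t t0.
apply: filterS N0 => w N0w; rewrite /stopped -EFin_min/=.
have [th|th] := ltP 0 (theta n w).
  by rewrite indicE mem_set ?mul1r//= lte_fin.
have th0 : theta n w = 0 by apply/eqP; rewrite eq_le th (stop n).1.
by rewrite th0 min_r// N0w mulr0.
Qed.

(** Both directions of the theorem at once. Where [X] keeps its sign, [V] is
    flat, so that [M] follows [X] on positive excursions and [M / c0] follows
    [- X] on negative ones. The positive parts of [X] and of [- X] can then be
    decomposed against [M] and [M / c0] along the same stopping times, and these
    two decompositions combined with any coefficient. *)
Lemma class_Sigma_rescale_negative (X : R -> T -> R) (c0 c : R) :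
  c0 != 0 -> c != 0 -> adapted F X ->
  {ae P, forall w, continuous_path (X ^~ w)} -> {ae P, forall w, X 0 w = 0} ->
  class_Sigma P F (fun t w => rescale_negative c0 (X t w)) ->
  class_Sigma P F (fun t w => rescale_negative c (X t w)).
Proof.
move=> c00 c0' aX aecX aeX0 [M [V [aeMV [lM _] [aV aepV] aeint]]].
have zerosE a w : a != 0 -> [set u | rescale_negative a (X u w) != 0] =
    [set u | X u w != 0].
  by move=> a0; apply/seteqP; split=> u /=; rewrite rescale_negative_eq0.
have cR a (x : R -> R) : continuous_path x ->
    continuous_path (fun t => rescale_negative a (x t)).
  move=> cx; apply: continuous_pathD; first exact: continuous_path_pos.
  apply: continuous_pathZ; apply: continuous_path_pos.
  by have := @continuous_pathZ _ (-1) _ cx; under eq_fun do rewrite mulN1r.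
pose Good w := [/\ continuous_path (X ^~ w), X 0 w = 0, M 0 w = 0,
  continuous_path (M ^~ w) &
  (forall s t, 0 <= s -> s <= t ->
     (forall u, s <= u <= t -> 0 < X u w) \/ (forall u, s <= u <= t -> X u w < 0) ->
     M t w - M s w = rescale_negative c0 (X t w) - rescale_negative c0 (X s w))].
have aeGood : {ae P, forall w, Good w}.
  apply: filterS3 aeMV (filterI aepV aeint) (filterI aecX aeX0).
  move=> w MV [[V0 cV bV] int0] [cX X0].
  have ME t : 0 <= t -> M t w = rescale_negative c0 (X t w) - V t w.
    by move=> t0; rewrite MV// addrK.
  split => //.
  - by rewrite ME// V0 X0 /rescale_negative !(oppr0, maxxx, mulr0, addr0).
  - apply: (@eq_continuous_path _ (fun t => rescale_negative c0 (X t w) - V t w)).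
      by move=> t t0; rewrite ME.
    by apply: continuous_pathB => //; exact: cR.
  have flat : flat_off_zeros (X ^~ w) (V ^~ w).
    apply: flat_of_stieltjes_integral => // t t0.
    by rewrite -(zerosE c0)//; exact: int0.
  move=> s t s0 st sgn; rewrite !ME ?(le_trans s0)// (flat s t s0 st sgn).
  by ring.
have [G [theta [aeG GGood stop thetaP bM]]] := localize Ffilt Fusual lM aeGood
  (fun w h => let: And5 _ _ M0 cM _ := h in conj M0 cM).
pose X' t w : R := \1_G w * X t w; pose M' t w : R := \1_G w * M t w.
have in_G (Y : R -> T -> R) t w : G w -> \1_G w * Y t w = Y t w.
  by move=> Gw; rewrite indicE mem_set// mul1r.
have off_G (Y : R -> T -> R) t w : ~ G w -> \1_G w * Y t w = 0.
  by move=> Gw; rewrite indicE memNset// mul0r.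
have adapted_G (Y : R -> T -> R) : adapted F Y -> adapted F (fun t w => \1_G w * Y t w).
  move=> aY; apply: (adapted_ae_eq Ffilt Fusual aY) => t t0.
  by apply: filterS aeG => w Gw; rewrite in_G.
have path_G (Y : R -> T -> R) : (forall w, G w -> continuous_path (Y ^~ w)) ->
    forall w, continuous_path (fun t => \1_G w * Y t w).
  move=> cY w; have [Gw|Gw] := pselect (G w).
    by apply: eq_continuous_path (cY w Gw) => t _; rewrite in_G.
  by apply: eq_continuous_path (@continuous_path_cst R 0) => t _; rewrite off_G.
have aX' : adapted F X' by exact: adapted_G.
have aM' : adapted F M' by apply: adapted_G; case: lM.
have cX' w : continuous_path (X' ^~ w).
  by apply: path_G => {}w /GGood[].
have cM' w : continuous_path (M' ^~ w).
  by apply: path_G => {}w /GGood[].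
have follow w s t : 0 <= s -> s <= t ->
    (forall u, s <= u <= t -> 0 < X' u w) \/ (forall u, s <= u <= t -> X' u w < 0) ->
    M' t w - M' s w = rescale_negative c0 (X' t w) - rescale_negative c0 (X' s w).
  move=> s0 st sgn; have [Gw|Gw] := pselect (G w); last first.
    by case: sgn => /(_ s); rewrite lexx st /X' off_G// ltxx => /(_ isT).
  rewrite /M' /X' !in_G//; have [_ _ _ _ H] := GGood w Gw; apply: H => //.
  by case: sgn => sgn; [left|right] => u /sgn; rewrite /X' in_G.
pose oX' t w : R := - X' t w; pose sM' t w : R := c0^-1 * M' t w.
have aoX' : adapted F oX'.
  move=> t t0; have [sF _ _] := Ffilt; rewrite /oX'; under eq_fun do rewrite -mulN1r.
  by apply: (measurable_wrtZ (sF t t0)); exact: aX'.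
have coX' w : continuous_path (oX' ^~ w).
  have := @continuous_pathZ _ (-1) _ (@cX' w).
  by under eq_fun do rewrite mulN1r.
have asM' : adapted F sM'.
  by move=> t t0; have [sF _ _] := Ffilt; apply: (measurable_wrtZ (sF t t0)); exact: aM'.
have csM' w : continuous_path (sM' ^~ w) by exact: continuous_pathZ.
have th0 n w : 0 <= theta n w by case: (stop n).
have th_le n w : theta n w <= n%:R by case: (thetaP w).
have th_unb w : forall b : R, exists n, forall k, (n <= k)%N -> b <= theta k w.
  by case: (thetaP w).
have [mesh meshP] := choice (exists_mesh P Ffilt aX' cX').
have [omesh omeshP] := choice (exists_mesh P Ffilt aoX' coX').
have follow_pos w s t : 0 <= s -> s <= t ->
    (forall u, s <= u <= t -> 0 < X' u w) -> M' t w - M' s w = X' t w - X' s w.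
  move=> s0 st xp; rewrite (follow w s t s0 st (or_introl xp)).
  by rewrite !rescale_negative_pos//; apply: xp; rewrite lexx st.
have follow_neg w s t : 0 <= s -> s <= t ->
    (forall u, s <= u <= t -> 0 < oX' u w) -> sM' t w - sM' s w = oX' t w - oX' s w.
  move=> s0 st xp; have xn u : s <= u <= t -> X' u w < 0 by move=> /xp; rewrite oppr_gt0.
  rewrite /sM' -mulrBr (follow w s t s0 st (or_intror xn)).
  rewrite !rescale_negative_neg; [|by apply: xn; rewrite lexx st..].
  by rewrite -mulrBr mulKf.
have [N1 [aN1 mN1 pN1]] := positive_part_decomposition Ffilt Fusual aX' cX'
  aM' cM' follow_pos th0 th_le th_unb bM meshP.
have [N2 [aN2 mN2 pN2]] := positive_part_decomposition Ffilt Fusual aoX' coX'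
  asM' csM' follow_neg th0 th_le th_unb
  (fun n => bounded_martingaleZ Ffilt c0^-1 (bM n)) omeshP.
pose N t w := N1 t w + c * N2 t w.
have aN : adapted F N.
  move=> t t0; have [sF _ _] := Ffilt; apply: (measurable_wrtD (sF t t0)); first exact: aN1.
  by apply: (measurable_wrtZ (sF t t0)); exact: aN2.
have pN : {ae P, forall w, [/\ N 0 w = 0, continuous_path (N ^~ w) &
    [/\ rescale_negative c (X 0 w) = 0,
     continuous_path (fun t => rescale_negative c (X t w) - N t w),
     finite_variation_path (fun t => rescale_negative c (X t w) - N t w) &
     forall t, 0 <= t -> stieltjes_integral (fun t => rescale_negative c (X t w) - N t w)
       \1_[set u | rescale_negative c (X u w) != 0] t = 0]]}.
  apply: filterS3 aeG pN1 pN2 => w Gw [cN1 N10 nd1 flat1] [cN2 N20 nd2 flat2].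
  have [cX X0 _ _ _] := GGood w Gw.
  have cN : continuous_path (N ^~ w).
    by apply: continuous_pathD => //; exact: continuous_pathZ.
  pose a1 t := Num.max (X' t w) 0 - N1 t w; pose a2 t := Num.max (oX' t w) 0 - N2 t w.
  have VE : (fun t => rescale_negative c (X t w) - N t w) = (fun t => a1 t + c * a2 t).
    apply/funext => t; rewrite /a1 /a2 /oX' /X' in_G// /N /rescale_negative.
    by ring.
  have cV : continuous_path (fun t => rescale_negative c (X t w) - N t w).
    by apply: continuous_pathB => //; exact: cR.
  have bV : finite_variation_path (fun t => rescale_negative c (X t w) - N t w).
    rewrite VE; apply: finite_variationD; first exact: nondecreasing_finite_variation.
    exact: finite_variationZ_nondecreasing.
  split => //; first by rewrite /N N10 N20 mulr0 addr0.
  split => //; first by rewrite X0 /rescale_negative !(oppr0, maxxx, mulr0, addr0).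
  move=> t t0; rewrite (zerosE c)//; apply: stieltjes_integral_flat => //.
  rewrite VE; apply: flat_off_zerosZD.
    have X'E : X' ^~ w = X ^~ w by apply/funext => u; rewrite /X' in_G.
    by rewrite -X'E.
  apply: flat_off_zerosN.
  have oX'E : oX' ^~ w = (fun u => - X u w) by apply/funext => u; rewrite /oX' /X' in_G.
  by rewrite -oX'E.
exists N, (fun t w => rescale_negative c (X t w) - N t w); split.
- by apply: aeW => w t _; rewrite addrC subrK.
- split; last by apply: filterS pN => w [_ cN _]; exact: cadlag_continuous_path.
  apply: (local_martingale_of_stopped aN (theta := theta)) => //.
  + by apply: filterS pN => w [].
  + by move=> w; case: (thetaP w).
  + move=> n; apply: (martingaleD Ffilt) => //; exact: (martingaleZ Ffilt).
- split.
    move=> t t0; have [sF _ _] := Ffilt; apply: (measurable_wrtB (sF t t0)); last exact: aN.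
    apply: (measurable_wrtD (sF t t0)).
      by apply: (measurable_wrt_max0 (sF t t0)); exact: aX.
    apply: (measurable_wrtZ (sF t t0)); apply: (measurable_wrt_max0 (sF t t0)).
    by under eq_fun do rewrite -mulN1r; apply: (measurable_wrtZ (sF t t0)); exact: aX.
  by apply: filterS pN => w [N0 _ [R0 cV bV _]]; split => //; rewrite R0 N0 subrr.
- by apply: filterS pN => w [_ _ [_ _ _ int0]].
Qed.

End change_negative_part.

Theorem theorem1 (R : realType) (d : measure_display) (T : measurableType d)
    (P : probability T R) (F : R -> set (set T))
    (F_filtration : filtration F) (F_usual : usual_conditions P F)
    (X : R -> T -> R) (X_adapted : adapted F X)
    (X_continuous : {ae P, forall w, continuous_path (X ^~ w)})
    (X0 : {ae P, forall w, X 0 w = 0}) :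
  class_Sigma P F X <-> class_Sigma P F (fun t w => `|X t w|).
Proof.
have XE : X = fun t w => rescale_negative (-1) (X t w).
  by apply/funext => t; apply/funext => w; rewrite rescale_negativeN1.
have absXE : (fun t w => `|X t w|) = fun t w => rescale_negative 1 (X t w).
  by apply/funext => t; apply/funext => w; rewrite rescale_negative1.
have N1 : -1 != 0 :> R by rewrite oppr_eq0 oner_eq0.
have rescale a b (a0 : a != 0) (b0 : b != 0) := class_Sigma_rescale_negative
  F_filtration F_usual a0 b0 X_adapted X_continuous X0.
rewrite absXE; split => [S|S].
  by apply: (rescale (-1)) => //; rewrite -XE.
by rewrite XE; apply: (rescale 1).
Qed.
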